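(* Let $c=5/4$, $\alpha>2$, $\lambda_b>0$, $P>0$, $\sigma_k^2\ge0$, $\omega>0$ be constants, $K\ge1$ an integer and $r_k\in\{1,\dots,2K\}$. Let $D_1,\dots,D_{2K}$ be i.i.d. with density $f_d(x)=2c\lambda_b\pi x e^{-c\lambda_b\pi x^2}$, $x\ge0$, and let $d$ be the $r_k$-th smallest of them. For $s,t\in\mathbb C$ with $\mathrm{Re}(s),\mathrm{Re}(t)>0$ define $$\varphi(s+t)=\mathbb{E}\left\{\exp\left(-\frac{\sigma_k^2}{P}(s+t)d^{\alpha}-\pi\lambda_b\,\omega\, d^2 (s+t)^{2/\alpha}\right)\right\}.$$ Then $$\varphi(s+t)=c\,r_k\binom{2K}{r_k}\sum_{l=0}^{r_k-1}\frac{(-1)^l\binom{r_k-1}{l}\,H_{1,1}^{1,1}\left(\frac{\sigma_k^2}{P}(s+t)\left(\pi\lambda_b\left((2K-r_k+l+1)c+\omega (s+t)^{2/\alpha}\right)\right)^{-\alpha/2}\right)}{(2K-r_k+l+1)c+\omega (s+t)^{2/\alpha}},$$ where $H_{1,1}^{1,1}(x)$ denotes $H_{1,1}^{1,1}\left(x\,\middle|\,\begin{smallmatrix}(0,\alpha/2)\\(0,1)\end{smallmatrix}\right)$, and, for fixed $s,t$, as $\sigma_k^2/P\to0$, $$\varphi(s+t)\to c\,r_k\binom{2K}{r_k}\sum_{l=0}^{r_k-1}\frac{(-1)^l\binom{r_k-1}{l}}{(2K-r_k+l+1)c+\omega(s+t)^{2/\alpha}}.$$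
   Context: Model: base stations form a homogeneous PPP of intensity $\lambda_b$; user-to-serving-BS distances are i.i.d. with density $f_d$. Under distance-based NOMA grouping, the $2K$ users of a cell are ranked by increasing distance; $d$ is the distance of the near user $k$, whose rank is $r_k$ (with $r_k$ smaller than the rank of its paired far user). $\sigma_k^2=\sigma^2\|\mathbf u_k\|^2$ is filtered noise power, $P$ transmit power per stream, $\omega>0$ a fixed interference-related constant (in the paper $\Gamma(1-2/\alpha)(\frac{\rho_I}{P}|\mathbf u_k^{\mathrm H}\mathbf 1|^2)^{2/\alpha}$). Principal branches for complex powers. Fox H-function: $H_{1,1}^{1,1}\left(x\,\middle|\,\begin{smallmatrix}(0,\alpha/2)\\(0,1)\end{smallmatrix}\right)=\frac{1}{2\pi \mathrm{i}}\int_{\mathcal L}\Gamma(\xi)\Gamma(1-\tfrac{\alpha}{2}\xi)x^{-\xi}d\xi$, with $\mathcal L$ a vertical line $\mathrm{Re}(\xi)=\gamma$, $0<\gamma<2/\alpha$.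
   Formalization: The closed form is stated for σ_k² > 0 instead of σ_k² ≥ 0: at σ_k² = 0 the argument of H is 0, where x^{-ξ} and hence the defining contour integral are undefined; the limit is taken as σ_k²/P → 0 from above. *)

(* Defs.v *)
From Stdlib Require Import Reals List.
From Coquelicot Require Import Coquelicot.
Open Scope R_scope.

Definition Cexp (z : C) : C := (exp (Re z) * cos (Im z), exp (Re z) * sin (Im z)).

Definition Carg (z : C) : R :=
  if Rlt_dec 0 (Im z) then acos (Re z / Cmod z)
  else if Rlt_dec (Im z) 0 then - acos (Re z / Cmod z)
  else if Rlt_dec (Re z) 0 then PI else 0.

Definition Clog (z : C) : C := (ln (Cmod z), Carg z).

Definition Cpowc (z w : C) : C := Cexp (w * Clog z)%C.

Definition CInt_0_inf (f : R -> C) : C :=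
  RInt_gen (V := C_R_CompleteNormedModule) f (at_right 0) (Rbar_locally p_infty).
Definition CInt_0c_inf (f : R -> C) : C :=
  RInt_gen (V := C_R_CompleteNormedModule) f (at_point 0) (Rbar_locally p_infty).
Definition CInt_R (f : R -> C) : C :=
  RInt_gen (V := C_R_CompleteNormedModule) f (Rbar_locally m_infty) (Rbar_locally p_infty).

(* Euler Gamma function, Gamma(z) = int_0^oo t^(z-1) e^(-t) dt  (used for Re z > 0) *)
Definition CGamma (z : C) : C :=
  CInt_0_inf (fun t => (Cpowc (RtoC t) (z - 1) * RtoC (exp (- t)))%C).

(* Fox H-function H_{1,1}^{1,1}( x | (0, alpha/2) ; (0, 1) ) as the Mellin-Barnes
   integral (1/(2 pi i)) int_L Gamma(xi) Gamma(1 - alpha/2 xi) x^(-xi) dxi over the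
   vertical line L = {Re xi = gam}, parametrised by xi = gam + i y, dxi = i dy. *)
Definition FoxH11 (alpha gam : R) (x : C) : C :=
  (/ (RtoC (2 * PI) * Ci) *
   CInt_R (fun y =>
     let xi := (RtoC gam + RtoC y * Ci)%C in
     (CGamma xi * CGamma (1 - RtoC (alpha / 2) * xi) * Cpowc x (- xi) * Ci)%C))%C.

Fixpoint insertR (x : R) (l : list R) : list R :=
  match l with
  | nil => x :: nil
  | y :: l' => if Rle_dec x y then x :: y :: l' else y :: insertR x l'
  end.

Fixpoint sortR (l : list R) : list R :=
  match l with
  | nil => nil
  | x :: l' => insertR x (sortR l')
  end.

(* the r-th smallest element of l (r counted from 1) *)
Definition kth_smallest (r : nat) (l : list R) : R := nth (r - 1) (sortR l) 0.

Fixpoint iter_int (n : nat) (F : list R -> C) : C :=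
  match n with
  | O => F nil
  | S m => CInt_0c_inf (fun x => iter_int m (fun l => F (x :: l)))
  end.

(* E[ g(X_(r)) ] where X_1..X_n are i.i.d. with density f supported on [0,+oo)
   and X_(r) is their r-th smallest value *)
Definition E_order_stat (n r : nat) (f : R -> R) (g : R -> C) : C :=
  iter_int n (fun l => (g (kth_smallest r l) * RtoC (fold_right Rmult 1 (map f l)))%C).

Definition c_const : R := 5 / 4.

Definition f_d (lb : R) (x : R) : R :=
  2 * c_const * lb * PI * x * exp (- (c_const * lb * PI * x ^ 2)).

(* phi(w) = E exp( - a w d^alpha - pi lambda_b omega d^2 w^(2/alpha) ),  with a = sigma_k^2/P,
   d the r-th smallest of 2K i.i.d. f_d distances *)
Definition phi (K r : nat) (alpha lb omega a : R) (w : C) : C :=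
  E_order_stat (2 * K) r (f_d lb)
    (fun d => Cexp (- (RtoC (a * Rpower d alpha) * w)
                    - RtoC (PI * lb * omega * d ^ 2) * Cpowc w (RtoC (2 / alpha)))%C).

Fixpoint Csum (n : nat) (f : nat -> C) : C :=
  match n with
  | O => RtoC 0
  | S m => (Csum m f + f m)%C
  end.

Definition denom (K r l : nat) (alpha omega : R) (w : C) : C :=
  (RtoC (INR (2 * K - r + l + 1) * c_const) + RtoC omega * Cpowc w (RtoC (2 / alpha)))%C.

(* Main.v *)
Require Import Defs.
From Stdlib Require Import Reals List Lra Lia ClassicalEpsilon.
From Coquelicot Require Import Coquelicot.
Open Scope R_scope.

(** The expectation over the iterated integrals is reduced, one variable at a time, to a single
    integral against the density of the order statistic: inserting a value [x] in a sorted list with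
    neighbouring entries [a <= b] gives [G (max a (min b x)) = G (max a x) + G (min b x) - G x], and
    the resulting outer integral has an explicit antiderivative.  Expanding the density by the
    binomial theorem leaves the integrals of [exp (- A u - b u^(alpha/2))] over [u > 0], with
    [A = pinfty lb denom] and [b = (sig2 / P) (s + t)] in the right half-plane.  There
    [exp (- b u^(alpha/2))] is written as an inverse Mellin integral and Fubini's theorem is applied;
    the integral over [u] is a Gamma function, by rotation of the contour, and what remains is the
    Fox H-function because [Clog b - (alpha/2) Clog A] lies in the principal strip.  Mellin inversion
    for [exp] follows from the Poisson kernel and the bound [O(1/(1+y^2))] for the Gamma function on
    vertical lines, which two applications of its functional equation provide.  The limit
    [sig2 / P -> 0] is dominated convergence in the same integrals. *)

(** All integrals are improper Riemann integrals, so every interchange of limits rests on a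
    continuous integrable majorant [m], which controls the ends of the range for all functions below
    it at once. To get continuous integrands on the whole line, the Mellin and Laplace integrals
    over [u > 0] are rewritten with [u = exp t]; powers of [u] become exponentials, and the
    majorants are multiples of [exp (- x * Rabs t)] and [/ (1 + y * y)]. The obstacle on the
    vertical line is that [b^(-xi)] grows exponentially in one direction when [b] is not real, at a
    rate that can come close to the decay rate of Gamma. Estimates of Gamma alone would have to be
    sharp. Instead [Gamma(xi) b^(-xi)] is kept as one function, the Mellin transform of
    [exp (- b u)], and its functional equation bounds the product directly. The condition
    [2 < alpha] is geometric: [(s + t)^(2/alpha)] lies in the sector of half-angle
    [PI / alpha < PI / 2], which is stable under adding positive reals, and multiplying angles by
    [alpha / 2] leaves them below [PI / 2]. Together with the bound [PI / 2] on the angle of [b],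
    this excludes a jump of the logarithm. *)

Local Notation CR := C_R_CompleteNormedModule.
Local Notation minfty := (Rbar_locally m_infty).
Local Notation pinfty := (Rbar_locally p_infty).

(** * Dominated improper integrals *)

Lemma minus_plus_middle {G : AbelianGroup} (x y z : G) :
  minus (plus x (plus y z)) y = plus x z.
Proof.
  change (plus (plus x (plus y z)) (opp y) = plus x z).
  rewrite (plus_comm y z), plus_assoc, <- (plus_assoc (plus x z)), plus_opp_r.
  apply plus_zero_r.
Qed.

Section Dominated.
Context {V : CompleteNormedModule R_AbsRing}.

Lemma norm_minus_triangle (x y z : V) :
  norm (minus x z) <= norm (minus x y) + norm (minus y z).
Proof. rewrite (minus_trans (G := V) y x z). apply (norm_triangle (V := V)). Qed.

Lemma norm_minus_sym (x y : V) : norm (minus x y) = norm (minus y x).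
Proof. rewrite <- (norm_opp (V := V)). f_equal. apply (opp_minus (G := V)). Qed.

Lemma ex_RInt_cont (f : R -> V) a b : (forall x, continuous f x) -> ex_RInt f a b.
Proof. intros H; apply (ex_RInt_continuous (V := V)); intros; apply H. Qed.

Lemma norm_RInt_le_any (f : R -> V) (m : R -> R) a b :
  (forall x, continuous f x) -> (forall x, continuous m x) ->
  (forall x, norm (f x) <= m x) -> norm (RInt f a b) <= Rabs (RInt m a b).
Proof.
  intros Cf Cm H.
  assert (L : forall a b, a <= b -> norm (RInt f a b) <= RInt m a b).
  { intros u v Huv.
    apply (norm_RInt_le f m u v); auto.
    - apply RInt_correct, ex_RInt_cont; auto.
    - apply (RInt_correct (V := R_CompleteNormedModule)).
      apply (ex_RInt_continuous (V := R_CompleteNormedModule)); auto. }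
  destruct (Rle_lt_dec a b) as [h|h].
  - eapply Rle_trans; [apply L; auto|apply Rle_abs].
  - rewrite <- (opp_RInt_swap f) by (apply ex_RInt_cont; auto).
    rewrite (norm_opp (V := V)).
    rewrite <- (opp_RInt_swap (V := R_CompleteNormedModule) m)
      by (apply (ex_RInt_continuous (V := R_CompleteNormedModule)); auto).
    change (opp (RInt m b a)) with (- RInt m b a). rewrite Rabs_Ropp.
    eapply Rle_trans; [apply L; lra|apply Rle_abs].
Qed.

Lemma minus_RInt (f : R -> V) a b a' b' :
  (forall x, continuous f x) ->
  minus (RInt f a b) (RInt f a' b') = plus (RInt f a a') (RInt f b' b).
Proof.
  intros Cf.
  rewrite <- (RInt_Chasles f a a' b) by (apply ex_RInt_cont; auto).
  rewrite <- (RInt_Chasles f a' b' b) by (apply ex_RInt_cont; auto).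
  apply (minus_plus_middle (G := V)).
Qed.

Context {Fa Fb : (R -> Prop) -> Prop} {PFa : ProperFilter Fa} {PFb : ProperFilter Fb}.

(** The sets [P] and [Q] come from [m] alone and so serve every [f] below [m]; parameter continuity,
    dominated limits and Fubini all rest on this uniformity. Changing the ends costs two end pieces,
    each bounded by the same piece of the integral of [m], which is a difference of two values
    within [eps / 4] of [M]. *)
Lemma dominated_cauchy (m : R -> R) (M : R) :
  (forall x, continuous m x) -> is_RInt_gen m Fa Fb M ->
  forall eps : posreal, exists P Q, Fa P /\ Fb Q /\
    forall f : R -> V, (forall x, continuous f x) -> (forall x, norm (f x) <= m x) ->
    forall a b a' b', P a -> Q b -> P a' -> Q b' ->
      norm (minus (RInt f a b) (RInt f a' b')) < eps.
Proof.
  intros Cm Hm eps.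
  assert (He : 0 < eps / 4) by (destruct eps; simpl; lra).
  assert (H := proj1 (filterlimi_locally _ _) Hm (mkposreal _ He)).
  destruct H as [P Q HP HQ H].
  exists P, Q; repeat split; auto.
  assert (K : forall a b, P a -> Q b -> Rabs (RInt m a b - M) < eps / 4).
  { intros a b Ha Hb. destruct (H a b Ha Hb) as [z [Hz Bz]]. simpl in Hz.
    rewrite (is_RInt_unique _ _ _ _ Hz). apply Bz. }
  assert (E : forall a b, ex_RInt m a b).
  { intros; apply (ex_RInt_continuous (V := R_CompleteNormedModule)); auto. }
  assert (Ch : forall a b c, RInt m a b + RInt m b c = RInt m a c).
  { intros; apply (RInt_Chasles (V := R_CompleteNormedModule)); auto. }
  intros f Cf Hf a b a' b' Ha Hb Ha' Hb'.
  rewrite minus_RInt by auto.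
  eapply Rle_lt_trans; [apply (norm_triangle (V := V))|].
  assert (H1 := norm_RInt_le_any f m a a' Cf Cm Hf).
  assert (H2 := norm_RInt_le_any f m b' b Cf Cm Hf).
  assert (H3 := K a b Ha Hb). assert (H4 := K a' b Ha' Hb). assert (H5 := K a b' Ha Hb').
  generalize (Ch a a' b) (Ch a b' b); intros C1 C2.
  assert (Rabs (RInt m a a') < eps / 2).
  { apply Rabs_def2 in H3; apply Rabs_def2 in H4. apply Rabs_def1; lra. }
  assert (Rabs (RInt m b' b) < eps / 2).
  { apply Rabs_def2 in H3; apply Rabs_def2 in H5. apply Rabs_def1; lra. }
  lra.
Qed.

Lemma dominated_ex (f : R -> V) (m : R -> R) (M : R) :
  (forall x, continuous m x) -> is_RInt_gen m Fa Fb M ->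
  (forall x, continuous f x) -> (forall x, norm (f x) <= m x) -> ex_RInt_gen f Fa Fb.
Proof.
  intros Cm Hm Cf Hf.
  (* The Cauchy criterion for limits of relations asks that each pair of ends have exactly one
     integral; continuity provides existence. *)
  apply (proj1 (filterlimi_locally_cauchy (U := V) (F := filter_prod Fa Fb)
    (fun ab : R * R => is_RInt f (fst ab) (snd ab))
    (filter_forall _ (fun ab => conj (ex_RInt_cont f (fst ab) (snd ab) Cf)
      (fun y1 y2 H1 H2 => eq_trans (eq_sym (is_RInt_unique _ _ _ _ H1)) (is_RInt_unique _ _ _ _ H2)))))).
  intros eps. destruct (dominated_cauchy m M Cm Hm eps) as (P & Q & HP & HQ & H).
  exists (fun ab => P (fst ab) /\ Q (snd ab)). split.
  - apply (Filter_prod _ _ _ P Q); auto.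
  - intros [a b] [a' b'] [Ha Hb] [Ha' Hb'] u v Hu Hv; simpl in *.
    rewrite <- (is_RInt_unique _ _ _ _ Hu), <- (is_RInt_unique _ _ _ _ Hv).
    apply (norm_compat1 (V := V)). apply H; auto.
Qed.

Lemma dominated_tail (m : R -> R) (M : R) :
  (forall x, continuous m x) -> is_RInt_gen m Fa Fb M ->
  forall eps : posreal, exists P Q, Fa P /\ Fb Q /\
    forall f : R -> V, (forall x, continuous f x) -> (forall x, norm (f x) <= m x) ->
    forall a b, P a -> Q b ->
      norm (minus (RInt_gen f Fa Fb) (RInt f a b)) < eps.
Proof.
  intros Cm Hm eps.
  assert (He : 0 < eps / 2) by (destruct eps; simpl; lra).
  destruct (dominated_cauchy m M Cm Hm (mkposreal _ He)) as (P & Q & HP & HQ & H).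
  exists P, Q; repeat split; auto. intros f Cf Hf a b Ha Hb.
  assert (E := RInt_gen_correct f (dominated_ex f m M Cm Hm Cf Hf)).
  assert (E' := E _ (locally_ball_norm (V := V) (RInt_gen f Fa Fb) (mkposreal _ He))).
  assert (HPQ : filter_prod Fa Fb (fun ab => P (fst ab) /\ Q (snd ab)))
    by (apply (Filter_prod _ _ _ P Q); auto).
  destruct (filter_ex (F := filter_prod Fa Fb) _ (filter_and (F := filter_prod Fa Fb) _ _ E' HPQ)) as [[a' b'] [[z [Hz Bz]] [Ha' Hb']]].
  simpl in Hz, Ha', Hb'. rewrite <- (is_RInt_unique _ _ _ _ Hz) in Bz.
  assert (X := H f Cf Hf a' b' a b Ha' Hb' Ha Hb). simpl in X.
  assert (Bz' : norm (minus (RInt f a' b') (RInt_gen f Fa Fb)) < eps / 2) by exact Bz.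
  assert (T := norm_minus_triangle (RInt_gen f Fa Fb) (RInt f a' b') (RInt f a b)).
  rewrite norm_minus_sym in Bz'. lra.
Qed.

Lemma dominated_norm_le (f : R -> V) (m : R -> R) (M : R) :
  (forall x, continuous m x) -> is_RInt_gen m Fa Fb M ->
  (forall x, continuous f x) -> (forall x, norm (f x) <= m x) ->
  norm (RInt_gen f Fa Fb) <= Rabs M.
Proof.
  intros Cm Hm Cf Hf. apply le_epsilon; intros eps He.
  assert (He2 : 0 < eps / 2) by lra.
  destruct (dominated_tail m M Cm Hm (mkposreal _ He2)) as (P & Q & HP & HQ & H).
  assert (E' := proj1 (filterlimi_locally _ _) Hm (mkposreal _ He2)).
  assert (HPQ : filter_prod Fa Fb (fun ab => P (fst ab) /\ Q (snd ab)))
    by (apply (Filter_prod _ _ _ P Q); auto).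
  destruct (filter_ex (F := filter_prod Fa Fb) _ (filter_and (F := filter_prod Fa Fb) _ _ E' HPQ)) as [[a b] [[z [Hz Bz]] [Ha Hb]]].
  simpl in Hz, Ha, Hb. specialize (H f Cf Hf a b Ha Hb). simpl in H.
  assert (N := norm_RInt_le_any f m a b Cf Cm Hf).
  rewrite (is_RInt_unique _ _ _ _ Hz) in N.
  assert (B : Rabs (z - M) < eps / 2) by apply Bz.
  assert (Eq : plus (minus (RInt_gen f Fa Fb) (RInt f a b)) (RInt f a b) = RInt_gen f Fa Fb).
  { generalize (RInt_gen f Fa Fb) (RInt f a b). intros x y.
    change (plus (plus x (opp y)) y = x).
    rewrite <- (plus_assoc (G := V)), (plus_opp_l (G := V)). apply (plus_zero_r (G := V)). }
  assert (T : norm (RInt_gen f Fa Fb) <=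
    norm (minus (RInt_gen f Fa Fb) (RInt f a b)) + norm (RInt f a b)).
  { rewrite <- Eq at 1. apply (norm_triangle (V := V)). }
  assert (Rabs z <= Rabs M + Rabs (z - M)).
  { replace z with (M + (z - M)) at 1 by ring. apply Rabs_triang. }
  lra.
Qed.

(** Convergence is required on bounded intervals only: one pair of ends makes the remaining parts of
    all [f u] and of [g] smaller than [eps / 3] simultaneously. *)
Lemma dominated_filterlim {T : Type} {F : (T -> Prop) -> Prop} {FF : Filter F}
  (f : T -> R -> V) (g : R -> V) (m : R -> R) (M : R) :
  (forall x, continuous m x) -> is_RInt_gen m Fa Fb M ->
  F (fun u => (forall x, continuous (f u) x) /\ (forall x, norm (f u x) <= m x)) ->
  (forall x, continuous g x) -> (forall x, norm (g x) <= m x) ->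
  (forall a b, filterlim (fun u => RInt (f u) a b) F (locally (RInt g a b))) ->
  filterlim (fun u => RInt_gen (f u) Fa Fb) F (locally (RInt_gen g Fa Fb)).
Proof.
  intros Cm Hm HF Cg Hg Hl.
  apply (filterlim_locally_ball_norm (U := V)). intros eps.
  assert (He : 0 < eps / 3) by (destruct eps; simpl; lra).
  destruct (dominated_tail m M Cm Hm (mkposreal _ He)) as (P & Q & HP & HQ & H).
  destruct (filter_ex _ HP) as [a Ha]. destruct (filter_ex _ HQ) as [b Hb].
  assert (L := Hl a b _ (locally_ball_norm (V := V) (RInt g a b) (mkposreal _ He))).
  unfold filtermap in L.
  generalize (filter_and _ _ HF L). apply filter_imp. intros u [[Cu Hu] Bu].
  assert (H1 := H _ Cu Hu a b Ha Hb). assert (H2 := H _ Cg Hg a b Ha Hb).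
  assert (Bu' : norm (minus (RInt (f u) a b) (RInt g a b)) < eps / 3) by exact Bu.
  simpl in H1, H2. change (norm (minus (RInt_gen (f u) Fa Fb) (RInt_gen g Fa Fb)) < eps).
  rewrite norm_minus_sym in H2.
  assert (T1 := norm_minus_triangle (RInt_gen (f u) Fa Fb) (RInt (f u) a b) (RInt_gen g Fa Fb)).
  assert (T2 := norm_minus_triangle (RInt (f u) a b) (RInt g a b) (RInt_gen g Fa Fb)).
  lra.
Qed.

End Dominated.

(** * Parameter integrals and Fubini *)

Definition cont2 {V : UniformSpace} (f : R -> R -> V) :=
  forall p : R * R, continuous (fun p : R * R => f (fst p) (snd p)) p.

Lemma cont2_swap {V : UniformSpace} (f : R -> R -> V) : cont2 f -> cont2 (fun x y => f y x).
Proof.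
  intros H [x y].
  apply (continuous_comp_2 (fun p : R * R => snd p) (fun p : R * R => fst p) (fun a b => f a b)).
  - apply continuous_snd.
  - apply continuous_fst.
  - apply H.
Qed.

Lemma cont2_r {V : UniformSpace} (f : R -> R -> V) x : cont2 f -> forall y, continuous (f x) y.
Proof.
  intros H y.
  apply (continuous_comp_2 (fun _ : R => x) (fun y : R => y) (fun a b => f a b)).
  - apply continuous_const.
  - apply continuous_id.
  - apply H.
Qed.

Lemma cont2_l {V : UniformSpace} (f : R -> R -> V) y :
  cont2 f -> forall x, continuous (fun x => f x y) x.
Proof. intros H; apply (cont2_r (fun y x => f x y)), cont2_swap, H. Qed.

Section Param.
Context {V : CompleteNormedModule R_AbsRing}.

(** Compactness of [[a, b]]: joint continuity at [(x0, t)] gives a radius for each [t], and finitely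
    many of these intervals cover. *)
Lemma cont2_unif (f : R -> R -> V) x0 a b : cont2 f ->
  forall eps : posreal, exists d : posreal, forall x, Rabs (x - x0) < d ->
    forall t, a <= t <= b -> norm (minus (f x t) (f x0 t)) < eps.
Proof.
  intros H eps.
  assert (He : 0 < eps / 2) by (destruct eps; simpl; lra).
  assert (D : forall t, exists d : posreal, forall x u, Rabs (x - x0) < d -> Rabs (u - t) < d ->
    norm (minus (f x u) (f x0 t)) < eps / 2).
  { intros t.
    destruct (H (x0, t) _ (locally_ball_norm (V := V) (f x0 t) (mkposreal _ He))) as [d Hd].
    exists d. intros x u Hx Hu. apply (Hd (x, u)). split; assumption. }
  set (D' := fun t => proj1_sig (constructive_indefinite_description _ (D t))).
  assert (HD : forall t x u, Rabs (x - x0) < D' t -> Rabs (u - t) < D' t ->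
    norm (minus (f x u) (f x0 t)) < eps / 2)
    by (intros t; exact (proj2_sig (constructive_indefinite_description _ (D t)))).
  (* The covering property for the gauge [D'] is delivered in doubly negated form, hence the detour
     through [NNPP]. *)
  destruct (compactness_value_1d a b D') as [d Hd].
  exists d. intros x Hx t Ht. apply NNPP. intros N. apply (Hd t Ht).
  intros [u [Hu [Htu Hdu]]]. apply N.
  assert (T := norm_minus_triangle (f x t) (f x0 u) (f x0 t)).
  assert (H1 := HD u x t ltac:(lra) Htu).
  assert (H2 := HD u x0 t ltac:(replace (x0 - x0) with 0 by ring; rewrite Rabs_R0; apply cond_pos) Htu).
  rewrite norm_minus_sym in H2. lra.
Qed.

Lemma RInt_param_continuous (f : R -> R -> V) a b x0 :
  cont2 f -> continuous (fun x => RInt (f x) a b) x0.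
Proof.
  intros H.
  (* The case of ordered ends; this local name is unrelated to the kernel of the Mellin transform
     defined later. *)
  assert (mellin_kernel : forall a b, a <= b -> continuous (fun x => RInt (f x) a b) x0).
  { clear a b; intros a b Hab.
    apply (filterlim_locally_ball_norm (U := V)). intros eps.
    (* The [+ 1] keeps the denominator positive when [a = b] and the final inequality strict. *)
    assert (He : 0 < eps / (b - a + 1)) by (apply Rdiv_lt_0_compat; [apply cond_pos|lra]).
    destruct (cont2_unif f x0 a b H (mkposreal _ He)) as [d Hd].
    exists d. intros x Hx.
    assert (E : norm (minus (RInt (f x) a b) (RInt (f x0) a b)) <= (b - a) * (eps / (b - a + 1))).
    { rewrite <- (RInt_minus (f x) (f x0)) by (apply ex_RInt_cont, cont2_r, H).
      apply (norm_RInt_le_const (V := V) (fun t => minus (f x t) (f x0 t)) a b); auto.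
      - intros t Ht. apply Rlt_le, (Hd x Hx t Ht).
      - apply RInt_correct. apply ex_RInt_minus; apply ex_RInt_cont, cont2_r, H. }
    change (norm (minus (RInt (f x) a b) (RInt (f x0) a b)) < eps).
    eapply Rle_lt_trans; [apply E|].
    assert (0 < eps) by apply cond_pos.
    replace ((b - a) * (eps / (b - a + 1))) with (eps - eps / (b - a + 1)) by (field; lra). lra. }
  destruct (Rle_lt_dec a b) as [h|h]; [auto|].
  apply (continuous_ext (fun x => opp (RInt (f x) b a))).
  - intros x. apply (opp_RInt_swap (f x)). apply ex_RInt_cont, cont2_r, H.
  - apply (continuous_opp (V := V)). apply mellin_kernel; lra.
Qed.
End Param.

(** As functions of the upper limit [b], both sides have derivative [RInt (f b) c d], the right one
    by differentiation under the integral sign, and both vanish at [b = a]. *)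
Lemma Fubini_finite_R (f : R -> R -> R) a b c d : cont2 f ->
  RInt (fun x => RInt (fun y => f x y) c d) a b = RInt (fun y => RInt (fun x => f x y) a b) c d.
Proof.
  intros H.
  assert (Er : forall x u v, ex_RInt (f x) u v).
  { intros; apply (ex_RInt_cont (V := R_CompleteNormedModule)), cont2_r, H. }
  assert (El : forall y u v, ex_RInt (fun x => f x y) u v).
  { intros; apply (ex_RInt_cont (V := R_CompleteNormedModule)), cont2_l, H. }
  assert (Cr : forall u v x, continuous (fun x => RInt (f x) u v) x).
  { intros; apply (RInt_param_continuous (V := R_CompleteNormedModule)), H. }
  assert (Cl : forall u v x, continuous (fun y => RInt (fun x => f x y) u v) x).
  { intros; apply (RInt_param_continuous (V := R_CompleteNormedModule) (fun y x => f x y)), cont2_swap, H. }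
  assert (Hd : forall y t, is_derive (fun z => RInt (fun x => f x y) a z) t (f t y)).
  { intros y t. apply (is_derive_RInt (fun x => f x y) (fun z => RInt (fun x => f x y) a z) a t).
    - apply filter_forall; intros z. apply (RInt_correct (V := R_CompleteNormedModule)), El.
    - apply (cont2_l f), H. }
  set (D := fun t => RInt (fun x => RInt (f x) c d) a t
              - RInt (fun y => RInt (fun x => f x y) a t) c d).
  assert (HD : forall t, is_derive D t 0).
  { intros t. unfold D.
    replace 0 with (RInt (f t) c d - RInt (fun y => Derive (fun z => RInt (fun x => f x y) a z) t) c d).
    2: { rewrite (RInt_ext (V := R_CompleteNormedModule)
           (fun y => Derive (fun z => RInt (fun x => f x y) a z) t) (f t)); [ring|].
         intros y _. apply is_derive_unique, Hd. }
    apply (is_derive_minus (K := R_AbsRing) (V := R_NormedModule)).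
    - apply (is_derive_RInt (fun x => RInt (f x) c d) _ a t).
      + apply filter_forall; intros z. apply (RInt_correct (V := R_CompleteNormedModule)).
        apply (ex_RInt_cont (V := R_CompleteNormedModule)). auto.
      + auto.
    - apply (is_derive_RInt_param (fun t y => RInt (fun x => f x y) a t)).
      + apply filter_forall. intros z y _. eexists. apply Hd.
      + intros y _. apply continuity_2d_pt_ext with f.
        * intros u v. symmetry. apply is_derive_unique, Hd.
        * apply continuity_2d_pt_filterlim. apply (H (t, y)).
      + apply filter_forall; intros z. apply (ex_RInt_cont (V := R_CompleteNormedModule)). auto. }
  assert (Eq : D a = D b).
  { destruct (Rtotal_order a b) as [h|[h|h]].
    - apply (eq_is_derive (V := R_NormedModule) D a b); auto.
    - now rewrite h.
    - symmetry. apply (eq_is_derive (V := R_NormedModule) D b a); auto. }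
  unfold D in Eq. rewrite (RInt_point (V := R_CompleteNormedModule)) in Eq.
  rewrite (RInt_ext (V := R_CompleteNormedModule) (fun y => RInt (fun x => f x y) a a) (fun _ => 0)) in Eq.
  2: { intros y _. apply (RInt_point (V := R_CompleteNormedModule)). }
  rewrite RInt_const in Eq. unfold scal in Eq; simpl in Eq; unfold mult, zero in Eq; simpl in Eq.
  apply Rminus_diag_uniq. refine (eq_trans (eq_sym Eq) _). ring.
Qed.


Lemma RInt_C (f : R -> C) a b : (forall x, continuous f x) ->
  RInt (V := CR) f a b = (RInt (fun x => fst (f x)) a b, RInt (fun x => snd (f x)) a b).
Proof.
  intros H. apply is_RInt_unique.
  assert (E : ex_RInt (V := CR) f a b) by (apply (ex_RInt_cont (V := CR)); auto).
  apply (is_RInt_fct_extend_pair (U := R_NormedModule) (V := R_NormedModule) f).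
  - apply (RInt_correct (V := R_CompleteNormedModule)).
    apply (ex_RInt_fct_extend_fst (U := R_NormedModule) (V := R_NormedModule)). apply E.
  - apply (RInt_correct (V := R_CompleteNormedModule)).
    apply (ex_RInt_fct_extend_snd (U := R_NormedModule) (V := R_NormedModule)). apply E.
Qed.

Lemma Fubini_finite (f : R -> R -> C) a b c d : cont2 f ->
  RInt (V := CR) (fun x => RInt (V := CR) (fun y => f x y) c d) a b =
  RInt (V := CR) (fun y => RInt (V := CR) (fun x => f x y) a b) c d.
Proof.
  intros H.
  rewrite !RInt_C.
  - f_equal.
    + erewrite RInt_ext. 2: { intros x _. rewrite RInt_C by (apply cont2_r, H). simpl. reflexivity. }
      erewrite (RInt_ext (fun x => fst (RInt (V := CR) _ _ _))).
      2: { intros y _. rewrite RInt_C by (apply (cont2_l f), H). simpl. reflexivity. }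
      apply Fubini_finite_R. intros p.
      apply (continuous_comp (fun p => f (fst p) (snd p)) fst). apply H. 
      destruct (f (fst p) (snd p)). apply continuous_fst.
    + erewrite RInt_ext. 2: { intros x _. rewrite RInt_C by (apply cont2_r, H). simpl. reflexivity. }
      erewrite (RInt_ext (fun x => snd (RInt (V := CR) _ _ _))).
      2: { intros y _. rewrite RInt_C by (apply (cont2_l f), H). simpl. reflexivity. }
      apply Fubini_finite_R. intros p.
      apply (continuous_comp (fun p => f (fst p) (snd p)) snd). apply H. 
      destruct (f (fst p) (snd p)). apply continuous_snd.
  - intros y. apply (RInt_param_continuous (V := CR) (fun y x => f x y)), cont2_swap, H.
  - intros y. apply (RInt_param_continuous (V := CR)), H.
Qed.

Lemma continuous_scal_R (m : R -> R) k x : continuous m x -> continuous (fun x => k * m x) x.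
Proof. intros; apply (continuous_scal_r (K := R_AbsRing) (V := R_NormedModule)); auto. Qed.

Lemma is_RInt_gen_scal_R (m : R -> R) k M Fa Fb {FFa : Filter Fa} {FFb : Filter Fb} :
  is_RInt_gen m Fa Fb M -> is_RInt_gen (fun x => k * m x) Fa Fb (k * M).
Proof. intros; apply (is_RInt_gen_scal (V := R_NormedModule)); auto. Qed.

(** * Fubini's theorem for improper integrals under a product majorant *)

Section FubiniDominated.
Context {V : CompleteNormedModule R_AbsRing}.
Context {Fa Fb Fc Fd : (R -> Prop) -> Prop} {PFa : ProperFilter Fa} {PFb : ProperFilter Fb}
  {PFc : ProperFilter Fc} {PFd : ProperFilter Fd}.

Lemma RInt_gen_param_continuous (f : R -> R -> V) (m : R -> R) (M : R) x0 :
  cont2 f -> (forall x, continuous m x) -> is_RInt_gen m Fc Fd M ->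
  locally x0 (fun x => forall y, norm (f x y) <= m y) ->
  continuous (fun x => RInt_gen (f x) Fc Fd) x0.
Proof.
  intros H Cm Hm Hd. apply (dominated_filterlim (V := V) f (f x0) m M); auto.
  - revert Hd. apply filter_imp. intros x Hx; split; auto. apply cont2_r, H.
  - apply cont2_r, H.
  - apply (locally_singleton _ _ Hd).
  - intros a b. apply RInt_param_continuous, H.
Qed.

(** Applied to the slices [f x] of a function below [m x * n y]: the factor [k = m x] varies with
    the slice, but after division by [k] all slices share the same [P] and [Q]. *)
Lemma dominated_tail_scal (m : R -> R) (M : R) :
  (forall x, continuous m x) -> is_RInt_gen m Fc Fd M ->
  forall eps : posreal, exists P Q, Fc P /\ Fd Q /\
    forall (f : R -> V) k, 0 < k -> (forall x, continuous f x) -> (forall x, norm (f x) <= k * m x) ->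
    forall a b, P a -> Q b ->
      norm (minus (RInt_gen f Fc Fd) (RInt f a b)) <= k * eps.
Proof.
  intros Cm Hm eps.
  destruct (dominated_tail (V := V) m M Cm Hm eps) as (P & Q & HP & HQ & H).
  exists P, Q; repeat split; auto. intros f k Hk Cf Hf a b Ha Hb.
  assert (C1 : forall x, continuous (fun x => scal (/ k) (f x)) x).
  { intros x; apply (continuous_scal_r (V := V)); auto. }
  assert (Ef : ex_RInt_gen f Fc Fd).
  { apply (dominated_ex f (fun x => k * m x) (k * M)); auto.
    - intros; apply continuous_scal_R; auto.
    - apply is_RInt_gen_scal_R; auto; apply filter_filter'. }
  assert (X := H (fun x => scal (/ k) (f x)) C1).
  assert (Hk' : 0 < / k) by (apply Rinv_0_lt_compat; auto).
  assert (N : forall (l : R) (v : V), 0 < l -> norm (scal l v) <= l * norm v).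
  { intros l v Hl. assert (Z := norm_scal (V := V) l v). unfold abs in Z; simpl in Z.
    rewrite Rabs_pos_eq in Z by lra. exact Z. }
  assert (N2 : forall v : V, norm v <= k * norm (scal (/ k) v)).
  { intros v. assert (Z := N k (scal (/ k) v) Hk). rewrite (scal_assoc (V := V)) in Z.
    unfold mult in Z; simpl in Z. rewrite Rinv_r in Z by lra.
    rewrite (scal_one (V := V)) in Z. exact Z. }
  assert (Y : forall x, norm (scal (/ k) (f x)) <= m x).
  { intros x. eapply Rle_trans; [apply N; auto|]. apply (Rmult_le_reg_l k); auto.
    rewrite <- Rmult_assoc, Rinv_r, Rmult_1_l; auto; lra. }
  specialize (X Y a b Ha Hb).
  assert (E1 : RInt_gen (fun x => scal (/ k) (f x)) Fc Fd = scal (/ k) (RInt_gen f Fc Fd)).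
  { apply is_RInt_gen_unique. apply (is_RInt_gen_scal (V := V)). apply RInt_gen_correct, Ef. }
  assert (E2 : RInt (fun x => scal (/ k) (f x)) a b = scal (/ k) (RInt f a b)).
  { apply (RInt_scal (V := V)). apply ex_RInt_cont; auto. }
  rewrite E1, E2 in X.
  assert (X' : norm (scal (/ k) (minus (RInt_gen f Fc Fd) (RInt f a b))) < eps).
  { rewrite (scal_minus_distr_l (V := V)). exact X. }
  eapply Rle_trans; [apply N2|]. apply Rmult_le_compat_l; lra.
Qed.

(** The point is the second half of the conclusion: rectangles approximate the iterated integral,
    with the ends in the two variables chosen independently, so that the two orders of integration
    can be compared on one rectangle. *)
Lemma iterated_dominated (f : R -> R -> V) (m n : R -> R) (M N : R) :
  cont2 f -> (forall x, continuous m x) -> (forall x, continuous n x) ->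
  (forall x, 0 < m x) -> (forall x, 0 < n x) ->
  is_RInt_gen m Fa Fb M -> is_RInt_gen n Fc Fd N ->
  (forall x y, norm (f x y) <= m x * n y) ->
  exists X, is_RInt_gen (fun x => RInt_gen (f x) Fc Fd) Fa Fb X /\
   forall eps : posreal, exists P Q P' Q', Fa P /\ Fb Q /\ Fc P' /\ Fd Q' /\
    forall a b c d, P a -> Q b -> P' c -> Q' d ->
     norm (minus X (RInt (fun x => RInt (f x) c d) a b)) < eps.
Proof.
  intros H Cm Cn Pm Pn Hm Hn Hd.
  set (I := fun x => RInt_gen (f x) Fc Fd).
  assert (CI : forall x, continuous I x).
  (* Near [x] the continuous function [m] stays below [m x + 1], which yields one majorant for all
     neighbouring slices. *)
  { intros x. apply (RInt_gen_param_continuous f (fun y => (m x + 1) * n y) ((m x + 1) * N)); auto.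
    - intros; apply continuous_scal_R; auto.
    - apply is_RInt_gen_scal_R; auto; apply filter_filter'.
    - assert (L := Cm x _ (locally_ball (m x) (mkposreal _ Rlt_0_1))).
      unfold filtermap in L. revert L. apply filter_imp. intros u Hu y. eapply Rle_trans; [apply Hd|].
      apply Rmult_le_compat_r. apply Rlt_le, Pn.
      assert (B : Rabs (m u - m x) < 1) by exact Hu. apply Rabs_def2 in B. lra. }
  assert (CmN : forall x, continuous (fun x => Rabs N * m x) x) by (intros; apply continuous_scal_R; auto).
  assert (HmN : is_RInt_gen (fun x => Rabs N * m x) Fa Fb (Rabs N * M)).
  { apply is_RInt_gen_scal_R; auto; apply filter_filter'. }
  assert (BI : forall x, norm (I x) <= Rabs N * m x).
  { intros x. rewrite Rmult_comm. rewrite <- (Rabs_pos_eq (m x)) by (apply Rlt_le, Pm).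
    rewrite <- Rabs_mult.
    apply (dominated_norm_le (f x) (fun y => m x * n y)).
    - intros; apply continuous_scal_R; auto.
    - apply is_RInt_gen_scal_R; auto; apply filter_filter'.
    - apply cont2_r, H.
    - auto. }
  exists (RInt_gen I Fa Fb). split.
  { apply RInt_gen_correct. apply (dominated_ex I _ _ CmN HmN CI BI). }
  intros eps.
  assert (He : 0 < eps / 2) by (destruct eps; simpl; lra).
  assert (HM : 0 < Rabs M + 1) by (generalize (Rabs_pos M); lra).
  (* The inner truncation error at [x] is at most this number times [m x]; over [[a, b]] the
     integral of [m] is within [1] of [M], so the errors add up to at most [eps / 2]. *)
  assert (He' : 0 < (eps / 2) / (Rabs M + 1)) by (apply Rdiv_lt_0_compat; auto).
  destruct (dominated_tail (V := V) _ _ CmN HmN (mkposreal _ He)) as (P1 & Q1 & HP1 & HQ1 & T1).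
  destruct (dominated_tail_scal n N Cn Hn (mkposreal _ He')) as (P' & Q' & HP' & HQ' & T2).
  destruct (proj1 (filterlimi_locally _ _) Hm (mkposreal _ Rlt_0_1)) as [P2 Q2 HP2 HQ2 T3].
  exists (fun a => P1 a /\ P2 a), (fun b => Q1 b /\ Q2 b), P', Q'.
  repeat split; auto; try (apply filter_and; auto).
  intros a b c d [Ha1 Ha2] [Hb1 Hb2] Hc Hd'.
  specialize (T1 I CI BI a b Ha1 Hb1). simpl in T1.
  destruct (T3 a b Ha2 Hb2) as [z [Hz Bz]]. simpl in Hz.
  assert (Bz' : Rabs (z - M) < 1) by exact Bz.
  assert (Cf : forall x, continuous (fun x => RInt (f x) c d) x) by (intros; apply RInt_param_continuous, H).
  assert (E : norm (minus (RInt I a b) (RInt (fun x => RInt (f x) c d) a b)) <= eps / 2).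
  { rewrite <- (RInt_minus (V := V)) by (apply ex_RInt_cont; auto).
    eapply Rle_trans.
    - apply (norm_RInt_le_any (V := V) (fun x => minus (I x) (RInt (f x) c d))
        (fun x => ((eps / 2) / (Rabs M + 1)) * m x)).
      + intros x. apply (continuous_minus (V := V)); auto.
      + intros; apply continuous_scal_R; auto.
      + intros x. rewrite Rmult_comm. apply (T2 (f x) (m x)); auto. apply cont2_r, H.
    - assert (EQ : RInt (fun x => ((eps / 2) / (Rabs M + 1)) * m x) a b = ((eps / 2) / (Rabs M + 1)) * z).
      { apply is_RInt_unique. apply (is_RInt_scal (V := R_NormedModule)). exact Hz. }
      rewrite EQ, Rabs_mult, Rabs_pos_eq by lra.
      assert (Rabs z <= Rabs M + 1).
      { replace z with (M + (z - M)) by ring. eapply Rle_trans; [apply Rabs_triang|]. lra. }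
      apply Rle_trans with (((eps / 2) / (Rabs M + 1)) * (Rabs M + 1)).
      + apply Rmult_le_compat_l; lra.
      + right. field. lra. }
  assert (T := norm_minus_triangle (RInt_gen I Fa Fb) (RInt I a b) (RInt (fun x => RInt (f x) c d) a b)).
  eapply Rle_lt_trans; [exact T|].
  eapply Rlt_le_trans; [apply Rplus_lt_le_compat; [exact T1|exact E]|]. lra.
Qed.
End FubiniDominated.

(** Both iterated integrals are close to the integral over a common large rectangle, where the
    finite theorem applies. *)
Lemma Fubini_dominated (f : R -> R -> C) (m n : R -> R) (M N : R) Fa Fb Fc Fd
  {PFa : ProperFilter Fa} {PFb : ProperFilter Fb} {PFc : ProperFilter Fc} {PFd : ProperFilter Fd} :
  cont2 f -> (forall x, continuous m x) -> (forall x, continuous n x) ->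
  (forall x, 0 < m x) -> (forall x, 0 < n x) ->
  is_RInt_gen m Fa Fb M -> is_RInt_gen n Fc Fd N ->
  (forall x y, Cmod (f x y) <= m x * n y) ->
  exists X, is_RInt_gen (V := CR) (fun x => RInt_gen (V := CR) (f x) Fc Fd) Fa Fb X /\
    is_RInt_gen (V := CR) (fun y => RInt_gen (V := CR) (fun x => f x y) Fa Fb) Fc Fd X.
Proof.
  intros H Cm Cn Pm Pn Hm Hn Hd.
  destruct (iterated_dominated (V := CR) f m n M N H Cm Cn Pm Pn Hm Hn) as [X [HX TX]].
  { intros x y. rewrite <- Cmod_norm. apply Hd. }
  destruct (iterated_dominated (V := CR) (fun y x => f x y) n m N M (cont2_swap _ H) Cn Cm Pn Pm Hn Hm)
    as [Y [HY TY]].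
  { intros x y. rewrite <- Cmod_norm, Rmult_comm. apply Hd. }
  exists X; split; auto. replace X with Y; auto.
  apply (eq_close (V := CR)). intros eps. apply (norm_compat1 (V := CR)).
  assert (He : 0 < eps / 2) by (destruct eps; simpl; lra).
  destruct (TX (mkposreal _ He)) as (P1 & Q1 & P2 & Q2 & H1 & H2 & H3 & H4 & T1).
  destruct (TY (mkposreal _ He)) as (P3 & Q3 & P4 & Q4 & H5 & H6 & H7 & H8 & T2).
  destruct (filter_ex _ (filter_and _ _ H1 H7)) as [a [? ?]].
  destruct (filter_ex _ (filter_and _ _ H2 H8)) as [b [? ?]].
  destruct (filter_ex _ (filter_and _ _ H3 H5)) as [c [? ?]].
  destruct (filter_ex _ (filter_and _ _ H4 H6)) as [d [? ?]].
  specialize (T1 a b c d ltac:(auto) ltac:(auto) ltac:(auto) ltac:(auto)).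
  specialize (T2 c d a b ltac:(auto) ltac:(auto) ltac:(auto) ltac:(auto)).
  rewrite (Fubini_finite f) in T1 by auto.
  rewrite (norm_minus_sym (V := CR)) in T2. simpl in T1, T2.
  eapply Rle_lt_trans; [apply (norm_minus_triangle (V := CR))|].
  eapply Rlt_le_trans; [apply Rplus_lt_compat; [exact T1|exact T2]|]. lra.
Qed.

(** * Complex-valued functions of a real variable *)

Lemma Cexp_plus (z w : C) : Cexp (z + w)%C = (Cexp z * Cexp w)%C.
Proof.
  destruct z as [a b], w as [c d]. unfold Cexp, Cplus, Cmult, Re, Im; simpl.
  rewrite exp_plus, cos_plus, sin_plus. f_equal; ring.
Qed.

Lemma Cexp_R (x : R) : Cexp (RtoC x) = RtoC (exp x).
Proof. unfold Cexp, RtoC; simpl. rewrite cos_0, sin_0. f_equal; ring. Qed.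

Lemma Cexp_opp_l (z : C) : (Cexp (- z) * Cexp z = 1)%C.
Proof. rewrite <- Cexp_plus. replace (- z + z)%C with (RtoC 0) by ring. rewrite Cexp_R, exp_0. reflexivity. Qed.

Lemma Cmod_Cexp (z : C) : Cmod (Cexp z) = exp (Re z).
Proof.
  unfold Cmod, Cexp; simpl.
  replace (_ + _) with (exp (Re z) * exp (Re z)).
  - apply sqrt_square, Rlt_le, exp_pos.
  - generalize (sin2_cos2 (Im z)). unfold Rsqr. intros H.
    replace (exp (Re z) * exp (Re z)) with (exp (Re z) * exp (Re z) * (sin (Im z) * sin (Im z) + cos (Im z) * cos (Im z))) by (rewrite H; ring). ring.
Qed.

Lemma Cexp_neq_0 (z : C) : Cexp z <> 0%C.
Proof. intros H. assert (M := Cmod_Cexp z). rewrite H, Cmod_0 in M. generalize (exp_pos (Re z)). lra. Qed.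

Section ContC.
Context {U : UniformSpace}.

Lemma continuous_pairC (u v : U -> R) x :
  continuous u x -> continuous v x -> continuous (fun t => (u t, v t) : C) x.
Proof.
  intros Hu Hv.
  apply (continuous_comp_2 (V := R_UniformSpace) (W := R_UniformSpace) u v (fun a b => (a, b) : C)); auto.
  apply (continuous_ext (fun p : R * R => p)); [intros []; reflexivity|apply continuous_id].
Qed.

Lemma continuous_fstC (f : U -> C) x : continuous f x -> continuous (fun t => fst (f t)) x.
Proof. intros H. apply (continuous_comp f fst); auto. destruct (f x); apply continuous_fst. Qed.

Lemma continuous_sndC (f : U -> C) x : continuous f x -> continuous (fun t => snd (f t)) x.
Proof. intros H. apply (continuous_comp f snd); auto. destruct (f x); apply continuous_snd. Qed.

Lemma continuous_RtoC (u : U -> R) x : continuous u x -> continuous (fun t => RtoC (u t)) x.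
Proof. intros; apply continuous_pairC; auto. apply continuous_const. Qed.

Lemma continuous_Rplus (u v : U -> R) x :
  continuous u x -> continuous v x -> continuous (fun t => u t + v t) x.
Proof. apply (continuous_plus (K := R_AbsRing) (V := R_NormedModule)). Qed.

Lemma continuous_Rminus (u v : U -> R) x :
  continuous u x -> continuous v x -> continuous (fun t => u t - v t) x.
Proof. apply (continuous_minus (K := R_AbsRing) (V := R_NormedModule)). Qed.

Lemma continuous_Ropp (u : U -> R) x : continuous u x -> continuous (fun t => - u t) x.
Proof. apply (continuous_opp (K := R_AbsRing) (V := R_NormedModule)). Qed.

Lemma continuous_Rmult (u v : U -> R) x :
  continuous u x -> continuous v x -> continuous (fun t => u t * v t) x.
Proof. apply (continuous_mult (K := R_AbsRing)). Qed.

Lemma continuous_Rexp (u : U -> R) x : continuous u x -> continuous (fun t => exp (u t)) x.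
Proof. intros; apply (continuous_comp u exp); auto. apply continuous_exp. Qed.

Lemma continuous_Rcos (u : U -> R) x : continuous u x -> continuous (fun t => cos (u t)) x.
Proof. intros; apply (continuous_comp u cos); auto. apply continuous_cos. Qed.

Lemma continuous_Rsin (u : U -> R) x : continuous u x -> continuous (fun t => sin (u t)) x.
Proof. intros; apply (continuous_comp u sin); auto. apply continuous_sin. Qed.

Lemma continuous_Rabs_comp (u : U -> R) x : continuous u x -> continuous (fun t => Rabs (u t)) x.
Proof. intros; apply (continuous_comp u Rabs); auto. apply continuous_Rabs. Qed.

Lemma continuous_Cexp (f : U -> C) x : continuous f x -> continuous (fun t => Cexp (f t)) x.
Proof.
  intros H. unfold Cexp, Re, Im.
  assert (H1 := continuous_fstC _ _ H). assert (H2 := continuous_sndC _ _ H).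
  apply continuous_pairC; apply continuous_Rmult; try (apply continuous_Rexp; auto).
  - apply continuous_Rcos; auto.
  - apply continuous_Rsin; auto.
Qed.

Lemma continuous_Cplus (f g : U -> C) x :
  continuous f x -> continuous g x -> continuous (fun t => (f t + g t)%C) x.
Proof.
  intros Hf Hg. unfold Cplus. apply continuous_pairC; apply continuous_Rplus;
  first [apply continuous_fstC | apply continuous_sndC]; auto.
Qed.

Lemma continuous_Copp (f : U -> C) x : continuous f x -> continuous (fun t => (- f t)%C) x.
Proof.
  intros Hf. unfold Copp. apply continuous_pairC; apply continuous_Ropp;
  first [apply continuous_fstC | apply continuous_sndC]; auto.
Qed.

Lemma continuous_Cminus (f g : U -> C) x :
  continuous f x -> continuous g x -> continuous (fun t => (f t - g t)%C) x.
Proof. intros Hf Hg. unfold Cminus. apply continuous_Cplus; auto. apply continuous_Copp; auto. Qed.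

Lemma continuous_Cmult (f g : U -> C) x :
  continuous f x -> continuous g x -> continuous (fun t => (f t * g t)%C) x.
Proof.
  intros Hf Hg. unfold Cmult. apply continuous_pairC.
  - apply continuous_Rminus; apply continuous_Rmult; first [apply continuous_fstC | apply continuous_sndC]; auto.
  - apply continuous_Rplus; apply continuous_Rmult; first [apply continuous_fstC | apply continuous_sndC]; auto.
Qed.
End ContC.

Lemma continuous_fstR (p : R * R) : continuous (fun p : R * R => fst p) p.
Proof. destruct p; apply continuous_fst. Qed.
Lemma continuous_sndR (p : R * R) : continuous (fun p : R * R => snd p) p.
Proof. destruct p; apply continuous_snd. Qed.

(** Continuity by recursion on the term; the later cases restore eta-reduced functions such as
    [Rmult a] to an abstraction. *)
Ltac ccont := cbv beta; repeat (cbv beta; lazymatch goal with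
  | |- continuous (fun x => x) _ => apply continuous_id
  | |- continuous (fun x => fst x) _ => apply continuous_fstR
  | |- continuous (fun x => snd x) _ => apply continuous_sndR
  | |- continuous (fun _ => ?c) _ => apply continuous_const
  | |- continuous (fun x => Cexp _) _ => apply continuous_Cexp
  | |- continuous (fun x => Cplus _ _) _ => apply continuous_Cplus
  | |- continuous (fun x => Cminus _ _) _ => apply continuous_Cminus
  | |- continuous (fun x => Copp _) _ => apply continuous_Copp
  | |- continuous (fun x => Cmult _ _) _ => apply continuous_Cmult
  | |- continuous (fun x => RtoC _) _ => apply continuous_RtoC
  | |- continuous (fun x => (_, _)) _ => apply continuous_pairC
  | |- continuous (fun x => Rplus _ _) _ => apply continuous_Rplus
  | |- continuous (fun x => Rminus _ _) _ => apply continuous_Rminus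
  | |- continuous (fun x => Ropp _) _ => apply continuous_Ropp
  | |- continuous (fun x => Rmult _ _) _ => apply continuous_Rmult
  | |- continuous (fun x => exp _) _ => apply continuous_Rexp
  | |- continuous (fun x => Rabs _) _ => apply continuous_Rabs_comp
  | |- continuous (fun x => cos _) _ => apply continuous_Rcos
  | |- continuous (fun x => sin _) _ => apply continuous_Rsin
  | |- continuous (Rmult ?a) ?x => change (continuous (fun t => a * t) x)
  | |- continuous (Rplus ?a) ?x => change (continuous (fun t => a + t) x)
  | |- continuous (Rminus ?a) ?x => change (continuous (fun t => a - t) x)
  | |- continuous (Cmult ?a) ?x => change (continuous (fun t => (a * t)%C) x)
  | |- continuous Ropp ?x => change (continuous (fun t => - t) x)
  | |- continuous exp ?x => change (continuous (fun t => exp t) x)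
  | |- continuous Rabs ?x => change (continuous (fun t => Rabs t) x)
  | |- continuous Cexp ?x => change (continuous (fun t => Cexp t) x)
  | |- continuous RtoC ?x => change (continuous (fun t => RtoC t) x)
  | |- continuous fst _ => apply continuous_fstR
  | |- continuous snd _ => apply continuous_sndR
  end).

(** Integration takes place in a real normed module, whose scalar rule covers real factors only; a
    complex factor mixes the two components. *)
Lemma is_RInt_Cmult (f : R -> C) (c : C) a b (l : C) :
  is_RInt (V := CR) f a b l -> is_RInt (V := CR) (fun x => (c * f x)%C) a b (c * l)%C.
Proof.
  intros H.
  assert (H1 := is_RInt_fct_extend_fst (U := R_NormedModule) (V := R_NormedModule) f a b l H).
  assert (H2 := is_RInt_fct_extend_snd (U := R_NormedModule) (V := R_NormedModule) f a b l H).
  apply (is_RInt_fct_extend_pair (U := R_NormedModule) (V := R_NormedModule)).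
  - simpl. apply (is_RInt_minus (V := R_NormedModule)); apply (is_RInt_scal (V := R_NormedModule)); auto.
  - simpl. apply (is_RInt_plus (V := R_NormedModule)); apply (is_RInt_scal (V := R_NormedModule)); auto.
Qed.

Section GenC.
Context {Fa Fb : (R -> Prop) -> Prop} {PFa : ProperFilter Fa} {PFb : ProperFilter Fb}.

Lemma is_RInt_gen_Cmult (f : R -> C) (c l : C) :
  is_RInt_gen (V := CR) f Fa Fb l -> is_RInt_gen (V := CR) (fun x => (c * f x)%C) Fa Fb (c * l)%C.
Proof.
  intros H P HP.
  assert (K : continuous (fun z : C => (c * z)%C) l) by ccont.
  specialize (H _ (K P HP)). revert H. unfold filtermapi, filtermap. apply filter_imp.
  intros [a b] [z [Hz Pz]]. exists (c * z)%C; split; auto. apply is_RInt_Cmult, Hz.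
Qed.

Lemma is_RInt_gen_of_derive (V : CompleteNormedModule R_AbsRing) (F f : R -> V) (la lb : V) :
  filter_prod Fa Fb (fun ab => forall x, Rmin (fst ab) (snd ab) <= x <= Rmax (fst ab) (snd ab) ->
    is_derive F x (f x) /\ continuous f x) ->
  filterlim F Fa (locally la) -> filterlim F Fb (locally lb) ->
  is_RInt_gen f Fa Fb (minus lb la).
Proof.
  intros H Ha Hb. unfold is_RInt_gen.
  apply (filterlimi_lim_ext_loc (fun ab : R * R => minus (F (snd ab)) (F (fst ab)))).
  - revert H. apply filter_imp. intros [a b] H; simpl in *.
    apply (is_RInt_derive F f); intros x Hx; apply H; auto.
  - apply (filterlim_comp_2 (F := filter_prod Fa Fb) (G := locally lb) (H := locally (opp la))
      (fun ab => F (snd ab)) (fun ab => opp (F (fst ab))) plus).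
    + eapply filterlim_comp; [apply filterlim_snd|exact Hb].
    + eapply filterlim_comp; [eapply filterlim_comp; [apply filterlim_fst|exact Ha]|].
      apply (filterlim_opp (V := V)).
    + apply (filterlim_plus (V := V)).
Qed.
End GenC.

Lemma is_derive_pairC (u v : R -> R) x du dv :
  is_derive u x du -> is_derive v x dv ->
  is_derive (V := CR) (fun t => (u t, v t) : C) x (du, dv).
Proof.
  intros Hu Hv.
  assert (H := is_derive_plus (V := C_R_NormedModule) _ _ x _ _
    (is_derive_scal_l (V := C_R_NormedModule) u x du ((1, 0) : C) Hu)
    (is_derive_scal_l (V := C_R_NormedModule) v x dv ((0, 1) : C) Hv)).
  assert (E : forall a b : R, plus (scal a ((1, 0) : C)) (scal b ((0, 1) : C)) = ((a, b) : C)).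
  { intros a b. rewrite !scal_R_Cmult. change ((RtoC a * (1, 0) + RtoC b * (0, 1))%C = (a, b)).
    unfold Cmult, Cplus, RtoC; simpl. f_equal; ring. }
  rewrite E in H. revert H. apply is_derive_ext. intros t. apply E.
Qed.

Lemma is_derive_Cexp_pair (u v : R -> R) x du dv :
  is_derive u x du -> is_derive v x dv ->
  is_derive (V := CR) (fun t => Cexp (u t, v t)) x ((du, dv) * Cexp (u x, v x))%C.
Proof.
  intros Hu Hv. unfold Cexp, Cmult, Re, Im; simpl.
  apply (is_derive_pairC (fun t => exp (u t) * cos (v t)) (fun t => exp (u t) * sin (v t))).
  - auto_derive.
    + repeat split; auto; eexists; eauto.
    + replace (Derive (fun x => u x) x) with du by (symmetry; apply is_derive_unique, Hu).
      replace (Derive (fun x => v x) x) with dv by (symmetry; apply is_derive_unique, Hv). ring.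
  - auto_derive.
    + repeat split; auto; eexists; eauto.
    + replace (Derive (fun x => u x) x) with du by (symmetry; apply is_derive_unique, Hu).
      replace (Derive (fun x => v x) x) with dv by (symmetry; apply is_derive_unique, Hv). ring.
Qed.

(** * The Mellin transform of the exponential *)

Lemma filterlim_C0 {T : Type} {F : (T -> Prop) -> Prop} {FF : Filter F} (f : T -> C) (g : T -> R) :
  F (fun t => Cmod (f t) <= g t) -> filterlim g F (locally 0) -> filterlim f F (locally (RtoC 0)).
Proof.
  intros H Hg. apply (filterlim_locally_ball_norm (U := CR)). intros eps.
  assert (Hg' := proj1 (filterlim_locally g 0) Hg eps).
  generalize (filter_and _ _ H Hg'). apply filter_imp. intros t [H1 H2].
  change (norm (V := CR) (f t - 0)%C < eps).
  replace (f t - 0)%C with (f t) by ring.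
  rewrite <- Cmod_norm. assert (B : Rabs (g t - 0) < eps) by exact H2.
  apply Rabs_def2 in B. lra.
Qed.

Lemma lim_exp_lin_m x : 0 < x -> filterlim (fun t => exp (x * t)) minfty (locally 0).
Proof.
  intros Hx. eapply filterlim_comp; [|apply is_lim_exp_m].
  intros P [M HM]. exists (M / x). intros t Ht. apply HM.
  apply (Rmult_lt_compat_l x) in Ht; auto.
  replace (x * (M / x)) with M in Ht by (field; lra). auto.
Qed.

Lemma lim_exp_lin_p x : 0 < x -> filterlim (fun t => exp (- x * t)) pinfty (locally 0).
Proof.
  intros Hx. eapply filterlim_comp; [|apply is_lim_exp_m].
  intros P [M HM]. exists (- M / x). intros t Ht. apply HM.
  apply (Rmult_lt_compat_l x) in Ht; auto.
  replace (x * (- M / x)) with (- M) in Ht by (field; lra). lra.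
Qed.

Lemma lim_exp_abs_m K x : 0 < x -> filterlim (fun t => K * exp (- x * Rabs t)) minfty (locally 0).
Proof.
  intros Hx. replace 0 with (K * 0) by ring.
  apply (filterlim_comp _ _ _ (fun t => exp (- x * Rabs t)) (fun y => K * y) _ (locally 0)).
  - apply (filterlim_ext_loc (fun t => exp (x * t))); [|apply lim_exp_lin_m; auto].
    exists 0. intros t Ht. rewrite Rabs_left by auto. f_equal; ring.
  - apply (continuous_scal_R (fun y => y) K 0), continuous_id.
Qed.

Lemma lim_exp_abs_p K x : 0 < x -> filterlim (fun t => K * exp (- x * Rabs t)) pinfty (locally 0).
Proof.
  intros Hx. replace 0 with (K * 0) by ring.
  apply (filterlim_comp _ _ _ (fun t => exp (- x * Rabs t)) (fun y => K * y) _ (locally 0)).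
  - apply (filterlim_ext_loc (fun t => exp (- x * t))); [|apply lim_exp_lin_p; auto].
    exists 0. intros t Ht. rewrite Rabs_right by lra. reflexivity.
  - apply (continuous_scal_R (fun y => y) K 0), continuous_id.
Qed.

Lemma Rmin_Rmax_neg a x : a < 0 -> Rmin a 0 < x < Rmax a 0 -> x < 0.
Proof. intros Ha [_ H]. rewrite Rmax_right in H; lra. Qed.

Lemma Rmin_Rmax_pos b x : 0 < b -> Rmin 0 b < x < Rmax 0 b -> 0 < x.
Proof. intros Hb [H _]. rewrite Rmin_left in H; lra. Qed.

Lemma is_RInt_gen_poisson e t : 0 < e ->
  is_RInt_gen (V := CR) (fun y => Cexp (- e * Rabs y, t * y)) minfty pinfty (RtoC (2 * e / (e * e + t * t))).
Proof.
  intros He.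
  assert (Hd : 0 < e * e + t * t) by nra.
  (* [lp] is [1 / (e + i t)] and [lm] below is [1 / (- e + i t)], the coefficients of the
     antiderivatives on the negative and positive half-lines; the integral is [lp - lm]. *)
  set (lp := ((e / (e * e + t * t), - t / (e * e + t * t)) : C)).
  set (lm := ((- e / (e * e + t * t), - t / (e * e + t * t)) : C)).
  assert (Ep : is_RInt_gen (V := CR) (fun y => Cexp (- e * Rabs y, t * y)) minfty (at_point 0) lp).
  { apply (is_RInt_gen_ext (fun y => Cexp (e * y, t * y)%R)).
    { apply (Filter_prod _ _ _ (fun a => a < 0) (fun b => b = 0)).
      - exists 0; auto.
      - reflexivity.
      - intros a b Ha -> x Hx; simpl in Hx. apply Rmin_Rmax_neg in Hx; auto.
        rewrite Rabs_left by auto. do 2 f_equal. ring. }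
    replace lp with (minus (lp * Cexp (e * 0, t * 0)%R)%C (RtoC 0)).
    2: { rewrite !Rmult_0_r. change ((lp * Cexp (RtoC 0) - 0)%C = lp). rewrite Cexp_R, exp_0. ring. }
    apply (is_RInt_gen_of_derive CR (fun y => lp * Cexp (e * y, t * y)%R)%C).
    - apply filter_forall. intros ab x _. split.
      + replace (Cexp (e * x, t * x)%R) with (lp * ((e, t)%R * Cexp (e * x, t * x)%R))%C.
        2: { rewrite Cmult_assoc. replace (lp * (e, t)%R)%C with (RtoC 1). ring.
             unfold lp, Cmult, RtoC; simpl. f_equal; field; lra. }
        apply (is_derive_pairC (fun y => fst (lp * Cexp (e * y, t * y)%R)%C) (fun y => snd (lp * Cexp (e * y, t * y)%R)%C)).
        * unfold lp, Cmult, Cexp, Re, Im; simpl. auto_derive; auto. ring.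
        * unfold lp, Cmult, Cexp, Re, Im; simpl. auto_derive; auto. ring.
      + apply continuous_Cexp, continuous_pairC; ccont.
    - apply (filterlim_C0 _ (fun y => Cmod lp * exp (- e * Rabs y))).
      + exists 0. intros y Hy. rewrite Cmod_mult, Cmod_Cexp, Rabs_left by auto. simpl. right. do 2 f_equal. ring.
      + apply lim_exp_abs_m; auto.
    - intros P HP. unfold filtermap, at_point. apply (locally_singleton _ _ HP). }
  assert (Em : is_RInt_gen (V := CR) (fun y => Cexp (- e * Rabs y, t * y)) (at_point 0) pinfty (- lm)%C).
  { apply (is_RInt_gen_ext (fun y => Cexp (- e * y, t * y)%R)).
    { apply (Filter_prod _ _ _ (fun a => a = 0) (fun b => 0 < b)).
      - reflexivity.
      - exists 0; auto.
      - intros a b -> Hb x Hx; simpl in Hx. apply Rmin_Rmax_pos in Hx; auto.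
        rewrite Rabs_right by lra. reflexivity. }
    replace (- lm)%C with (minus (RtoC 0) (lm * Cexp (- e * 0, t * 0)%R)%C).
    2: { rewrite !Rmult_0_r. change ((0 - lm * Cexp (RtoC 0))%C = (- lm)%C). rewrite Cexp_R, exp_0. ring. }
    apply (is_RInt_gen_of_derive CR (fun y => lm * Cexp (- e * y, t * y)%R)%C).
    - apply filter_forall. intros ab x _. split.
      + replace (Cexp (- e * x, t * x)%R) with (lm * ((- e, t)%R * Cexp (- e * x, t * x)%R))%C.
        2: { rewrite Cmult_assoc. replace (lm * (- e, t)%R)%C with (RtoC 1). ring.
             unfold lm, Cmult, RtoC; simpl. f_equal; field; lra. }
        apply (is_derive_pairC (fun y => fst (lm * Cexp (- e * y, t * y)%R)%C) (fun y => snd (lm * Cexp (- e * y, t * y)%R)%C)).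
        * unfold lm, Cmult, Cexp, Re, Im; simpl. auto_derive; auto. ring.
        * unfold lm, Cmult, Cexp, Re, Im; simpl. auto_derive; auto. ring.
      + apply continuous_Cexp, continuous_pairC; ccont.
    - intros P HP. unfold filtermap, at_point. apply (locally_singleton _ _ HP).
    - apply (filterlim_C0 _ (fun y => Cmod lm * exp (- e * Rabs y))).
      + exists 0. intros y Hy. rewrite Cmod_mult, Cmod_Cexp, Rabs_right by lra. simpl. right. reflexivity.
      + apply lim_exp_abs_p; auto. }
  assert (X := is_RInt_gen_Chasles _ 0 _ _ Ep Em).
  replace (RtoC (2 * e / (e * e + t * t))) with (plus lp (- lm)%C); auto.
  change ((lp - lm)%C = RtoC (2 * e / (e * e + t * t))). unfold lp, lm, Cminus, Cplus, Copp, RtoC; simpl.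
  f_equal; field; lra.
Qed.

Lemma is_RInt_gen_fst (f : R -> C) Fa Fb {FFa : Filter Fa} {FFb : Filter Fb} (l : C) :
  is_RInt_gen (V := CR) f Fa Fb l -> is_RInt_gen (fun x => fst (f x)) Fa Fb (fst l).
Proof.
  intros H P HP.
  assert (K : continuous (fun z : C => fst z) l) by (apply (continuous_fstC (fun z => z)), continuous_id).
  specialize (H _ (K P HP)). revert H. unfold filtermapi, filtermap. apply filter_imp.
  intros [a b] [z [Hz Pz]]. exists (fst z); split; auto.
  apply (is_RInt_fct_extend_fst (U := R_NormedModule) (V := R_NormedModule)). exact Hz.
Qed.

Lemma is_RInt_gen_exp_abs x : 0 < x -> is_RInt_gen (fun t => exp (- x * Rabs t)) minfty pinfty (2 / x).
Proof.
  intros Hx. assert (H := is_RInt_gen_fst _ _ _ _ (is_RInt_gen_poisson x 0 Hx)).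
  replace (2 / x) with (fst (RtoC (2 * x / (x * x + 0 * 0)))).
  2: { simpl. field. lra. }
  revert H. apply is_RInt_gen_ext. apply filter_forall. intros ab t _.
  simpl. rewrite Rmult_0_l, cos_0. ring.
Qed.

(* The integrand of the Mellin transform of [exp (- A u)], after [u = exp t]. *)
Definition mellin_kernel (z A : C) (t : R) : C := Cexp (z * RtoC t - A * RtoC (exp t))%C.
(** For [z] and [A] in the right half-plane this is [Gamma(z) A^(-z)], see [mellin_exp_Gamma]. *)
Definition mellin_exp (z A : C) : C := CInt_R (mellin_kernel z A).

Lemma Re_mellin_exponent z A t : Re (z * RtoC t - A * RtoC (exp t))%C = Re z * t - Re A * exp t.
Proof. destruct z, A; unfold Re; simpl; ring. Qed.

Lemma Cmod_mellin_kernel z A t : Cmod (mellin_kernel z A t) = exp (Re z * t - Re A * exp t).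
Proof. unfold mellin_kernel. rewrite Cmod_Cexp, Re_mellin_exponent. reflexivity. Qed.

(** For [t >= 0] the claim is [2 x t - r exp t <= 4 x^2 / r]: use [exp t >= t^2 / 4] and complete
    the square. For [t < 0] the term [x t] is already the decay. *)
Lemma mellin_kernel_real_bound x r t : 0 < x -> 0 < r ->
  exp (x * t - r * exp t) <= exp (4 * x * x / r) * exp (- x * Rabs t).
Proof.
  intros Hx Hr. rewrite <- exp_plus. 
  assert (E := exp_pos t).
  assert (L : x * t - r * exp t <= 4 * x * x / r + - x * Rabs t).
  { assert (0 < 4 * x * x / r) by (apply Rdiv_lt_0_compat; nra).
    destruct (Rle_lt_dec 0 t) as [h|h].
    - rewrite Rabs_right by lra.
      assert (Q : (t / 2) * (t / 2) <= exp t).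
      { replace t with (t / 2 + t / 2) at 3 by field. rewrite exp_plus.
        assert (1 + t / 2 <= exp (t / 2)) by apply exp_ineq1_le.
        apply Rmult_le_compat; lra. }
      assert (S : 0 <= (r / 4) * (t - 4 * x / r) ^ 2).
      { apply Rmult_le_pos; [lra|apply pow2_ge_0]. }
      replace ((r / 4) * (t - 4 * x / r) ^ 2) with (r * ((t / 2) * (t / 2)) - 2 * x * t + 4 * x * x / r) in S
        by (field; lra).
      assert (r * ((t / 2) * (t / 2)) <= r * exp t) by (apply Rmult_le_compat_l; lra).
      lra.
    - rewrite Rabs_left by lra. assert (0 < r * exp t) by nra. lra. }
  destruct L as [L|L]; [left; apply exp_increasing; auto|right; rewrite L; auto].
Qed.

Definition kernel_bound (x r : R) : R := exp (4 * x * x / r).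

Lemma mellin_kernel_bound z A t : 0 < Re z -> 0 < Re A ->
  Cmod (mellin_kernel z A t) <= kernel_bound (Re z) (Re A) * exp (- Re z * Rabs t).
Proof. intros; rewrite Cmod_mellin_kernel. apply mellin_kernel_real_bound; auto. Qed.

Lemma continuous_mellin_kernel z A t : continuous (mellin_kernel z A) t.
Proof. unfold mellin_kernel; ccont. Qed.

Lemma continuous_exp_abs K x t : continuous (fun t => K * exp (- x * Rabs t)) t.
Proof. ccont. Qed.

Lemma is_RInt_gen_exp_abs_scal K x : 0 < x ->
  is_RInt_gen (fun t => K * exp (- x * Rabs t)) minfty pinfty (K * (2 / x)).
Proof. intros; apply is_RInt_gen_scal_R; try typeclasses eauto. apply is_RInt_gen_exp_abs; auto. Qed.

Lemma mellin_exp_correct z A : 0 < Re z -> 0 < Re A -> is_RInt_gen (V := CR) (mellin_kernel z A) minfty pinfty (mellin_exp z A).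
Proof.
  intros Hz HA. apply (RInt_gen_correct (V := CR)).
  apply (dominated_ex (V := CR) _ _ _ (continuous_exp_abs (kernel_bound (Re z) (Re A)) (Re z))
    (is_RInt_gen_exp_abs_scal (kernel_bound (Re z) (Re A)) (Re z) Hz)).
  - apply continuous_mellin_kernel.
  - intros t. rewrite <- Cmod_norm. apply mellin_kernel_bound; auto.
Qed.

Lemma mellin_exp_bound z A : 0 < Re z -> 0 < Re A ->
  Cmod (mellin_exp z A) <= kernel_bound (Re z) (Re A) * (2 / Re z).
Proof.
  intros Hz HA. rewrite Cmod_norm.
  rewrite <- (Rabs_pos_eq (kernel_bound (Re z) (Re A) * (2 / Re z))).
  - apply (dominated_norm_le (V := CR) _ _ _ (continuous_exp_abs (kernel_bound (Re z) (Re A)) (Re z))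
    (is_RInt_gen_exp_abs_scal (kernel_bound (Re z) (Re A)) (Re z) Hz)).
    + apply continuous_mellin_kernel.
    + intros t. rewrite <- Cmod_norm. apply mellin_kernel_bound; auto.
  - apply Rmult_le_pos; [apply Rlt_le, exp_pos|]. apply Rlt_le, Rdiv_lt_0_compat; lra.
Qed.

Lemma mellin_kernel_succ z A t : mellin_kernel (z + 1) A t = (RtoC (exp t) * mellin_kernel z A t)%C.
Proof. unfold mellin_kernel. rewrite <- Cexp_R, <- Cexp_plus. f_equal. rewrite Cexp_R. ring. Qed.

Lemma is_derive_mellin_kernel z A t :
  is_derive (V := CR) (mellin_kernel z A) t (z * mellin_kernel z A t - A * mellin_kernel (z + 1) A t)%C.
Proof.
  rewrite mellin_kernel_succ.
  replace (z * mellin_kernel z A t - A * (RtoC (exp t) * mellin_kernel z A t))%C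
    with ((z - A * RtoC (exp t)) * mellin_kernel z A t)%C by ring.
  destruct z as [a b], A as [c d].
  assert (H := is_derive_Cexp_pair (fun t => a * t - c * exp t) (fun t => b * t - d * exp t) t
    (a - c * exp t) (b - d * exp t) ltac:(auto_derive; auto; ring) ltac:(auto_derive; auto; ring)).
  assert (E : forall s, ((a, b) * RtoC s - (c, d) * RtoC (exp s))%C = (a * s - c * exp s, b * s - d * exp s)).
  { intros s. unfold Cminus, Cplus, Copp, Cmult, RtoC; simpl. f_equal; ring. }
  unfold mellin_kernel. rewrite E.
  replace ((a, b) - (c, d) * RtoC (exp t))%C with ((a - c * exp t, b - d * exp t) : C).
  2: { unfold Cminus, Cplus, Copp, Cmult, RtoC; simpl. f_equal; ring. }
  revert H. apply is_derive_ext. intros s. rewrite E. reflexivity.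
Qed.

Lemma mellin_kernel_lim_m z A : 0 < Re z -> 0 < Re A -> filterlim (mellin_kernel z A) minfty (locally (RtoC 0)).
Proof.
  intros. eapply filterlim_C0; [|apply (lim_exp_abs_m (kernel_bound (Re z) (Re A)) (Re z)); auto].
  apply filter_forall. intros; apply mellin_kernel_bound; auto.
Qed.

Lemma mellin_kernel_lim_p z A : 0 < Re z -> 0 < Re A -> filterlim (mellin_kernel z A) pinfty (locally (RtoC 0)).
Proof.
  intros. eapply filterlim_C0; [|apply (lim_exp_abs_p (kernel_bound (Re z) (Re A)) (Re z)); auto].
  apply filter_forall. intros; apply mellin_kernel_bound; auto.
Qed.

(** The functional equation of Gamma: the kernel vanishes at both ends, so its derivative integrates
    to 0. *)
Lemma mellin_exp_succ z A : 0 < Re z -> 0 < Re A -> (z * mellin_exp z A = A * mellin_exp (z + 1) A)%C.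
Proof.
  intros Hz HA.
  assert (Hz1 : 0 < Re (z + 1)%C) by (destruct z; unfold Re in *; simpl in *; lra).
  assert (H1 := is_RInt_gen_of_derive CR (mellin_kernel z A) (fun t => z * mellin_kernel z A t - A * mellin_kernel (z + 1) A t)%C
    (RtoC 0) (RtoC 0) (Fa := minfty) (Fb := pinfty)).
  assert (H2 := is_RInt_gen_minus (V := CR) _ _ _ _
    (is_RInt_gen_Cmult _ z _ (mellin_exp_correct z A Hz HA)) (is_RInt_gen_Cmult _ A _ (mellin_exp_correct _ A Hz1 HA))).
  assert (H1' : is_RInt_gen (V := CR) (fun t => z * mellin_kernel z A t - A * mellin_kernel (z + 1) A t)%C minfty pinfty
     (minus (RtoC 0) (RtoC 0))).
  { apply H1.
    - apply filter_forall. intros ab t _; split; [apply is_derive_mellin_kernel|].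
      apply continuous_Cminus; apply continuous_Cmult; try apply continuous_const; apply continuous_mellin_kernel.
    - apply mellin_kernel_lim_m; auto.
    - apply mellin_kernel_lim_p; auto. }
  assert (E := eq_trans (eq_sym (is_RInt_gen_unique _ _ H1')) (is_RInt_gen_unique _ _ H2)).
  assert (E' : (0 - 0 = z * mellin_exp z A - A * mellin_exp (z + 1) A)%C) by exact E.
  replace (z * mellin_exp z A)%C with ((z * mellin_exp z A - A * mellin_exp (z + 1) A) + A * mellin_exp (z + 1) A)%C by ring.
  rewrite <- E'. ring.
Qed.

Lemma cos_Rabs t : cos (Rabs t) = cos t.
Proof. unfold Rabs; destruct (Rcase_abs t); [apply cos_neg|reflexivity]. Qed.

Lemma RInt_derive_C (F f : R -> C) a b :
  (forall x, is_derive (V := CR) F x (f x)) -> (forall x, continuous f x) ->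
  RInt (V := CR) f a b = (F b - F a)%C.
Proof. intros H1 H2. apply is_RInt_unique. apply (is_RInt_derive (V := CR)); intros; [apply H1|apply H2]. Qed.

(** * Rotation of the contour in the Gamma integral *)

Section Rotation.
Variables (x y l th : R).
Hypotheses (Hx : 0 < x) (Hth : Rabs th < PI / 2).

(** With [z = x + i y], [Rf s t] is [exp (z T - exp T)] at [T = t + s (l + i th)]. Thus [s] moves
    the contour from the real line, where the kernel has [A = 1], to its translate by [l + i th],
    which after [u = exp t] is a rotation with scaling and produces [A = Cexp (l, th)]. *)
Let e s t := exp (t + s * l).
Let RU s t := x * (t + s * l) - y * (s * th) - e s t * cos (s * th).
Let RV s t := x * (s * th) + y * (t + s * l) - e s t * sin (s * th).
Let Rf s t := Cexp (RU s t, RV s t).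
Let Df s t : C := ((x - e s t * cos (s * th), y - e s t * sin (s * th))%R * Rf s t)%C.

Let is_derive_Rf_t s t : is_derive (V := CR) (fun t => Rf s t) t (Df s t).
Proof.
  apply (is_derive_Cexp_pair (RU s) (RV s)); unfold RU, RV, e; auto_derive; auto; ring.
Qed.

Let is_derive_Rf_s s t : is_derive (V := CR) (fun s => Rf s t) s ((l, th) * Df s t)%C.
Proof.
  unfold Df. rewrite Cmult_assoc.
  replace ((l, th) * (x - e s t * cos (s * th), y - e s t * sin (s * th))%R)%C with
    ((x * l - y * th - (l * e s t * cos (s * th) - th * e s t * sin (s * th)),
      x * th + y * l - (l * e s t * sin (s * th) + th * e s t * cos (s * th))) : C).
  - apply (is_derive_Cexp_pair (fun s => RU s t) (fun s => RV s t)); unfold RU, RV, e; auto_derive; auto; ring.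
  - unfold Cmult; simpl. f_equal; ring.
Qed.

Let cont2_Df : cont2 (fun t s => ((l, th) * Df s t)%C).
Proof. intros p. unfold Df, Rf, RU, RV, e. ccont. Qed.

(** Cauchy's theorem on a parallelogram. Holomorphy enters as the fact that the [s]-derivative is
    [(l, th)] times the [t]-derivative; the finite Fubini theorem then exchanges the long sides for
    the short ones. *)
Let Rf_finite a b :
  RInt (V := CR) (fun t => (Rf 1 t - Rf 0 t)%C) a b =
  RInt (V := CR) (fun s => ((l, th) * (Rf s b - Rf s a))%C) 0 1.
Proof.
  rewrite (RInt_ext (V := CR) _ (fun t => RInt (V := CR) (fun s => ((l, th) * Df s t)%C) 0 1)).
  2: { intros t _. symmetry. apply (RInt_derive_C (fun s => Rf s t)); intros s.
       - apply is_derive_Rf_s.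
       - apply (cont2_r (fun t s => ((l, th) * Df s t)%C)), cont2_Df. }
  rewrite (Fubini_finite (fun t s => ((l, th) * Df s t)%C)) by apply cont2_Df.
  apply (RInt_ext (V := CR)). intros s _.
  apply is_RInt_unique. apply is_RInt_Cmult.
  apply (is_RInt_derive (V := CR) (fun t => Rf s t)); intros t _; [apply is_derive_Rf_t|].
  unfold Df, Rf, RU, RV, e; ccont.
Qed.

(** A lower bound of [exp (s * l) * cos (s * th)] for [0 <= s <= 1]. It is positive because [th]
    stays below [PI / 2] in modulus, so all intermediate contours share the majorant of the real
    kernel with rate [kap]. *)
Let kap := exp (- Rabs l) * cos th.
Let c1 := Rabs (x * l - y * th).
Let K := exp c1 * kernel_bound x kap.

Let kap_pos : 0 < kap.
Proof.
  apply Rmult_lt_0_compat; [apply exp_pos|]. rewrite <- cos_Rabs. apply cos_gt_0.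
  - generalize (Rabs_pos th) PI_RGT_0; lra.
  - auto.
Qed.

Let Rf_bound s t : 0 <= s <= 1 -> Cmod (Rf s t) <= K * exp (- x * Rabs t).
Proof.
  intros Hs. unfold Rf. rewrite Cmod_Cexp. simpl.
  assert (H1 : kap * exp t <= e s t * cos (s * th)).
  { unfold kap, e. rewrite exp_plus.
    replace (exp (- Rabs l) * cos th * exp t) with (exp t * (exp (- Rabs l) * cos th)) by ring.
    rewrite Rmult_assoc. apply Rmult_le_compat_l; [apply Rlt_le, exp_pos|].
    assert (Hc : cos th <= cos (s * th)).
    { rewrite <- (cos_Rabs th), <- (cos_Rabs (s * th)).
      assert (P := PI_RGT_0). assert (Q := Rabs_pos th).
      assert (Rabs (s * th) <= Rabs th).
      { rewrite Rabs_mult, (Rabs_pos_eq s) by lra. nra. }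
      apply cos_decr_1; try lra; try apply Rabs_pos. }
    assert (Hc0 : 0 <= cos th).
    { rewrite <- cos_Rabs. apply cos_ge_0; generalize (Rabs_pos th) PI_RGT_0; lra. }
    apply Rmult_le_compat; auto; [apply Rlt_le, exp_pos|].
    assert (- Rabs l <= s * l).
    { assert (A1 := Rle_abs l). assert (A2 := Rle_abs (- l)). rewrite Rabs_Ropp in A2.
      assert (A3 := Rabs_pos l). nra. }
    destruct H as [H|H]; [left; apply exp_increasing; auto|right; rewrite H; auto]. }
  assert (H2 : s * (x * l - y * th) <= c1).
  { unfold c1. assert (A1 := Rle_abs (x * l - y * th)). assert (A3 := Rabs_pos (x * l - y * th)). nra. }
  apply Rle_trans with (exp (c1 + (x * t - kap * exp t))).
  - assert (L : RU s t <= c1 + (x * t - kap * exp t)) by (unfold RU; nra).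
    destruct L as [L|L]; [left; apply exp_increasing; auto|right; rewrite L; auto].
  - rewrite exp_plus. unfold K, kernel_bound. rewrite Rmult_assoc. apply Rmult_le_compat_l; [apply Rlt_le, exp_pos|].
    apply mellin_kernel_real_bound; auto.
Qed.

Let Rf_diff : is_RInt_gen (V := CR) (fun t => (Rf 1 t - Rf 0 t)%C) minfty pinfty (RtoC 0).
Proof.
  assert (Ct : forall t, continuous (fun t => (Rf 1 t - Rf 0 t)%C) t).
  { intros t; unfold Rf, RU, RV, e; ccont. }
  unfold is_RInt_gen.
  apply (filterlimi_lim_ext_loc (fun ab : R * R => RInt (V := CR) (fun t => (Rf 1 t - Rf 0 t)%C) (fst ab) (snd ab))).
  { apply filter_forall. intros ab. apply (RInt_correct (V := CR)), (ex_RInt_cont (V := CR)), Ct. }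
  set (q := Cmod (l, th) * K).
  apply (filterlim_C0 _ (fun ab : R * R => q * exp (- x * Rabs (snd ab)) + q * exp (- x * Rabs (fst ab)))).
  - apply filter_forall. intros [a b]; simpl. rewrite Rf_finite, Cmod_norm.
    replace (q * exp (- x * Rabs b) + q * exp (- x * Rabs a)) with
      ((1 - 0) * (q * exp (- x * Rabs b) + q * exp (- x * Rabs a))) by ring.
    apply (norm_RInt_le_const (V := CR) (fun s => ((l, th) * (Rf s b - Rf s a))%C) 0 1).
    + lra.
    + intros s Hs. rewrite <- Cmod_norm, Cmod_mult. unfold q.
      rewrite !Rmult_assoc, <- Rmult_plus_distr_l. apply Rmult_le_compat_l; [apply Cmod_ge_0|].
      eapply Rle_trans; [apply Cmod_triangle|]. rewrite Cmod_opp.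
      apply Rplus_le_compat; apply Rf_bound; auto.
    + apply (RInt_correct (V := CR)), (ex_RInt_cont (V := CR)). intros s. unfold Rf, RU, RV, e; ccont.
  - replace 0 with (0 + 0) by ring.
    apply (filterlim_comp_2 (F := filter_prod minfty pinfty) (G := locally 0) (H := locally 0)
      (fun ab => q * exp (- x * Rabs (snd ab))) (fun ab => q * exp (- x * Rabs (fst ab))) Rplus).
    + apply (filterlim_comp _ _ _ snd (fun b => q * exp (- x * Rabs b)) _ pinfty); [apply filterlim_snd|apply lim_exp_abs_p; auto].
    + apply (filterlim_comp _ _ _ fst (fun b => q * exp (- x * Rabs b)) _ minfty); [apply filterlim_fst|apply lim_exp_abs_m; auto].
    + apply (filterlim_plus (V := R_NormedModule)).
Qed.

Lemma mellin_exp_rotation : mellin_exp (x, y) (Cexp (l, th)) = (Cexp (- ((x, y) * (l, th))) * mellin_exp (x, y) 1)%C.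
Proof.
  assert (HA : 0 < Re (Cexp (l, th))).
  { simpl. apply Rmult_lt_0_compat; [apply exp_pos|]. rewrite <- cos_Rabs.
    apply cos_gt_0; auto. generalize (Rabs_pos th) PI_RGT_0; lra. }
  assert (H1 := is_RInt_gen_Cmult _ (Cexp ((x, y) * (l, th))) _ (mellin_exp_correct (x, y) (Cexp (l, th)) Hx HA)).
  assert (H2 := mellin_exp_correct (x, y) 1 Hx ltac:(simpl; lra)).
  assert (H3 := is_RInt_gen_minus (V := CR) _ _ _ _ H1 H2).
  assert (H4 : is_RInt_gen (V := CR) (fun t => (Rf 1 t - Rf 0 t)%C) minfty pinfty
    (Cexp ((x, y) * (l, th)) * mellin_exp (x, y) (Cexp (l, th)) - mellin_exp (x, y) 1)%C).
  { revert H3. apply is_RInt_gen_ext. apply filter_forall. intros ab t _.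
    apply (f_equal2 Cminus); unfold mellin_kernel.
    - rewrite <- Cexp_plus. unfold Rf. f_equal. unfold RU, RV, e, Cexp, Cminus, Cplus, Copp, Cmult, RtoC; simpl.
      rewrite !Rmult_1_l, exp_plus. f_equal; ring.
    - unfold Rf. f_equal. unfold RU, RV, e, Cminus, Cplus, Copp, Cmult, RtoC; simpl.
      rewrite !Rmult_0_l, cos_0, sin_0, !Rplus_0_r. f_equal; ring. }
  assert (E := eq_trans (eq_sym (is_RInt_gen_unique _ _ Rf_diff)) (is_RInt_gen_unique _ _ H4)).
  assert (E2 : mellin_exp (x, y) 1 = (Cexp ((x, y) * (l, th)) * mellin_exp (x, y) (Cexp (l, th)))%C).
  { replace (mellin_exp (x, y) 1) with (0 + mellin_exp (x, y) 1)%C by ring. rewrite E. ring. }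
  rewrite E2, Cmult_assoc, Cexp_opp_l. ring.
Qed.
End Rotation.

(** The scale [k] allows two uses: [k = 1] for the Gamma integral and [k = / 2] for distances [x]
    with [x * x = exp t]. *)
Lemma is_RInt_gen_exp_subst (f g : R -> C) k (l : C) : 0 < k ->
  (forall t, 0 < t -> continuous f t) ->
  (forall t, g t = (RtoC (k * exp (k * t)) * f (exp (k * t)))%C) ->
  is_RInt_gen (V := CR) g minfty pinfty l -> is_RInt_gen (V := CR) f (at_right 0) pinfty l.
Proof.
  intros Hk Cf Hg H P HP. destruct (H P HP) as [Q1 Q2 [M1 HQ1] [M2 HQ2] HQ].
  assert (E1 : 0 < exp (k * M1)) by apply exp_pos.
  assert (E2 : 0 < exp (k * M2)) by apply exp_pos.
  apply (Filter_prod _ _ _ (fun a => 0 < a < exp (k * M1)) (fun b => exp (k * M2) < b)).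
  - exists (mkposreal _ E1). intros a Ha Ha0. split; auto.
    assert (B : Rabs (a - 0) < exp (k * M1)) by exact Ha. apply Rabs_def2 in B. lra.
  - exists (exp (k * M2)). auto.
  - intros a b [Ha1 Ha2] Hb. simpl.
    assert (Hb0 : 0 < b) by lra.
    assert (La : Q1 (ln a / k)).
    { apply HQ1. apply (Rmult_lt_reg_l k); auto. replace (k * (ln a / k)) with (ln a) by (field; lra).
      rewrite <- (ln_exp (k * M1)). apply ln_increasing; auto. }
    assert (Lb : Q2 (ln b / k)).
    { apply HQ2. apply (Rmult_lt_reg_l k); auto. replace (k * (ln b / k)) with (ln b) by (field; lra).
      rewrite <- (ln_exp (k * M2)). apply ln_increasing; auto. }
    destruct (HQ _ _ La Lb) as [z [Hz Pz]]. simpl in Hz. exists z; split; auto.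
    assert (X := is_RInt_comp (V := CR) f (fun t => exp (k * t)) (fun t => k * exp (k * t)) (ln a / k) (ln b / k)).
    assert (Y : is_RInt (V := CR) g (ln a / k) (ln b / k) (RInt (V := CR) f (exp (k * (ln a / k))) (exp (k * (ln b / k))))).
    { eapply is_RInt_ext; [|apply X].
      - intros t _. rewrite Hg. simpl. rewrite scal_R_Cmult. reflexivity.
      - intros t _. apply Cf, exp_pos.
      - intros t _. split; [auto_derive; auto; ring|]. ccont. }
    replace (k * (ln a / k)) with (ln a) in Y by (field; lra).
    replace (k * (ln b / k)) with (ln b) in Y by (field; lra).
    rewrite !exp_ln in Y by auto.
    rewrite <- (is_RInt_unique _ _ _ _ Hz), (is_RInt_unique _ _ _ _ Y).
    apply (RInt_correct (V := CR)). apply (ex_RInt_continuous (V := CR)). intros t [Ht _]. apply Cf.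
    assert (0 < Rmin a b) by (apply Rmin_glb_lt; auto). lra.
Qed.

Lemma Clog_pos t : 0 < t -> Clog (RtoC t) = RtoC (ln t).
Proof.
  intros Ht. unfold Clog. rewrite Cmod_R, Rabs_pos_eq by lra. unfold Carg; simpl.
  destruct (Rlt_dec 0 0); [lra|]. destruct (Rlt_dec t 0); [lra|]. reflexivity.
Qed.

Lemma Cpowc_pos t w : 0 < t -> Cpowc (RtoC t) w = Cexp (w * RtoC (ln t))%C.
Proof. intros. unfold Cpowc. rewrite Clog_pos; auto. Qed.

Lemma CGamma_mellin_exp z : 0 < Re z -> CGamma z = mellin_exp z 1.
Proof.
  intros Hz. unfold CGamma, CInt_0_inf. apply (is_RInt_gen_unique (V := CR)).
  apply (is_RInt_gen_exp_subst _ (mellin_kernel z 1) 1).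
  - lra.
  - intros t Ht.
    apply (continuous_ext_loc _ (fun t => (Cexp ((z - 1) * RtoC (ln t)) * RtoC (exp (- t)))%C)).
    + exists (mkposreal _ Ht). intros u Hu. assert (B : Rabs (u - t) < t) by exact Hu.
      apply Rabs_def2 in B. rewrite Cpowc_pos by lra. reflexivity.
    + apply continuous_Cmult; [apply continuous_Cexp, continuous_Cmult; [apply continuous_const|]|ccont].
      apply continuous_RtoC. apply (continuous_comp (fun t => t) ln); [apply continuous_id|]. 
      apply (ex_derive_continuous (K := R_AbsRing) (V := R_NormedModule)). exists (/ t). apply is_derive_ln; auto.
  - intros t. rewrite Rmult_1_l, Rmult_1_l, Cpowc_pos by apply exp_pos. rewrite ln_exp, <- !Cexp_R, <- !Cexp_plus.
    unfold mellin_kernel. f_equal. rewrite RtoC_opp. ring.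
  - apply mellin_exp_correct; auto. simpl; lra.
Qed.

(** * Mellin inversion *)

Lemma Clog_Cexp l th : - PI < th <= PI -> Clog (Cexp (l, th)) = (l, th).
Proof.
  intros H. unfold Clog. rewrite Cmod_Cexp. simpl. rewrite ln_exp. f_equal.
  unfold Carg. rewrite Cmod_Cexp. unfold Cexp, Re, Im; simpl.
  assert (E := exp_pos l).
  replace (exp l * cos th / exp l) with (cos th) by (field; lra).
  destruct (Rlt_dec 0 th) as [h|h].
  - destruct (Req_dec th PI) as [->|n].
    + rewrite sin_PI, cos_PI, Rmult_0_r.
      destruct (Rlt_dec 0 0); [lra|]. destruct (Rlt_dec (exp l * -1) 0); lra.
    + assert (0 < sin th) by (apply sin_gt_0; lra).
      destruct (Rlt_dec 0 (exp l * sin th)) as [g|g]; [apply acos_cos; lra|].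
      exfalso; apply g, Rmult_lt_0_compat; auto.
  - destruct (Req_dec th 0) as [->|n].
    + rewrite sin_0, cos_0, Rmult_0_r.
      destruct (Rlt_dec 0 0); [lra|]. destruct (Rlt_dec (exp l * 1) 0); lra.
    + assert (S : sin th < 0) by (apply sin_lt_0_var; lra).
      assert (S' : exp l * sin th < 0) by nra.
      destruct (Rlt_dec 0 (exp l * sin th)) as [g|g]; [lra|].
      destruct (Rlt_dec (exp l * sin th) 0) as [g'|g']; [|lra].
      rewrite <- cos_neg, acos_cos; lra.
Qed.

Lemma polar_pos (A : C) : 0 < Re A -> exists l th, Rabs th < PI / 2 /\ A = Cexp (l, th).
Proof.
  destruct A as [a b]; simpl; intros Ha.
  assert (Hs : 0 < 1 + (b / a)²) by (generalize (Rle_0_sqr (b / a)); lra).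
  assert (Hq : 0 < sqrt (1 + (b / a)²)) by (apply sqrt_lt_R0; auto).
  exists (ln (a * sqrt (1 + (b / a)²))), (atan (b / a)). split.
  - assert (B := atan_bound (b / a)). apply Rabs_def1; lra.
  - unfold Cexp; simpl. rewrite exp_ln by (apply Rmult_lt_0_compat; auto).
    rewrite cos_atan, sin_atan. f_equal; field; repeat split; lra.
Qed.

Lemma Cexp_Clog (A : C) : 0 < Re A -> Cexp (Clog A) = A /\ Rabs (Im (Clog A)) < PI / 2.
Proof.
  intros H. destruct (polar_pos A H) as (l & th & Ht & ->).
  assert (P := PI_RGT_0). assert (T := Rabs_def2 _ _ Ht).
  rewrite Clog_Cexp by lra. split; auto.
Qed.

Lemma mellin_exp_Gamma z A : 0 < Re z -> 0 < Re A -> mellin_exp z A = (CGamma z * Cexp (- (z * Clog A)))%C.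
Proof.
  intros Hz HA. rewrite CGamma_mellin_exp by auto.
  destruct (Cexp_Clog A HA) as [E T].
  rewrite <- E at 1. destruct (Clog A) as [l th], z as [x y]. simpl in T, Hz.
  rewrite mellin_exp_rotation by auto. ring.
Qed.

(** With [z = (g, y)], two uses of the functional equation give [z (z + 1) mellin_exp z A = A^2
    mellin_exp (z + 2) A], where the right side is bounded independently of [y], and
    [Cmod z <= Cmod (z + 1)] leaves the factor [g^2 + y^2]. The quotient [(1 + g^2) / g^2] converts
    this into [1 + y^2]. *)
Lemma mellin_exp_decay g A : 0 < g -> 0 < Re A ->
  exists K, 0 < K /\ forall y, Cmod (mellin_exp (g, y) A) <= K * / (1 + y * y).
Proof.
  intros Hg HA.
  set (B := kernel_bound (g + 1 + 1) (Re A) * (2 / (g + 1 + 1))).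
  assert (HB : 0 < B) by (apply Rmult_lt_0_compat; [apply exp_pos|apply Rdiv_lt_0_compat; lra]).
  assert (HAm : 0 < Cmod A).
  { apply Cmod_gt_0. intros E. rewrite E in HA. simpl in HA; lra. }
  exists (Cmod A * (Cmod A * B) * ((1 + g * g) / (g * g))). split.
  { apply Rmult_lt_0_compat; [apply Rmult_lt_0_compat; auto; apply Rmult_lt_0_compat; auto|]. apply Rdiv_lt_0_compat; nra. }
  intros y.
  assert (E1 := mellin_exp_succ (g, y) A Hg HA).
  assert (Hg1 : 0 < Re ((g, y) + 1)%C) by (simpl; lra).
  assert (E2 := mellin_exp_succ _ A Hg1 HA).
  assert (Hg2 : Re ((g, y) + 1 + 1)%C = g + 1 + 1) by (simpl; reflexivity).
  assert (Bd := mellin_exp_bound ((g, y) + 1 + 1)%C A ltac:(rewrite Hg2; lra) HA). rewrite Hg2 in Bd. fold B in Bd.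
  apply (f_equal Cmod) in E1. apply (f_equal Cmod) in E2. rewrite !Cmod_mult in E1, E2.
  assert (M : forall u v, Cmod (u, v) * Cmod (u, v) = u * u + v * v).
  { intros u v. unfold Cmod; simpl. rewrite sqrt_def; [ring|]. nra. }
  assert (M0 := M g y).
  assert (M1 : Cmod (g, y) <= Cmod ((g, y) + 1)%C).
  { unfold Cmod; simpl. apply sqrt_le_1_alt. nra. }
  assert (P0 := Cmod_ge_0 (g, y)).
  set (G0 := Cmod (mellin_exp (g, y) A)) in *. set (G1 := Cmod (mellin_exp ((g, y) + 1) A)) in *.
  set (G2 := Cmod (mellin_exp ((g, y) + 1 + 1) A)) in *.
  set (z0 := Cmod (g, y)) in *. set (z1 := Cmod ((g, y) + 1)%C) in *.
  assert (PG0 : 0 <= G0) by apply Cmod_ge_0.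
  assert (PG1 : 0 <= G1) by apply Cmod_ge_0.
  assert (Q : (g * g + y * y) * G0 <= Cmod A * (Cmod A * B)).
  { rewrite <- M0. rewrite Rmult_assoc.
    apply Rle_trans with (z1 * (z0 * G0)).
    - apply Rmult_le_compat_r; auto. apply Rmult_le_pos; auto.
    - rewrite E1. replace (z1 * (Cmod A * G1)) with (Cmod A * (z1 * G1)) by ring. rewrite E2.
      apply Rmult_le_compat_l; [lra|]. apply Rmult_le_compat_l; lra. }
  assert (D : 0 < g * g + y * y) by nra.
  assert (D1 : 0 < 1 + y * y) by nra.
  apply (Rmult_le_reg_l (g * g + y * y)); auto.
  eapply Rle_trans; [exact Q|].
  set (S := Cmod A * (Cmod A * B)) in *.
  assert (PS : 0 < S) by (apply Rmult_lt_0_compat; auto; apply Rmult_lt_0_compat; auto).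
  apply Rle_trans with (S * ((g * g + y * y) * (1 + g * g) / (g * g * (1 + y * y)))).
  - rewrite <- (Rmult_1_r S) at 1. apply Rmult_le_compat_l; [lra|].
    apply Rmult_le_reg_r with (g * g * (1 + y * y)); [nra|].
    replace ((g * g + y * y) * (1 + g * g) / (g * g * (1 + y * y)) * (g * g * (1 + y * y)))
      with ((g * g + y * y) * (1 + g * g)) by (field; split; nra).
    assert (0 <= (g * g) * (g * g)) by nra. assert (0 <= y * y) by nra. nra.
  - right. field. split; nra.
Qed.

Lemma lim_atan_p : filterlim atan pinfty (locally (PI / 2)).
Proof.
  apply filterlim_locally. intros eps.
  assert (P := PI_RGT_0).
  (* The cap [PI / 4] keeps [PI / 2 - d] inside the range where [atan] inverts [tan]. *)
  set (d := Rmin (eps / 2) (PI / 4)).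
  assert (Hd : 0 < d) by (apply Rmin_glb_lt; [destruct eps; simpl; lra|lra]).
  assert (d <= eps / 2) by apply Rmin_l. assert (d <= PI / 4) by apply Rmin_r.
  exists (tan (PI / 2 - d)). intros x Hx.
  apply atan_increasing in Hx. rewrite atan_tan in Hx by lra.
  assert (B := atan_bound x). destruct eps as [eps He]; simpl in *.
  apply Rabs_def1; unfold minus, plus, opp; simpl; lra.
Qed.

Lemma lim_atan_m : filterlim atan minfty (locally (- (PI / 2))).
Proof.
  apply (filterlim_ext (fun x => - atan (- x))).
  { intros x. rewrite atan_opp. ring. }
  apply (filterlim_comp _ _ _ (fun x => atan (- x)) Ropp _ (locally (PI / 2))).
  - apply (filterlim_comp _ _ _ Ropp atan _ pinfty); [|apply lim_atan_p].
    intros P [M HM]. exists (- M). intros x Hx. apply HM. lra.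
  - apply (filterlim_opp (V := R_NormedModule)).
Qed.

Lemma continuous_atan_kernel K y : continuous (fun y => K * / (1 + y * y)) y.
Proof.
  apply continuous_Rmult; [apply continuous_const|].
  apply continuous_Rinv_comp; [ccont|nra].
Qed.

Lemma is_RInt_gen_atan_kernel K : is_RInt_gen (fun y => K * / (1 + y * y)) minfty pinfty (K * PI).
Proof.
  apply is_RInt_gen_scal_R; try typeclasses eauto.
  replace PI with (PI / 2 - (- (PI / 2))) by field.
  apply (is_RInt_gen_of_derive R_CompleteNormedModule atan).
  - apply filter_forall. intros ab x _. split.
    + apply is_derive_atan.
    + apply (continuous_ext (fun y => 1 * / (1 + y * y))).
      * intros; apply Rmult_1_l.
      * apply continuous_atan_kernel.
  - apply lim_atan_m.
  - apply lim_atan_p.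
Qed.

Lemma is_RInt_gen_scale (h : R -> C) e (l : C) : 0 < e ->
  is_RInt_gen (V := CR) h minfty pinfty l -> is_RInt_gen (V := CR) (fun s => (RtoC e * h (e * s)%R)%C) minfty pinfty l.
Proof.
  intros He H P HP. destruct (H P HP) as [Q1 Q2 [M1 HQ1] [M2 HQ2] HQ].
  apply (Filter_prod _ _ _ (fun a => a < M1 / e) (fun b => M2 / e < b)).
  - exists (M1 / e); auto.
  - exists (M2 / e); auto.
  - intros a b Ha Hb. simpl.
    assert (La : Q1 (e * a)).
    { apply HQ1. apply (Rmult_lt_compat_l e) in Ha; auto.
      replace (e * (M1 / e)) with M1 in Ha by (field; lra). auto. }
    assert (Lb : Q2 (e * b)).
    { apply HQ2. apply (Rmult_lt_compat_l e) in Hb; auto.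
      replace (e * (M2 / e)) with M2 in Hb by (field; lra). auto. }
    destruct (HQ _ _ La Lb) as [z [Hz Pz]]. simpl in Hz. exists z; split; auto.
    assert (X := is_RInt_comp_lin (V := CR) h e 0 a b z).
    rewrite !Rplus_0_r in X. specialize (X Hz).
    revert X. apply is_RInt_ext. intros s _. rewrite Rplus_0_r. apply scal_R_Cmult.
Qed.

Lemma cont2_mellin_kernel g b : cont2 (fun y t => mellin_kernel (g, y) b t).
Proof. intros p. unfold mellin_kernel. ccont. Qed.

Lemma continuous_mellin_exp g b y : 0 < g -> 0 < Re b -> continuous (fun y => mellin_exp (g, y) b) y.
Proof.
  intros Hg Hb.
  apply (RInt_gen_param_continuous (V := CR) (fun y t => mellin_kernel (g, y) b t) _ _ y (cont2_mellin_kernel g b)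
    (continuous_exp_abs (kernel_bound g (Re b)) g) (is_RInt_gen_exp_abs_scal (kernel_bound g (Re b)) g Hg)).
  apply filter_forall. intros u t. rewrite <- Cmod_norm. apply (mellin_kernel_bound (g, u) b t); auto.
Qed.

Section Inversion.
Variables (g : R) (b : C).
Hypotheses (Hg : 0 < g) (Hb : 0 < Re b).
Let G y := mellin_exp (g, y) b.

(* Fubini turns the Abel means of the inversion integral into Poisson integrals of the kernel. *)
Let abel e : 0 < e ->
  RInt_gen (V := CR) (fun y => RtoC (exp (- Rabs e * Rabs y)) * G y)%C minfty pinfty =
  RInt_gen (V := CR) (fun s => mellin_kernel (g, 0%R) b (e * s) * RtoC (2 * / (1 + s * s)))%C minfty pinfty.
Proof.
  intros He. rewrite (Rabs_pos_eq e) by lra.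
  destruct (Fubini_dominated (fun y t => RtoC (exp (- e * Rabs y)) * mellin_kernel (g, y) b t)%C
    (fun y => 1 * exp (- e * Rabs y)) (fun t => kernel_bound g (Re b) * exp (- g * Rabs t))
    (1 * (2 / e)) (kernel_bound g (Re b) * (2 / g)) minfty pinfty minfty pinfty) as [Z [H1 H2]].
  - intros p. apply (continuous_Cmult (fun p : R * R => RtoC (exp (- e * Rabs (fst p)))) (fun p : R * R => mellin_kernel (g, fst p) b (snd p))).
    + ccont.
    + apply cont2_mellin_kernel.
  - apply continuous_exp_abs.
  - apply continuous_exp_abs.
  - intros; rewrite Rmult_1_l; apply exp_pos.
  - intros; apply Rmult_lt_0_compat; apply exp_pos.
  - apply is_RInt_gen_exp_abs_scal; auto.
  - apply is_RInt_gen_exp_abs_scal; auto.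
  - intros y t. rewrite Cmod_mult, Cmod_R, Rabs_pos_eq, Rmult_1_l by apply Rlt_le, exp_pos.
    apply Rmult_le_compat_l; [apply Rlt_le, exp_pos|]. apply (mellin_kernel_bound (g, y) b t); auto.
  - transitivity Z.
    + apply is_RInt_gen_unique. revert H1. apply is_RInt_gen_ext. apply filter_forall. intros ab y _.
      apply is_RInt_gen_unique. apply is_RInt_gen_Cmult. apply mellin_exp_correct; auto.
    + symmetry. apply is_RInt_gen_unique.
      assert (H3 : is_RInt_gen (V := CR) (fun t => mellin_kernel (g, 0%R) b t * RtoC (2 * e / (e * e + t * t)))%C minfty pinfty Z).
      { revert H2. apply is_RInt_gen_ext. apply filter_forall. intros ab t _.
        apply is_RInt_gen_unique.
        generalize (is_RInt_gen_Cmult _ (mellin_kernel (g, 0%R) b t) _ (is_RInt_gen_poisson e t He)).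
        apply is_RInt_gen_ext. apply filter_forall. intros ab' y _.
        unfold mellin_kernel. rewrite <- (Cexp_R (- e * Rabs y)), <- !Cexp_plus. f_equal.
        unfold Cminus, Cplus, Copp, Cmult, RtoC; simpl. f_equal; ring. }
      (* The substitution [t = e * s] removes [e] from the Poisson kernel, so that the limit
         [e -> 0] acts on the Mellin kernel alone. *)
      generalize (is_RInt_gen_scale _ e _ He H3). apply is_RInt_gen_ext. apply filter_forall. intros ab s _.
      rewrite Cmult_assoc, (Cmult_comm (RtoC e)), <- Cmult_assoc, <- RtoC_mult. do 2 f_equal.
      field. split; nra.
Qed.

(** Both sides of [abel] are continuous at [e = 0]: on the left by the decay of [mellin_exp], on the
    right because the Mellin kernel is bounded. At [e = 0] the right side is the kernel at the
    origin, [exp (- b)], times the integral [2 PI] of [2 / (1 + s^2)]. *)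
Lemma mellin_inversion_exp :
  is_RInt_gen (V := CR) (fun y => mellin_exp (g, y) b) minfty pinfty (RtoC (2 * PI) * Cexp (- b))%C.
Proof.
  destruct (mellin_exp_decay g b Hg Hb) as [K [HK Dec]].
  assert (CG : forall y, continuous G y) by exact (fun y => continuous_mellin_exp g b y Hg Hb).
  assert (EX : is_RInt_gen (V := CR) G minfty pinfty (RInt_gen (V := CR) G minfty pinfty)).
  { apply (RInt_gen_correct (V := CR)).
    apply (dominated_ex (V := CR) _ _ _ (continuous_atan_kernel K) (is_RInt_gen_atan_kernel K)); auto.
    intros y. rewrite <- Cmod_norm. exact (Dec y). }
  (* [Rabs e] keeps the damping factor at most 1 for both signs of [e], as continuity at 0 is
     two-sided. *)
  assert (L1 : continuous (fun e => RInt_gen (V := CR) (fun y => RtoC (exp (- Rabs e * Rabs y)) * G y)%C minfty pinfty) 0).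
  { apply (RInt_gen_param_continuous (V := CR) (fun e y => RtoC (exp (- Rabs e * Rabs y)) * G y)%C
      _ _ 0) with (2 := continuous_atan_kernel K) (3 := is_RInt_gen_atan_kernel K).
    - intros p. apply (continuous_Cmult (fun p : R * R => RtoC (exp (- Rabs (fst p) * Rabs (snd p)))) (fun p : R * R => G (snd p))).
      + ccont.
      + apply (continuous_comp (fun p : R * R => snd p) G); [apply continuous_sndR|apply CG].
    - apply filter_forall. intros e y. rewrite <- Cmod_norm, Cmod_mult, Cmod_R, Rabs_pos_eq by apply Rlt_le, exp_pos.
      rewrite <- (Rmult_1_l (K * _)). apply Rmult_le_compat; try apply Cmod_ge_0; auto.
      + apply Rlt_le, exp_pos.
      + rewrite <- exp_0. assert (L : - Rabs e * Rabs y <= 0) by (generalize (Rabs_pos e) (Rabs_pos y); nra).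
        destruct L as [L|L]; [left; apply exp_increasing; auto|right; rewrite L; auto].
      + exact (Dec y). }
  set (Q := kernel_bound g (Re b) * 2).
  assert (L2 : continuous (fun e => RInt_gen (V := CR) (fun s => mellin_kernel (g, 0%R) b (e * s) * RtoC (2 * / (1 + s * s)))%C minfty pinfty) 0).
  { apply (RInt_gen_param_continuous (V := CR) (fun e s => mellin_kernel (g, 0%R) b (e * s) * RtoC (2 * / (1 + s * s)))%C
      _ _ 0) with (2 := continuous_atan_kernel Q) (3 := is_RInt_gen_atan_kernel Q).
    - intros p. apply (continuous_Cmult (fun p : R * R => mellin_kernel (g, 0%R) b (fst p * snd p)) (fun p : R * R => RtoC (2 * / (1 + snd p * snd p)))).
      + unfold mellin_kernel. ccont.
      + apply continuous_RtoC. apply (continuous_comp (fun p : R * R => snd p) (fun s => 2 * / (1 + s * s))); [apply continuous_sndR|].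
        apply continuous_atan_kernel.
    - apply filter_forall. intros e s.
      assert (D1 : 0 < / (1 + s * s)) by (apply Rinv_0_lt_compat; nra).
      rewrite <- Cmod_norm, Cmod_mult, Cmod_R, Rabs_pos_eq by lra.
      unfold Q. rewrite Rmult_assoc. apply Rmult_le_compat_r; [lra|].
      eapply Rle_trans; [apply (mellin_kernel_bound (g, 0) b); auto|]. simpl.
      rewrite <- (Rmult_1_r (kernel_bound _ _)) at 2. apply Rmult_le_compat_l; [apply Rlt_le, exp_pos|].
      rewrite <- exp_0. assert (L : - g * Rabs (e * s) <= 0) by (generalize (Rabs_pos (e * s)); nra).
      destruct L as [L|L]; [left; apply exp_increasing; auto|right; rewrite L; auto]. }
  assert (Lr : forall (f : R -> C), continuous f 0 -> filterlim f (at_right 0) (locally (f 0))).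
  { intros f Cf. intros P HP. apply filter_le_within. apply (Cf P HP). }
  assert (E : RInt_gen (V := CR) (fun y => RtoC (exp (- Rabs 0 * Rabs y)) * G y)%C minfty pinfty =
     RInt_gen (V := CR) (fun s => mellin_kernel (g, 0%R) b (0 * s) * RtoC (2 * / (1 + s * s)))%C minfty pinfty).
  (* [abel] holds for [e > 0] only; the values at [e = 0] agree as limits from the right. *)
  { apply (filterlim_locally_unique (V := CR) (F := at_right 0)
      (fun e => RInt_gen (V := CR) (fun y => RtoC (exp (- Rabs e * Rabs y)) * G y)%C minfty pinfty)).
    - apply (Lr _ L1).
    - apply (filterlim_ext_loc (fun e => RInt_gen (V := CR) (fun s => mellin_kernel (g, 0%R) b (e * s) * RtoC (2 * / (1 + s * s)))%C minfty pinfty)).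
      + exists (mkposreal _ Rlt_0_1). intros e _ He. symmetry. apply abel; auto.
      + apply (Lr _ L2). }
  replace (RtoC (2 * PI) * Cexp (- b))%C with (RInt_gen (V := CR) G minfty pinfty); auto.
  transitivity (RInt_gen (V := CR) (fun y => RtoC (exp (- Rabs 0 * Rabs y)) * G y)%C minfty pinfty).
  { symmetry. apply is_RInt_gen_unique. revert EX. apply is_RInt_gen_ext. apply filter_forall. intros ab y _.
    rewrite Rabs_R0, Ropp_0, Rmult_0_l, exp_0. symmetry. apply Cmult_1_l. }
  rewrite E. apply is_RInt_gen_unique.
  assert (T : is_RInt_gen (V := CR) (fun s => RtoC (2 * / (1 + s * s))) minfty pinfty (RtoC (2 * PI))).
  { intros P HP.
    assert (KK : continuous RtoC (2 * PI)) by ccont.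
    assert (X := is_RInt_gen_atan_kernel 2 _ (KK P HP)). revert X. unfold filtermapi, filtermap. apply filter_imp.
    intros [u v] [z [Hz Pz]]. exists (RtoC z); split; auto.
    apply (is_RInt_fct_extend_pair (U := R_NormedModule) (V := R_NormedModule)); simpl; auto.
    assert (Z := is_RInt_const (V := R_NormedModule) u v 0).
    replace (scal (v - u) (0 : R_NormedModule)) with 0 in Z by (symmetry; apply Rmult_0_r). exact Z. }
  rewrite Cmult_comm.
  generalize (is_RInt_gen_Cmult _ (Cexp (- b)) _ T). apply is_RInt_gen_ext. apply filter_forall. intros ab s _.
  f_equal. unfold mellin_kernel. f_equal. rewrite Rmult_0_l, exp_0. ring.
Qed.
End Inversion.

(** * The Mellin-Barnes integral *)

Lemma Clog_scale_exp b s : 0 < Re b -> Clog (b * RtoC (exp s))%C = (Clog b + RtoC s)%C.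
Proof.
  intros Hb. destruct (polar_pos b Hb) as (l & th & Ht & ->).
  assert (P := PI_RGT_0). assert (T := Rabs_def2 _ _ Ht).
  rewrite <- Cexp_R, <- Cexp_plus.
  replace ((l, th) + RtoC s)%C with ((l + s, th) : C).
  2: { unfold Cplus, RtoC; simpl. f_equal; ring. }
  rewrite !Clog_Cexp by lra. unfold Cplus, RtoC; simpl. f_equal; ring.
Qed.

Section Core.
Variables (alpha gam : R) (b A x : C).
Hypotheses (Ha : 0 < alpha) (Hgam : 0 < gam < 2 / alpha) (Hb : 0 < Re b) (HA : 0 < Re A)
  (Hx : Clog x = (Clog b - RtoC (alpha / 2) * Clog A)%C).
Let be := alpha / 2.
(** This is [1 - (alpha / 2) xi] at [xi = gam + i y], the argument of the second Gamma factor. Its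
    real part [d] does not depend on [y] and is positive because [gam < 2 / alpha]. *)
Let v y : C := (1 - be * gam, - be * y).
Let d := 1 - be * gam.

Let Hd : 0 < d.
Proof.
  unfold d, be. assert (gam * alpha < 2).
  { destruct Hgam as [_ H]. apply (Rmult_lt_compat_r alpha) in H; auto.
    replace (2 / alpha * alpha) with 2 in H by (field; lra). lra. }
  lra.
Qed.

(** The [y]-dependent part of the kernel is [exp (- xi be t)], which rescales [b] to
    [b * exp (be * t)] inside the first transform; Mellin inversion at that point gives the
    value. *)
Let inner_y t :
  RInt_gen (V := CR) (fun y => mellin_exp (gam, y) b * mellin_kernel (v y) A t)%C minfty pinfty =
  (RtoC (2 * PI) * Cexp (RtoC t - A * RtoC (exp t) - b * RtoC (exp (be * t))))%C.
Proof.
  assert (Hbt : 0 < Re (b * RtoC (exp (be * t)))%C).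
  { destruct b as [b1 b2]; simpl in *. assert (E := exp_pos (be * t)).
    rewrite Rmult_0_r, Rminus_0_r. apply Rmult_lt_0_compat; auto. }
  apply is_RInt_gen_unique.
  assert (I := mellin_inversion_exp gam (b * RtoC (exp (be * t)))%C (proj1 Hgam) Hbt).
  assert (I' := is_RInt_gen_Cmult _ (Cexp (RtoC t - A * RtoC (exp t))) _ I).
  replace (RtoC (2 * PI) * Cexp (RtoC t - A * RtoC (exp t) - b * RtoC (exp (be * t))))%C with
    (Cexp (RtoC t - A * RtoC (exp t)) * (RtoC (2 * PI) * Cexp (- (b * RtoC (exp (be * t))))))%C.
  2: { unfold Cminus at 2. rewrite (Cexp_plus (RtoC t - A * RtoC (exp t))). ring. }
  revert I'. apply is_RInt_gen_ext. apply filter_forall. intros ab y _.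
  rewrite !mellin_exp_Gamma by (auto; apply Hgam). rewrite Clog_scale_exp by auto.
  assert (E1 : Cexp (- ((gam, y) * (Clog b + RtoC (be * t)%R))) =
    (Cexp (- ((gam, y) * Clog b)) * Cexp (- ((gam, y) * RtoC (be * t)%R)))%C).
  { rewrite <- Cexp_plus. f_equal. ring. }
  rewrite E1.
  assert (E2 : mellin_kernel (v y) A t = (Cexp (RtoC t - A * RtoC (exp t)) * Cexp (- ((gam, y) * RtoC (be * t)%R)))%C).
  { unfold mellin_kernel. rewrite <- Cexp_plus. f_equal. unfold v.
    unfold Cminus, Cplus, Copp, Cmult, RtoC; simpl. f_equal; ring. }
  rewrite E2. change (Cmult (Cexp (RtoC t - A * RtoC (exp t))%C) (CGamma (gam, y) * (Cexp (- ((gam, y) * Clog b)) * Cexp (- ((gam, y) * RtoC (be * t)%R))))%C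
   = CGamma (gam, y) * Cexp (- ((gam, y) * Clog b)) * (Cexp (RtoC t - A * RtoC (exp t)) * Cexp (- ((gam, y) * RtoC (be * t)%R))))%C.
  ring.
Qed.

(** The integral is [Gamma(v) A^(-v)] with [A^(-v) = A^(-1) A^(be xi)]. Hypothesis [Hx], an identity
    of logarithms and not merely of numbers, merges [b^(-xi) A^(be xi)] into the principal power
    [x^(-xi)]. *)
Let inner_t y :
  RInt_gen (V := CR) (fun t => mellin_exp (gam, y) b * mellin_kernel (v y) A t)%C minfty pinfty =
  (CGamma (gam, y) * CGamma (v y) * Cpowc x (- (gam, y)) * / A)%C.
Proof.
  apply is_RInt_gen_unique.
  replace (CGamma (gam, y) * CGamma (v y) * Cpowc x (- (gam, y)) * / A)%C with (mellin_exp (gam, y) b * mellin_exp (v y) A)%C.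
  - apply is_RInt_gen_Cmult. apply mellin_exp_correct; auto.
  - assert (Hv : 0 < Re (v y)) by exact Hd.
    assert (Hg : 0 < Re ((gam, y) : C)) by apply Hgam.
    rewrite !mellin_exp_Gamma by auto.
    unfold Cpowc. rewrite Hx.
    assert (EA : (/ A)%C = Cexp (- Clog A)).
    { destruct (Cexp_Clog A HA) as [E _]. rewrite <- E at 1.
      assert (N := Cexp_neq_0 (Clog A)). assert (M := Cexp_opp_l (Clog A)).
      replace (/ Cexp (Clog A))%C with ((Cexp (- Clog A) * Cexp (Clog A)) * / Cexp (Clog A))%C by (rewrite M; ring).
      field. auto. }
    rewrite EA.
    transitivity (CGamma (gam, y) * CGamma (v y) * (Cexp (- ((gam, y) * Clog b)) * Cexp (- (v y * Clog A))))%C; [ring|].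
    rewrite <- (Cmult_assoc (CGamma (gam, y) * CGamma (v y))%C). apply f_equal. rewrite <- !Cexp_plus. f_equal.
    replace (v y) with (1 - RtoC be * (gam, y))%C.
    + fold be. ring.
    + unfold v, Cminus, Cplus, Copp, Cmult, RtoC; simpl. f_equal; ring.
Qed.

(** Fubini applies with a product majorant because the modulus of the kernel with exponent [v y]
    depends on [t] only, while the first transform is bounded by a multiple of [/ (1 + y * y)]. *)
Lemma stretched_laplace_mellin_barnes :
  is_RInt_gen (V := CR) (fun t => Cexp (RtoC t - A * RtoC (exp t) - b * RtoC (exp (alpha / 2 * t))))%C minfty pinfty
    (FoxH11 alpha gam x / A)%C.
Proof.
  destruct (mellin_exp_decay gam b (proj1 Hgam) Hb) as [K [HK Dec]].
  assert (HP := PI_RGT_0).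
  destruct (Fubini_dominated (fun y t => mellin_exp (gam, y) b * mellin_kernel (v y) A t)%C
    (fun y => K * / (1 + y * y)) (fun t => kernel_bound d (Re A) * exp (- d * Rabs t))
    (K * PI) (kernel_bound d (Re A) * (2 / d)) minfty pinfty minfty pinfty) as [Z [H1 H2]].
  - intros p. apply (continuous_Cmult (fun p : R * R => mellin_exp (gam, fst p) b) (fun p : R * R => mellin_kernel (v (fst p)) A (snd p))).
    + apply (continuous_comp (fun p : R * R => fst p) (fun y => mellin_exp (gam, y) b)); [apply continuous_fstR|].
      apply continuous_mellin_exp; auto; apply Hgam.
    + unfold mellin_kernel, v. ccont.
  - apply continuous_atan_kernel.
  - apply continuous_exp_abs.
  - intros y. apply Rmult_lt_0_compat; auto. apply Rinv_0_lt_compat. nra.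
  - intros; apply Rmult_lt_0_compat; apply exp_pos.
  - apply is_RInt_gen_atan_kernel.
  - apply is_RInt_gen_exp_abs_scal; auto.
  - intros y t. rewrite Cmod_mult. apply Rmult_le_compat; try apply Cmod_ge_0.
    + exact (Dec y).
    + apply (mellin_kernel_bound (v y) A t); auto.
  - assert (H3 : is_RInt_gen (V := CR) (fun t => RtoC (2 * PI) * Cexp (RtoC t - A * RtoC (exp t) - b * RtoC (exp (be * t))))%C minfty pinfty Z).
    { revert H2. apply is_RInt_gen_ext. apply filter_forall. intros ab t _. apply inner_y. }
    assert (N2 : RtoC (2 * PI) <> 0%C) by (intros E; apply RtoC_inj in E; lra).
    assert (NA : A <> 0%C) by (intros E; rewrite E in HA; simpl in HA; lra).
    assert (H4 : CInt_R (fun y => let xi := (RtoC gam + RtoC y * Ci)%C in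
       (CGamma xi * CGamma (1 - RtoC (alpha / 2) * xi) * Cpowc x (- xi) * Ci)%C) = (A * Ci * Z)%C).
    { unfold CInt_R. apply (is_RInt_gen_unique (V := CR)).
      generalize (is_RInt_gen_Cmult _ (A * Ci)%C _ H1). apply is_RInt_gen_ext. apply filter_forall. intros ab y _.
      cbv zeta. rewrite inner_t.
      replace (RtoC gam + RtoC y * Ci)%C with ((gam, y) : C).
      2: { unfold Ci, Cplus, Cmult, RtoC; simpl. f_equal; ring. }
      replace (1 - RtoC (alpha / 2) * (gam, y))%C with (v y).
      2: { unfold v, be, Cminus, Cplus, Copp, Cmult, RtoC; simpl. f_equal; ring. }
      change (A * Ci * (CGamma (gam, y) * CGamma (v y) * Cpowc x (- (gam, y)) * / A) =
        CGamma (gam, y) * CGamma (v y) * Cpowc x (- (gam, y)) * Ci)%C.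
      field. auto. }
    assert (E0 : FoxH11 alpha gam x = (/ (RtoC (2 * PI) * Ci) * (A * Ci * Z))%C) by (exact (f_equal (Cmult (/ (RtoC (2 * PI) * Ci))%C) H4)). rewrite E0.
    replace (/ (RtoC (2 * PI) * Ci) * (A * Ci * Z) / A)%C with (/ RtoC (2 * PI) * Z)%C.
    2: { field. repeat split; auto. intros E. apply (f_equal snd) in E. simpl in E. lra. }
    generalize (is_RInt_gen_Cmult _ (/ RtoC (2 * PI))%C _ H3). apply is_RInt_gen_ext. apply filter_forall. intros ab t _.
    rewrite Cmult_assoc, Cinv_l by auto. apply Cmult_1_l.
Qed.
End Core.

(** * Order statistics *)

Lemma is_derive_RtoC_mult (F : R -> R) (U : R -> C) x dF dU :
  is_derive F x dF -> is_derive (V := CR) U x dU ->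
  is_derive (V := CR) (fun x => RtoC (F x) * U x)%C x (RtoC dF * U x + RtoC (F x) * dU)%C.
Proof.
  intros HF HU.
  assert (H := filterdiff_scal_fct (K := R_AbsRing) (U := R_NormedModule) (V := C_R_NormedModule) x F U
    (fun t => scal t dF) (fun t => scal t dU) Rmult_comm HF HU).
  apply (is_derive_ext (K := R_AbsRing) (V := C_R_NormedModule) (fun t => scal (F t) (U t))).
  { intros t. apply scal_R_Cmult. }
  eapply filterdiff_ext_lin; [exact H|].
  intros t. simpl. rewrite !scal_R_Cmult.
  change (RtoC (t * dF) * U x + RtoC (F x) * (RtoC t * dU) = RtoC t * (RtoC dF * U x + RtoC (F x) * dU))%C.
  rewrite RtoC_mult. ring.
Qed.

Section HalfLine.
Context {V : CompleteNormedModule R_AbsRing}.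

Lemma half_line_lim (f : R -> V) l : is_RInt_gen f (at_point 0) pinfty l ->
  filterlim (fun x => RInt f 0 x) pinfty (locally l).
Proof.
  intros H P HP. destruct (H P HP) as [Q1 Q2 H1 H2 HQ]. unfold filtermap.
  revert H2. apply filter_imp. intros b Hb. destruct (HQ 0 b H1 Hb) as [z [Hz Pz]]. simpl in Hz.
  rewrite (is_RInt_unique _ _ _ _ Hz). exact Pz.
Qed.

Lemma lim_half_line (f : R -> V) l : (forall x, continuous f x) ->
  filterlim (fun x => RInt f 0 x) pinfty (locally l) -> is_RInt_gen f (at_point 0) pinfty l.
Proof.
  intros Cf H P HP. specialize (H P HP). unfold filtermap in H.
  apply (Filter_prod _ _ _ (fun a => a = 0) (fun b => P (RInt f 0 b))); auto.
  { reflexivity. }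
  intros a b -> Hb. exists (RInt f 0 b). split; auto. simpl. apply RInt_correct, ex_RInt_cont; auto.
Qed.
End HalfLine.

Section FilterlimC.
Context {T : Type} {F : (T -> Prop) -> Prop} {FF : Filter F}.
Lemma filterlim_Cmult (f g : T -> C) (a b : C) :
  filterlim f F (locally a) -> filterlim g F (locally b) ->
  filterlim (fun x => f x * g x)%C F (locally (a * b)%C).
Proof.
  intros Hf Hg. apply (filterlim_comp_2 (F := F) (G := locally a) (H := locally b) f g Cmult); auto.
  assert (K : continuous (fun p : C * C => (fst p * snd p)%C) (a, b)).
  { apply (continuous_Cmult (fun p : C * C => fst p) (fun p : C * C => snd p)); [apply continuous_fst|apply continuous_snd]. }
  intros P HP. destruct (K P HP) as [d Hd].
  apply (Filter_prod _ _ _ (ball a d) (ball b d)).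
  - exists d; auto.
  - exists d; auto.
  - intros x y Hx Hy. apply (Hd (x, y)). split; auto.
Qed.

Lemma filterlim_Cplus (f g : T -> C) (a b : C) :
  filterlim f F (locally a) -> filterlim g F (locally b) ->
  filterlim (fun x => f x + g x)%C F (locally (a + b)%C).
Proof.
  intros Hf Hg. apply (filterlim_comp_2 (F := F) (G := locally a) (H := locally b) f g Cplus); auto.
  apply (filterlim_plus (V := C_R_NormedModule)).
Qed.

Lemma filterlim_RtoC (f : T -> R) (a : R) :
  filterlim f F (locally a) -> filterlim (fun x => RtoC (f x)) F (locally (RtoC a)).
Proof.
  intros Hf. apply (filterlim_comp _ _ _ f RtoC F (locally a)); auto.
  change (continuous RtoC a). ccont.
Qed.

Lemma filterlim_Cminus (f g : T -> C) (a b : C) :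
  filterlim f F (locally a) -> filterlim g F (locally b) ->
  filterlim (fun x => f x - g x)%C F (locally (a - b)%C).
Proof.
  intros Hf Hg. apply filterlim_Cplus; auto. apply (filterlim_comp _ _ _ g Copp F (locally b)); auto.
  apply (filterlim_opp (V := C_R_NormedModule)).
Qed.
End FilterlimC.

(** [iter_int] is a total function whose value carries no information on convergence. This relation
    records that each of the nested integrals converges, which makes it additive; it constrains the
    integrand at positive arguments only. *)
Fixpoint is_iter_int_int (n : nat) (Ph : list R -> C) (v : C) : Prop :=
  match n with
  | O => Ph nil = v
  | S m => exists h : R -> C,
      (forall x, 0 < x -> is_iter_int_int m (fun l => Ph (x :: l)) (h x)) /\
      is_RInt_gen (V := CR) h (at_point 0) pinfty v
  end.

Lemma half_line_ext (f g : R -> C) v : (forall x, 0 < x -> f x = g x) ->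
  is_RInt_gen (V := CR) f (at_point 0) pinfty v -> is_RInt_gen (V := CR) g (at_point 0) pinfty v.
Proof.
  intros H. apply is_RInt_gen_ext.
  apply (Filter_prod _ _ _ (fun a => a = 0) (fun b => 0 < b)).
  - reflexivity.
  - exists 0; auto.
  - intros a b -> Hb x Hx. apply H. simpl in Hx. apply Rmin_Rmax_pos in Hx; auto.
Qed.

Lemma is_iter_int_unique n : forall Ph v, is_iter_int_int n Ph v -> iter_int n Ph = v.
Proof.
  induction n as [|n IH]; intros Ph v H; [exact H|].
  destruct H as [h [H1 H2]]. simpl. unfold CInt_0c_inf. apply (is_RInt_gen_unique (V := CR)).
  revert H2. apply half_line_ext. intros x Hx. symmetry. apply IH, H1, Hx.
Qed.

Lemma is_iter_int_ext n : forall Ph Ps v,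
  (forall l, length l = n -> List.Forall (fun y => 0 < y) l -> Ph l = Ps l) ->
  is_iter_int_int n Ph v -> is_iter_int_int n Ps v.
Proof.
  induction n as [|n IH]; intros Ph Ps v E H.
  - simpl in *. rewrite <- H. symmetry; apply E; auto.
  - destruct H as [h [H1 H2]]. exists h; split; auto. intros x Hx.
    apply (IH (fun l => Ph (x :: l))); auto.
    intros l Hl Fl. apply E; simpl; auto.
Qed.

Lemma is_iter_int_plus n : forall Ph Ps v w,
  is_iter_int_int n Ph v -> is_iter_int_int n Ps w -> is_iter_int_int n (fun l => Ph l + Ps l)%C (v + w)%C.
Proof.
  induction n as [|n IH]; intros Ph Ps v w H K.
  - simpl in *. congruence.
  - destruct H as [h [H1 H2]]. destruct K as [k [K1 K2]].
    exists (fun x => h x + k x)%C. split.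
    + intros x Hx. apply (IH (fun l => Ph (x :: l)) (fun l => Ps (x :: l))); auto.
    + apply (is_RInt_gen_plus (V := CR)); auto.
Qed.

Lemma is_iter_int_Cmult n c : forall Ph v, is_iter_int_int n Ph v -> is_iter_int_int n (fun l => c * Ph l)%C (c * v)%C.
Proof.
  induction n as [|n IH]; intros Ph v H.
  - simpl in *. congruence.
  - destruct H as [h [H1 H2]]. exists (fun x => c * h x)%C. split.
    + intros x Hx. apply (IH (fun l => Ph (x :: l))); auto.
    + apply is_RInt_gen_Cmult; auto.
Qed.

(** * Insertion into a sorted list *)

Lemma insertR_length x l : length (insertR x l) = S (length l).
Proof. induction l as [|y l IH]; simpl; auto. destruct (Rle_dec x y); simpl; auto. Qed.

Lemma sortR_length l : length (sortR l) = length l.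
Proof. induction l; simpl; auto. rewrite insertR_length; auto. Qed.

Definition nth_nondecreasing (y : list R) := forall i, (S i < length y)%nat -> nth i y 0 <= nth (S i) y 0.

Lemma nth_nondecreasing_cons z y : nth_nondecreasing (z :: y) <-> (y <> nil -> z <= nth 0 y 0) /\ nth_nondecreasing y.
Proof.
  split.
  - intros H. split.
    + intros Hy. apply (H 0%nat). destruct y; [congruence|simpl; lia].
    + intros i Hi. apply (H (S i)). simpl; lia.
  - intros [H1 H2] [|i] Hi.
    + apply H1. intros ->. simpl in Hi; lia.
    + apply (H2 i). simpl in Hi; lia.
Qed.

Lemma nth_nondecreasing_head z y i : nth_nondecreasing (z :: y) -> (i < length y)%nat -> z <= nth i y 0.
Proof.
  intros H. induction i as [|i IH]; intros Hi.
  - apply (H 0%nat). simpl; lia.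
  - eapply Rle_trans; [apply IH; lia|]. apply (proj2 (proj1 (nth_nondecreasing_cons z y) H)); auto.
Qed.

Lemma nth_insertR_0 x y : y <> nil -> nth 0 (insertR x y) 0 = Rmin (nth 0 y 0) x.
Proof.
  destruct y as [|z y]; [congruence|intros _]. simpl. destruct (Rle_dec x z); simpl.
  - rewrite Rmin_right; auto.
  - rewrite Rmin_left; lra.
Qed.

(** The new entry at position [S i] is [x] clamped between the old neighbours: the lower one if [x]
    lies below it, the upper one if [x] lies above it, [x] otherwise. The companion lemmas treat the
    two ends, where one neighbour is missing. *)
Lemma nth_insertR_S x : forall y i, nth_nondecreasing y -> (S i < length y)%nat ->
  nth (S i) (insertR x y) 0 = Rmax (nth i y 0) (Rmin (nth (S i) y 0) x).
Proof.
  induction y as [|z y IH]; intros i Hy Hi; [simpl in Hi; lia|].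
  simpl in Hi. assert (Hy' := Hy). apply nth_nondecreasing_cons in Hy'. destruct Hy' as [H1 H2].
  simpl insertR. destruct (Rle_dec x z) as [h|h].
  - change (nth (S i) (x :: z :: y) 0) with (nth i (z :: y) 0).
    rewrite Rmax_left; auto. eapply Rle_trans; [apply Rmin_r|].
    eapply Rle_trans; [exact h|]. destruct i; simpl; [lra|]. apply nth_nondecreasing_head; auto; lia.
  - change (nth (S i) (z :: insertR x y) 0) with (nth i (insertR x y) 0).
    change (nth (S i) (z :: y) 0) with (nth i y 0). destruct i as [|i].
    + simpl (nth 0 (z :: y) 0). assert (y <> nil) by (intros ->; simpl in Hi; lia).
      rewrite nth_insertR_0, Rmax_right; auto. apply Rmin_glb; [auto|lra].
    + change (nth (S i) (z :: y) 0) with (nth i y 0). apply IH; auto; lia.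
Qed.

Lemma nth_insertR_last x : forall y i, nth_nondecreasing y -> S i = length y ->
  nth (S i) (insertR x y) 0 = Rmax (nth i y 0) x.
Proof.
  induction y as [|z y IH]; intros i Hy Hi; [simpl in Hi; lia|].
  simpl in Hi. assert (Hy' := Hy). apply nth_nondecreasing_cons in Hy'. destruct Hy' as [H1 H2].
  simpl insertR. destruct (Rle_dec x z) as [h|h].
  - change (nth (S i) (x :: z :: y) 0) with (nth i (z :: y) 0).
    rewrite Rmax_left; auto.
    eapply Rle_trans; [exact h|]. destruct i; simpl; [lra|]. apply nth_nondecreasing_head; auto; lia.
  - change (nth (S i) (z :: insertR x y) 0) with (nth i (insertR x y) 0). destruct i as [|i].
    + destruct y; [|simpl in Hi; lia]. simpl. rewrite Rmax_right; lra.
    + change (nth (S i) (z :: y) 0) with (nth i y 0). apply IH; auto; lia.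
Qed.

Lemma insertR_nondecreasing x : forall y, nth_nondecreasing y -> nth_nondecreasing (insertR x y).
Proof.
  induction y as [|z y IH]; intros Hy.
  - intros i Hi. simpl in Hi; lia.
  - simpl. destruct (Rle_dec x z) as [h|h].
    + apply nth_nondecreasing_cons; split; auto.
    + apply nth_nondecreasing_cons in Hy. destruct Hy as [H1 H2]. apply nth_nondecreasing_cons. split; auto.
      intros _. destruct y as [|w y]; [simpl; lra|].
      rewrite nth_insertR_0 by congruence. apply Rmin_glb; [apply H1; congruence|lra].
Qed.

Lemma sortR_nondecreasing l : nth_nondecreasing (sortR l).
Proof. induction l; simpl; [intros i Hi; simpl in Hi; lia|apply insertR_nondecreasing; auto]. Qed.

(** Probability of exactly [j] successes among [n] trials, by conditioning on one trial. The
    recursive form suits the inductions; [bernstein_formula] gives the closed form. *)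
Fixpoint bernstein (n j : nat) (u : R) : R :=
  match n, j with
  | O, O => 1
  | O, S _ => 0
  | S m, O => (1 - u) * bernstein m 0 u
  | S m, S i => u * bernstein m i u + (1 - u) * bernstein m (S i) u
  end.

(* Probability of at least [j] successes among [n] Bernoulli trials. *)
Fixpoint binomial_tail (n j : nat) (u : R) : R :=
  match n, j with
  | _, O => 1
  | O, S _ => 0
  | S m, S i => u * binomial_tail m i u + (1 - u) * binomial_tail m (S i) u
  end.

Lemma binomial_tail_0 n u : binomial_tail n 0 u = 1.
Proof. destruct n; reflexivity. Qed.

Lemma binomial_tail_diff n : forall j u, binomial_tail n j u - binomial_tail n (S j) u = bernstein n j u.
Proof.
  induction n as [|n IH]; intros j u.
  - destruct j; simpl; ring.
  - destruct j as [|j].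
    + simpl. rewrite <- IH, binomial_tail_0. ring.
    + simpl. rewrite <- !IH. ring.
Qed.

Lemma binomial_tail_gt n : forall j u, (n < j)%nat -> binomial_tail n j u = 0.
Proof.
  induction n as [|n IH]; intros [|j] u Hj; try lia; simpl; auto.
  rewrite !IH by lia. ring.
Qed.

Lemma bernstein_gt n j u : (n < j)%nat -> bernstein n j u = 0.
Proof. intros. rewrite <- binomial_tail_diff, !binomial_tail_gt by lia. ring. Qed.

Lemma binomial_tail_at_0 n : forall j, binomial_tail n (S j) 0 = 0.
Proof. induction n as [|n IH]; intros j; simpl; auto. rewrite IH. ring. Qed.

Lemma binomial_tail_at_1 n : forall j, (j <= n)%nat -> binomial_tail n j 1 = 1.
Proof. induction n as [|n IH]; intros [|j] Hj; try lia; simpl; auto. rewrite IH by lia. ring. Qed.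

Lemma bernstein_bound n : forall j u, 0 <= u <= 1 -> 0 <= bernstein n j u <= 1.
Proof.
  induction n as [|n IH]; intros [|j] u Hu; simpl; try lra.
  - assert (H := IH 0%nat u Hu). nra.
  - assert (H := IH j u Hu). assert (K := IH (S j) u Hu). nra.
Qed.

Lemma continuous_bernstein n : forall j u, continuous (bernstein n j) u.
Proof.
  induction n as [|n IH]; intros [|j] u; simpl.
  - apply continuous_const.
  - apply continuous_const.
  - apply continuous_Rmult; [ccont|apply IH].
  - apply continuous_Rplus; apply continuous_Rmult; try apply IH; ccont.
Qed.

(** Differentiating the recursion gives a difference of two consecutive tails, which is a single
    Bernstein polynomial, and two derivatives that recombine by the recursion of [bernstein]. *)
Lemma is_derive_binomial_tail n : forall j u,
  is_derive (binomial_tail n j) u (match n, j with S m, S i => INR (S m) * bernstein m i u | _, _ => 0 end).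
Proof.
  induction n as [|n IH]; intros [|j] u.
  - apply (is_derive_const (K := R_AbsRing) (V := R_NormedModule)).
  - apply (is_derive_const (K := R_AbsRing) (V := R_NormedModule)).
  - apply (is_derive_const (K := R_AbsRing) (V := R_NormedModule)).
  - assert (H1 := IH j u). assert (H2 := IH (S j) u).
    apply (is_derive_ext (fun u => u * binomial_tail n j u + (1 - u) * binomial_tail n (S j) u)); [reflexivity|].
    auto_derive.
    + repeat split; eexists; eauto.
    + replace (Derive (fun x => binomial_tail n j x) u) with (match n, j with S m, S i => INR (S m) * bernstein m i u | _, _ => 0 end)
        by (symmetry; apply is_derive_unique, H1).
      replace (Derive (fun x => binomial_tail n (S j) x) u) with (match n with S m => INR (S m) * bernstein m j u | _ => 0 end)
        by (symmetry; apply is_derive_unique, H2).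
      assert (D := binomial_tail_diff n j u). rewrite (S_INR n).
      destruct n as [|n].
      * destruct j; simpl in *; lra.
      * destruct j as [|j]; cbn [bernstein] in *; nra.
Qed.

Lemma continuous_Rmax_l x y : continuous (fun y => Rmax y x) y.
Proof.
  apply (continuous_ext (fun y => (y + x + Rabs (y - x)) * / 2)).
  - intros u. unfold Rmax, Rabs. destruct (Rle_dec u x), (Rcase_abs (u - x)); apply Rminus_diag_uniq; lra.
  - ccont.
Qed.

Lemma continuous_Rmin_l x y : continuous (fun y => Rmin y x) y.
Proof.
  apply (continuous_ext (fun y => (y + x - Rabs (y - x)) * / 2)).
  - intros u. unfold Rmin, Rabs. destruct (Rle_dec u x), (Rcase_abs (u - x)); apply Rminus_diag_uniq; lra.
  - ccont.
Qed.

Lemma RInt_C_const_mult (c : C) (w : R -> R) a b : (forall x, continuous w x) ->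
  RInt (V := CR) (fun y => c * RtoC (w y))%C a b = (c * RtoC (RInt w a b))%C.
Proof.
  intros Cw. apply is_RInt_unique, is_RInt_Cmult.
  apply (is_RInt_fct_extend_pair (U := R_NormedModule) (V := R_NormedModule)); simpl.
  - apply (RInt_correct (V := R_CompleteNormedModule)), (ex_RInt_cont (V := R_CompleteNormedModule)), Cw.
  - assert (Z := is_RInt_const (V := R_NormedModule) a b 0).
    replace (scal (b - a) (0 : R_NormedModule)) with 0 in Z by (symmetry; apply Rmult_0_r). exact Z.
Qed.

(** * The density of an order statistic from the iterated integral *)

Section OrderStat.
Variables (p F : R -> R) (Mp : R).
Hypotheses (HF : forall x, is_derive F x (p x)) (Cp : forall x, continuous p x)
  (F0 : F 0 = 0) (Flim : filterlim F pinfty (locally 1)) (F01 : forall x, 0 <= F x <= 1)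
  (Hp : is_RInt_gen (fun x => Rabs (p x)) (at_point 0) pinfty Mp).

Let CF x : continuous F x.
Proof. apply (ex_derive_continuous (K := R_AbsRing) (V := R_NormedModule)). eexists; apply HF. Qed.

(** Density of the [S j]-th smallest of [S n] samples, the derivative of
    [binomial_tail (S n) (S j) (F x)]. *)
Let q n j x := INR (S n) * bernstein n j (F x) * p x.

Let Cq n j x : continuous (q n j) x.
Proof.
  unfold q. apply continuous_Rmult; auto. apply continuous_Rmult; [apply continuous_const|].
  apply (continuous_comp F (bernstein n j)); auto. apply continuous_bernstein.
Qed.

Let q_RInt n j a b : RInt (q n j) a b = binomial_tail (S n) (S j) (F b) - binomial_tail (S n) (S j) (F a).
Proof.
  apply is_RInt_unique.
  apply (is_RInt_derive (V := R_CompleteNormedModule) (fun x => binomial_tail (S n) (S j) (F x)) (q n j)).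
  - intros x _. unfold q.
    assert (H := is_derive_comp (K := R_AbsRing) (V := R_NormedModule) (binomial_tail (S n) (S j)) F x _ _ (is_derive_binomial_tail (S n) (S j) (F x)) (HF x)).
    replace (INR (S n) * bernstein n j (F x) * p x) with (scal (p x) (INR (S n) * bernstein n j (F x)) : R); auto.
    apply Rmult_comm.
  - intros x _. apply Cq.
Qed.

Let q_bound n j x : Rabs (q n j x) <= INR (S n) * Rabs (p x).
Proof.
  unfold q. rewrite Rabs_mult. apply Rmult_le_compat_r; [apply Rabs_pos|].
  assert (B := bernstein_bound n j (F x) (F01 x)). assert (I := pos_INR (S n)).
  rewrite Rabs_pos_eq by (apply Rmult_le_pos; lra).
  rewrite <- (Rmult_1_r (INR (S n))) at 2. apply Rmult_le_compat_l; lra.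
Qed.

Section OneG.
Variables (G : R -> C) (M : R).
Hypotheses (CG : forall x, continuous G x) (BG : forall x, Cmod (G x) <= M).

Let Gq n j x := (G x * RtoC (q n j x))%C.

Let CGq n j x : continuous (Gq n j) x.
Proof. apply continuous_Cmult; auto. apply continuous_RtoC, Cq. Qed.

Lemma half_line_Gq_ex n j :
  is_RInt_gen (V := CR) (Gq n j) (at_point 0) pinfty (RInt_gen (V := CR) (Gq n j) (at_point 0) pinfty).
Proof.
  apply (RInt_gen_correct (V := CR)).
  apply (dominated_ex (V := CR) (Gq n j) (fun x => (M * INR (S n)) * Rabs (p x)) ((M * INR (S n)) * Mp)).
  - intros x. apply continuous_Rmult; [apply continuous_const|apply continuous_Rabs_comp; auto].
  - apply is_RInt_gen_scal_R; auto; typeclasses eauto.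
  - apply CGq.
  - intros x. rewrite <- Cmod_norm. unfold Gq. rewrite Cmod_mult, Cmod_R, Rmult_assoc.
    apply Rmult_le_compat; auto using Cmod_ge_0, Rabs_pos.
Qed.

Let Ginf n j := RInt_gen (V := CR) (Gq n j) (at_point 0) pinfty.
Let V n j x := RInt (V := CR) (Gq n j) 0 x.

(** Split at [x]: below it the integrand is the constant [G x] times the density, above it the clamp
    is inactive. *)
Lemma half_line_max n j x : 0 < x ->
  RInt_gen (V := CR) (fun y => G (Rmax y x) * RtoC (q n j y))%C (at_point 0) pinfty =
  (G x * RtoC (binomial_tail (S n) (S j) (F x)) + (Ginf n j - V n j x))%C.
Proof.
  intros Hx. apply is_RInt_gen_unique.
  assert (Cm : forall y, continuous (fun y => G (Rmax y x) * RtoC (q n j y))%C y).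
  { intros y. apply continuous_Cmult; [|apply continuous_RtoC, Cq].
    apply (continuous_comp (fun y => Rmax y x) G); auto. apply continuous_Rmax_l. }
  apply (lim_half_line (V := CR)); auto.
  apply (filterlim_ext_loc (fun b => G x * RtoC (binomial_tail (S n) (S j) (F x)) + (V n j b - V n j x))%C).
  - exists x. intros b Hb.
    rewrite <- (RInt_Chasles (V := CR) _ 0 x b) by (apply (ex_RInt_cont (V := CR)); auto).
    change (G x * RtoC (binomial_tail (S n) (S j) (F x)) + (V n j b - V n j x) =
      RInt (V := CR) (fun y => G (Rmax y x) * RtoC (q n j y))%C 0 x + RInt (V := CR) (fun y => G (Rmax y x) * RtoC (q n j y))%C x b)%C.
    f_equal.
    + rewrite (RInt_ext (V := CR) _ (fun y => G x * RtoC (q n j y))%C).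
      * rewrite RInt_C_const_mult by apply Cq. rewrite q_RInt, F0, binomial_tail_at_0. do 2 f_equal. ring.
      * intros y Hy. rewrite Rmin_left, Rmax_right in Hy by lra. rewrite Rmax_right; [reflexivity|lra].
    + rewrite (RInt_ext (V := CR) _ (Gq n j)).
      * unfold V. rewrite <- (RInt_Chasles (V := CR) (Gq n j) 0 x b) by (apply (ex_RInt_cont (V := CR)); auto).
        generalize (RInt (V := CR) (Gq n j) 0 x) (RInt (V := CR) (Gq n j) x b). intros u w.
        change (u + w - u = w)%C. ring.
      * intros y Hy. rewrite Rmin_left, Rmax_right in Hy by lra. rewrite Rmax_left; [reflexivity|lra].
  - apply filterlim_Cplus; [apply filterlim_const|]. apply filterlim_Cminus; [|apply filterlim_const].
    apply (half_line_lim (V := CR)), half_line_Gq_ex.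
Qed.

Let binomial_tail_lim n j : (j <= n)%nat -> filterlim (fun b => binomial_tail (S n) (S j) (F b)) pinfty (locally 1).
Proof.
  intros Hj. rewrite <- (binomial_tail_at_1 (S n) (S j)) by lia.
  apply (filterlim_comp _ _ _ F (binomial_tail (S n) (S j)) _ (locally 1)); auto.
  apply (ex_derive_continuous (K := R_AbsRing) (V := R_NormedModule)). eexists; apply is_derive_binomial_tail.
Qed.

(** The mirror image of the preceding split; [j <= n] makes the total mass of [q n j] equal to 1. *)
Lemma half_line_min n j x : 0 < x -> (j <= n)%nat ->
  RInt_gen (V := CR) (fun y => G (Rmin y x) * RtoC (q n j y))%C (at_point 0) pinfty =
  (V n j x + G x * RtoC (1 - binomial_tail (S n) (S j) (F x)))%C.
Proof.
  intros Hx Hj. apply is_RInt_gen_unique.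
  assert (Cm : forall y, continuous (fun y => G (Rmin y x) * RtoC (q n j y))%C y).
  { intros y. apply continuous_Cmult; [|apply continuous_RtoC, Cq].
    apply (continuous_comp (fun y => Rmin y x) G); auto. apply continuous_Rmin_l. }
  apply (lim_half_line (V := CR)); auto.
  apply (filterlim_ext_loc (fun b => V n j x + G x * RtoC (binomial_tail (S n) (S j) (F b) - binomial_tail (S n) (S j) (F x)))%C).
  - exists x. intros b Hb.
    rewrite <- (RInt_Chasles (V := CR) _ 0 x b) by (apply (ex_RInt_cont (V := CR)); auto).
    change (V n j x + G x * RtoC (binomial_tail (S n) (S j) (F b) - binomial_tail (S n) (S j) (F x)) =
      RInt (V := CR) (fun y => G (Rmin y x) * RtoC (q n j y))%C 0 x + RInt (V := CR) (fun y => G (Rmin y x) * RtoC (q n j y))%C x b)%C.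
    f_equal.
    + unfold V. apply (RInt_ext (V := CR)). intros y Hy. rewrite Rmin_left, Rmax_right in Hy by lra.
      rewrite Rmin_left; [reflexivity|lra].
    + rewrite (RInt_ext (V := CR) (fun y => G (Rmin y x) * RtoC (q n j y))%C (fun y => G x * RtoC (q n j y))%C).
      * rewrite RInt_C_const_mult by apply Cq. rewrite q_RInt. reflexivity.
      * intros y Hy. rewrite Rmin_left, Rmax_right in Hy by lra. rewrite Rmin_right; [reflexivity|lra].
  - apply filterlim_Cplus; [apply filterlim_const|]. apply filterlim_Cmult; [apply filterlim_const|].
    apply filterlim_RtoC.
    apply (filterlim_comp _ _ _ (fun b => binomial_tail (S n) (S j) (F b)) (fun t => t - binomial_tail (S n) (S j) (F x)) _ (locally 1)).
    + apply binomial_tail_lim; auto.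
    + change (continuous (fun t => t - binomial_tail (S n) (S j) (F x)) 1). ccont.
Qed.

Let is_derive_V n j x : is_derive (V := CR) (V n j) x (Gq n j x).
Proof.
  apply (is_derive_RInt (V := CR) (Gq n j) (V n j) 0 x); [|apply CGq].
  apply filter_forall. intros b. apply (RInt_correct (V := CR)), (ex_RInt_cont (V := CR)), CGq.
Qed.

Let CV n j x : continuous (V n j) x.
Proof. apply (ex_derive_continuous (K := R_AbsRing) (V := CR)). eexists; apply is_derive_V. Qed.

Let V0 n j : V n j 0 = RtoC 0.
Proof. unfold V. rewrite (RInt_point (V := CR)). reflexivity. Qed.

(* [U] and [V] are the contributions of the [j]-th and [j+1]-st smallest of the other variables;
   the outer integral is then an explicit antiderivative. *)
Lemma half_line_step n j (U dU : R -> C) :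
  (forall x, is_derive (V := CR) U x (- dU x)%C) -> (forall x, continuous dU x) ->
  filterlim U pinfty (locally (RtoC 0)) ->
  (forall x, Gq (S n) j x = (RtoC (F x) * dU x + RtoC (1 - F x) * Gq n j x
     + G x * RtoC (bernstein (S n) j (F x) * p x))%C) ->
  is_RInt_gen (V := CR)
    (fun x => RtoC (p x) * (U x + V n j x + G x * RtoC (bernstein (S n) j (F x))))%C (at_point 0) pinfty (Ginf (S n) j).
Proof.
  intros HU CdU LU E.
  assert (CU : forall x, continuous U x).
  { intros x. apply (ex_derive_continuous (K := R_AbsRing) (V := CR)). eexists; apply HU. }
  (* Integration by parts against [F] and [F - 1]. The shifts are such that only the last term
     survives: at 0 both [F] and [V] vanish, at infinity [U] and [F - 1] do. Hypothesis [E] cancels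
     what the derivatives of [U] and [V] leave over. *)
  set (Phi := fun x => (RtoC (F x) * U x + RtoC (F x - 1) * V n j x + V (S n) j x)%C).
  replace (Ginf (S n) j) with (minus (G := CR) (RtoC 1 * RtoC 0 + RtoC (1 - 1) * Ginf n j + Ginf (S n) j)%C (Phi 0)).
  2: { unfold Phi. rewrite F0, !V0.
       change ((1 * 0 + RtoC (1 - 1) * Ginf n j + Ginf (S n) j) - (0 * U 0%R + RtoC (0 - 1) * 0 + 0) = Ginf (S n) j)%C.
       replace (1 - 1)%R with 0 by ring. ring. }
  apply (is_RInt_gen_of_derive CR Phi).
  - apply filter_forall. intros ab x _. split.
    + assert (D1 := is_derive_RtoC_mult F U x _ _ (HF x) (HU x)).
      assert (HF1 : is_derive (fun x => F x - 1) x (p x)).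
      { replace (p x) with (p x - 0) by ring. apply (is_derive_minus (K := R_AbsRing) (V := R_NormedModule) F (fun _ => 1)); [apply HF|]. apply (is_derive_const (K := R_AbsRing) (V := R_NormedModule)). }
      assert (D2 := is_derive_RtoC_mult (fun x => F x - 1) (V n j) x _ _ HF1 (is_derive_V n j x)).
      assert (D3 := is_derive_plus (V := CR) _ _ x _ _ (is_derive_plus (V := CR) _ _ x _ _ D1 D2) (is_derive_V (S n) j x)).
      replace (RtoC (p x) * (U x + V n j x + G x * RtoC (bernstein (S n) j (F x))))%C with
        ((RtoC (p x) * U x + RtoC (F x) * (- dU x)) + (RtoC (p x) * V n j x + RtoC (F x - 1) * Gq n j x) + Gq (S n) j x)%C.
      * exact D3.
      * rewrite E, !RtoC_minus, RtoC_mult. ring.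
    + apply continuous_Cmult; [apply continuous_RtoC; auto|].
      apply continuous_Cplus; [apply continuous_Cplus; auto; apply CV|].
      apply continuous_Cmult; auto. apply continuous_RtoC.
      apply (continuous_comp F (bernstein (S n) j)); auto. apply continuous_bernstein.
  - intros P HP. unfold filtermap, at_point. apply (locally_singleton _ _ HP).
  - unfold Phi. apply filterlim_Cplus; [apply filterlim_Cplus|].
    + apply filterlim_Cmult; auto. apply filterlim_RtoC; auto.
    + apply filterlim_Cmult.
      * apply filterlim_RtoC.
        apply (filterlim_comp _ _ _ F (fun t => t - 1) _ (locally 1)); auto.
        change (continuous (fun t => t - 1) 1). ccont.
      * apply (half_line_lim (V := CR)), half_line_Gq_ex.
    + apply (half_line_lim (V := CR)), half_line_Gq_ex.
Qed.

Lemma half_line_step_S n i :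
  is_RInt_gen (V := CR)
    (fun x => RtoC (p x) * ((Ginf n i - V n i x) + V n (S i) x + G x * RtoC (bernstein (S n) (S i) (F x))))%C
    (at_point 0) pinfty (Ginf (S n) (S i)).
Proof.
  apply (half_line_step n (S i) (fun x => Ginf n i - V n i x)%C (Gq n i)).
  - intros x.
    assert (D := is_derive_minus (V := CR) (fun _ => Ginf n i) (V n i) x _ _
      (is_derive_const (V := CR) (Ginf n i) x) (is_derive_V n i x)).
    replace (- Gq n i x)%C with (minus (zero : CR) (Gq n i x)); [exact D|].
    change (0 - Gq n i x = - Gq n i x)%C. ring.
  - apply CGq.
  - replace (RtoC 0) with (Ginf n i - Ginf n i)%C by ring.
    apply filterlim_Cminus; [apply filterlim_const|]. apply (half_line_lim (V := CR)), half_line_Gq_ex.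
  (* Split the factor [S n + 1]: the part with [S n] is the recursion of [bernstein], the part with
     1 is the last term. *)
  - intros x. unfold Gq, q. rewrite (S_INR (S n)). cbn [bernstein].
    rewrite !RtoC_mult, !RtoC_plus, !RtoC_minus, !RtoC_mult, !RtoC_minus. ring.
Qed.

(** For the smallest value there is no lower neighbour, so its contribution [U] is 0. *)
Lemma half_line_step_0 n :
  is_RInt_gen (V := CR)
    (fun x => RtoC (p x) * (0 + V n 0 x + G x * RtoC (bernstein (S n) 0 (F x))))%C
    (at_point 0) pinfty (Ginf (S n) 0).
Proof.
  apply (half_line_step n 0 (fun x => RtoC 0) (fun _ => RtoC 0)).
  - intros x. replace (- RtoC 0)%C with (RtoC 0) by ring. apply (is_derive_const (V := CR) (RtoC 0) x).
  - intros; apply continuous_const.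
  - apply filterlim_const.
  - intros x. unfold Gq, q. rewrite (S_INR (S n)). cbn [bernstein].
    rewrite !RtoC_mult, !RtoC_plus, !RtoC_minus. ring.
Qed.
End OneG.

(** Induction on the number of samples with the first one, [x], held fixed. The hypothesis is
    applied to [G] composed with a clamp at [x] and to a constant, hence the quantification over all
    bounded continuous [G]. *)
Lemma order_stat_is_iter_int n : forall j (G : R -> C) (M : R), (j <= n)%nat ->
  (forall x, continuous G x) -> (forall x, Cmod (G x) <= M) ->
  is_iter_int_int (S n) (fun l => G (kth_smallest (S j) l) * RtoC (fold_right Rmult 1 (map p l)))%C
    (RInt_gen (V := CR) (fun x => G x * RtoC (INR (S n) * bernstein n j (F x) * p x))%C (at_point 0) pinfty).
Proof.
  induction n as [|n IH]; intros j G M Hj CG BG.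
  - replace j with 0%nat by lia.
    exists (fun x => G x * RtoC (INR 1 * bernstein 0 0 (F x) * p x))%C. split.
    + intros x Hx. simpl. do 2 f_equal. ring.
    + apply (half_line_Gq_ex G M CG BG 0 0).
  - assert (BM : forall x y, Cmod (G (Rmax y x)) <= M) by auto.
    assert (CM : forall x y, continuous (fun y => G (Rmax y x)) y).
    { intros x y. apply (continuous_comp (fun y => Rmax y x) G); auto. apply continuous_Rmax_l. }
    assert (Bm : forall x y, Cmod (G (Rmin y x)) <= M) by auto.
    assert (Cm : forall x y, continuous (fun y => G (Rmin y x)) y).
    { intros x y. apply (continuous_comp (fun y => Rmin y x) G); auto. apply continuous_Rmin_l. }
    assert (Kth : forall (x : R) l k, kth_smallest (S k) (x :: l) = nth k (insertR x (sortR l)) 0).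
    { intros. unfold kth_smallest. simpl. rewrite Nat.sub_0_r. reflexivity. }
    assert (Kth' : forall l k, kth_smallest (S k) l = nth k (sortR l) 0).
    { intros. unfold kth_smallest. simpl. rewrite Nat.sub_0_r. reflexivity. }
    destruct j as [|i].
    (* Rank one: [x] competes only with the smallest of the others, so a single minimum remains. *)
    + exists (fun x => RtoC (p x) * (0 + RInt (V := CR) (fun x => G x * RtoC (INR (S n) * bernstein n 0 (F x) * p x))%C 0 x + G x * RtoC (bernstein (S n) 0 (F x))))%C. split; [|apply (half_line_step_0 G M CG BG n)].
      intros x Hx.
      assert (I := IH 0%nat (fun y => G (Rmin y x)) M ltac:(lia) (Cm x) (Bm x)); cbv beta in I.
      assert (E1 := half_line_min G CG n 0 x Hx ltac:(lia)). cbv zeta in E1. unfold q in E1. rewrite E1 in I.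
      apply (is_iter_int_Cmult (S n) (RtoC (p x))) in I.
      assert (Tz := binomial_tail_diff (S n) 0 (F x)). rewrite binomial_tail_0 in Tz. rewrite Tz in I.
      rewrite Cplus_0_l. revert I. apply is_iter_int_ext.
      intros l Hl _. rewrite Kth, Kth', nth_insertR_0. simpl map. simpl fold_right. rewrite RtoC_mult. ring.
      intros E. apply (f_equal (@length R)) in E. rewrite sortR_length, Hl in E. simpl in E; lia.
    + exists (fun x => RtoC (p x) * ((RInt_gen (V := CR) (fun x => G x * RtoC (INR (S n) * bernstein n i (F x) * p x))%C (at_point 0) pinfty
         - RInt (V := CR) (fun x => G x * RtoC (INR (S n) * bernstein n i (F x) * p x))%C 0 x)
         + RInt (V := CR) (fun x => G x * RtoC (INR (S n) * bernstein n (S i) (F x) * p x))%C 0 x + G x * RtoC (bernstein (S n) (S i) (F x))))%C.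
      split; [|apply (half_line_step_S G M CG BG n i)].
      intros x Hx.
      assert (I := IH i (fun y => G (Rmax y x)) M ltac:(lia) (CM x) (BM x)); cbv beta in I.
      assert (E1 := half_line_max G M CG BG n i x Hx). cbv zeta in E1. unfold q in E1. rewrite E1 in I.
      (* For [i = n] the largest value is sought and the upper neighbour is missing; correspondingly
         [bernstein n (S n)] is 0. *)
      destruct (Nat.eq_dec i n) as [->|Hin].
      * apply (is_iter_int_Cmult (S n) (RtoC (p x))) in I.
        assert (Tz := binomial_tail_diff (S n) (S n) (F x)). rewrite (binomial_tail_gt (S n) (S (S n))), Rminus_0_r in Tz by lia.
        rewrite Tz in I.
        match goal with |- is_iter_int_int _ _ ?v => match type of I with is_iter_int_int _ _ ?w => replace v with w end end.
        { revert I. apply is_iter_int_ext.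
          intros l Hl _. rewrite Kth, Kth', nth_insertR_last. simpl map. simpl fold_right. rewrite RtoC_mult. ring.
          apply sortR_nondecreasing. rewrite sortR_length; auto. }
        rewrite (RInt_ext (V := CR) (fun x => G x * RtoC (INR (S n) * bernstein n (S n) (F x) * p x))%C (fun _ => RtoC 0)).
        { rewrite (RInt_const (V := CR)). change (scal (x - 0) (RtoC 0)) with (scal (x - 0) (zero : CR)).
          rewrite (scal_zero_r (V := CR)). change (zero : CR) with (RtoC 0). ring. }
        intros y _. rewrite bernstein_gt by lia. rewrite Rmult_0_r, Rmult_0_l. apply Cmult_0_r.
      * assert (I2 := IH (S i) (fun y => G (Rmin y x)) M ltac:(lia) (Cm x) (Bm x)); cbv beta in I2.
        assert (E2 := half_line_min G CG n (S i) x Hx ltac:(lia)). cbv zeta in E2. unfold q in E2. rewrite E2 in I2.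
        (* The correction [- G x] does not depend on the remaining samples; the hypothesis for a
           constant function, at rank one, evaluates its integral to [G x], the total mass being
           1. *)
        assert (I3 := IH 0%nat (fun y => G x) M ltac:(lia) (fun y => continuous_const (G x) y) (fun y => BG x)); cbv beta in I3.
        assert (E3 := half_line_min (fun _ => G x) (fun y => continuous_const (G x) y) n 0 x Hx ltac:(lia)).
        cbv beta zeta in E3. rewrite RInt_C_const_mult in E3 by apply (Cq n 0).
        rewrite (q_RInt n 0), F0, binomial_tail_at_0 in E3. unfold q in E3. rewrite E3 in I3. clear E3.
        apply (is_iter_int_Cmult (S n) (- 1)%C) in I3.
        assert (I4 := is_iter_int_plus _ _ _ _ _ (is_iter_int_plus _ _ _ _ _ I I2) I3). clear I I2 I3.
        apply (is_iter_int_Cmult (S n) (RtoC (p x))) in I4.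
        match goal with |- is_iter_int_int _ _ ?v => match type of I4 with is_iter_int_int _ _ ?w => replace v with w end end.
        { revert I4. apply is_iter_int_ext.
          intros l Hl _. rewrite Kth, !Kth', nth_insertR_S.
          2: apply sortR_nondecreasing. 2: rewrite sortR_length; lia.
          simpl map. simpl fold_right. rewrite RtoC_mult.
          assert (S1 : nth i (sortR l) 0 <= nth (S i) (sortR l) 0).
          { apply sortR_nondecreasing. rewrite sortR_length; lia. }
          set (a := nth i (sortR l) 0) in *. set (b := nth (S i) (sortR l) 0) in *.
          assert (E : (G (Rmax a x) + G (Rmin b x) - G x = G (Rmax a (Rmin b x)))%C).
          { destruct (Rle_lt_dec x a) as [h|h].
            - rewrite (Rmax_left a x), (Rmin_right b x), (Rmax_left a x) by lra. ring.
            - rewrite (Rmax_right a x) by lra. destruct (Rle_lt_dec x b) as [h'|h'].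
              + rewrite (Rmin_right b x), (Rmax_right a x) by lra. ring.
              + rewrite (Rmin_left b x), (Rmax_right a b) by lra. ring. }
          rewrite <- E. ring. }
        rewrite <- (binomial_tail_diff (S n) (S i)). rewrite !RtoC_minus. ring.
Qed.
End OrderStat.

(** * Stretched Laplace integrals *)

(** The exponential substitution yields integrals from [at_right 0], while the iterated integrals
    start from [at_point 0]; for a continuous integrand the piece near 0 tends to 0. *)
Lemma at_right_at_point (f : R -> C) (l : C) : (forall x, continuous f x) ->
  is_RInt_gen (V := CR) f (at_right 0) pinfty l -> is_RInt_gen (V := CR) f (at_point 0) pinfty l.
Proof.
  intros Cf H. apply (lim_half_line (V := CR)); auto.
  apply (filterlim_locally_ball_norm (U := CR)). intros eps.
  assert (He : 0 < eps / 2) by (destruct eps; simpl; lra).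
  destruct (H _ (locally_ball_norm (V := CR) l (mkposreal _ He))) as [Q1 Q2 H1 H2 HQ].
  assert (K : continuous (fun a => RInt (V := CR) f 0 a) 0).
  { apply (ex_derive_continuous (K := R_AbsRing) (V := CR)). exists (f 0).
    apply (is_derive_RInt (V := CR) f (fun a => RInt (V := CR) f 0 a) 0 0); auto.
    apply filter_forall. intros b. apply (RInt_correct (V := CR)), (ex_RInt_cont (V := CR)), Cf. }
  assert (K' := filter_le_within (fun u => 0 < u) (F := locally 0) _ (K _ (locally_ball_norm (V := CR) _ (mkposreal _ He)))).
  destruct (filter_ex (F := at_right 0) _ (filter_and (F := at_right 0) _ _ H1 K')) as [a [Ha1 Ha2]].
  revert H2. apply filter_imp. intros b Hb.
  destruct (HQ a b Ha1 Hb) as [z [Hz Bz]]. simpl in Hz.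
  assert (Bz' : norm (V := CR) (minus (G := CR) z l) < eps / 2) by exact Bz.
  assert (Ba : norm (V := CR) (minus (G := CR) (RInt (V := CR) f 0 a) (RInt (V := CR) f 0 0)) < eps / 2) by exact Ha2.
  rewrite (RInt_point (V := CR)) in Ba.
  change (norm (V := CR) (minus (G := CR) (RInt (V := CR) f 0 b) l) < eps).
  rewrite <- (RInt_Chasles (V := CR) f 0 a b) by (apply (ex_RInt_cont (V := CR)); auto).
  rewrite (is_RInt_unique _ _ _ _ Hz).
  set (y := RInt (V := CR) f 0 a) in *.
  replace (minus (G := CR) (plus y z) l) with (plus (G := CR) (minus (G := CR) y zero) (minus (G := CR) z l)).
  2: { change ((y - 0) + (z - l) = (y + z) - l)%C. ring. }
  eapply Rle_lt_trans; [apply (norm_triangle (V := CR))|]. eapply Rlt_le_trans; [apply Rplus_lt_compat; [exact Ba|exact Bz']|]. lra.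
Qed.

(* [Rpower 0 alpha] is [1]; this is the continuous version, equal to it on positive reals. *)
Definition cpow (alpha d : R) : R := if Rle_dec d 0 then 0 else Rpower d alpha.

Lemma cpow_pos alpha d : 0 < d -> cpow alpha d = Rpower d alpha.
Proof. intros H. unfold cpow. destruct (Rle_dec d 0); [lra|reflexivity]. Qed.

Lemma cpow_ge_0 alpha d : 0 <= cpow alpha d.
Proof. unfold cpow. destruct (Rle_dec d 0); [lra|apply Rlt_le, exp_pos]. Qed.

Lemma continuous_cpow alpha d : 0 < alpha -> continuous (cpow alpha) d.
Proof.
  intros Ha. destruct (Rtotal_order d 0) as [h|[h|h]].
  - apply (continuous_ext_loc _ (fun _ => 0)); [|apply continuous_const].
    assert (Hd : 0 < - d) by lra. exists (mkposreal _ Hd). intros u Hu.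
    assert (B : Rabs (u - d) < - d) by exact Hu. apply Rabs_def2 in B.
    unfold cpow. destruct (Rle_dec u 0); [reflexivity|lra].
  - subst d. apply filterlim_locally. intros eps.
    assert (He : 0 < Rpower eps (/ alpha)) by apply exp_pos.
    exists (mkposreal _ He). intros u Hu.
    assert (B : Rabs (u - 0) < Rpower eps (/ alpha)) by exact Hu. apply Rabs_def2 in B.
    change (Rabs (cpow alpha u - cpow alpha 0) < eps). unfold cpow at 2.
    destruct (Rle_dec 0 0) as [_|]; [|lra].
    rewrite Rminus_0_r, Rabs_pos_eq by apply cpow_ge_0.
    unfold cpow. destruct (Rle_dec u 0); [apply cond_pos|].
    apply Rlt_le_trans with (Rpower (Rpower eps (/ alpha)) alpha).
    + apply Rlt_Rpower_l; auto. lra.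
    + right. rewrite Rpower_mult, Rinv_l, Rpower_1; auto; [apply cond_pos|lra].
  - apply (continuous_ext_loc _ (fun d => exp (alpha * ln d))).
    + exists (mkposreal _ h). intros u Hu.
      assert (B : Rabs (u - d) < d) by exact Hu. apply Rabs_def2 in B.
      rewrite cpow_pos by lra. reflexivity.
    + apply (ex_derive_continuous (K := R_AbsRing) (V := R_NormedModule)). auto_derive. auto.
Qed.

Section LaplaceStretched.
Variable (alpha : R).
Hypothesis (Ha : 0 < alpha).

(** The integral of [exp (- A u - b u^(alpha/2))] over [u > 0], after [u = exp t]. *)
Definition stretched_laplace (A b : C) : C :=
  CInt_R (fun t => Cexp (RtoC t - A * RtoC (exp t) - b * RtoC (exp (alpha / 2 * t))))%C.

Lemma stretched_laplace_dominated A b t : 0 < Re A -> 0 <= Re b ->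
  Cmod (Cexp (RtoC t - A * RtoC (exp t) - b * RtoC (exp (alpha / 2 * t))))%C
    <= kernel_bound 1 (Re A) * exp (- 1 * Rabs t).
Proof.
  intros HA Hb. rewrite Cmod_Cexp. eapply Rle_trans; [|apply (mellin_kernel_real_bound 1 (Re A) t); lra].
  replace (Re _) with (1 * t - Re A * exp t - Re b * exp (alpha / 2 * t)).
  2: { destruct A, b; unfold Re; simpl; ring. }
  assert (E := exp_pos (alpha / 2 * t)).
  assert (L : 1 * t - Re A * exp t - Re b * exp (alpha / 2 * t) <= 1 * t - Re A * exp t) by nra.
  destruct L as [L|L]; [left; apply exp_increasing; auto|right; rewrite L; auto].
Qed.

Lemma stretched_laplace_correct A b : 0 < Re A -> 0 <= Re b ->
  is_RInt_gen (V := CR) (fun t => Cexp (RtoC t - A * RtoC (exp t) - b * RtoC (exp (alpha / 2 * t))))%C minfty pinfty (stretched_laplace A b).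
Proof.
  intros HA Hb. unfold stretched_laplace, CInt_R. apply (RInt_gen_correct (V := CR)).
  apply (dominated_ex (V := CR) _ _ _ (continuous_exp_abs (kernel_bound 1 (Re A)) 1) (is_RInt_gen_exp_abs_scal (kernel_bound 1 (Re A)) 1 Rlt_0_1)).
  - intros t. ccont.
  - intros t. rewrite <- Cmod_norm. apply stretched_laplace_dominated; auto.
Qed.

Lemma stretched_laplace_half_line A b : 0 < Re A -> 0 <= Re b ->
  is_RInt_gen (V := CR) (fun x => RtoC (2 * x) * Cexp (- (A * RtoC (x * x)) - b * RtoC (cpow alpha x)))%C (at_point 0) pinfty (stretched_laplace A b).
Proof.
  intros HA Hb.
  assert (Cf : forall x, continuous (fun x => RtoC (2 * x) * Cexp (- (A * RtoC (x * x)) - b * RtoC (cpow alpha x)))%C x).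
  { intros x. ccont. apply continuous_cpow; auto. }
  apply at_right_at_point; auto.
  apply (is_RInt_gen_exp_subst _ (fun t => Cexp (RtoC t - A * RtoC (exp t) - b * RtoC (exp (alpha / 2 * t))))%C (/ 2)).
  - lra.
  - intros; apply Cf.
  - intros t. rewrite cpow_pos by apply exp_pos. unfold Rpower. rewrite ln_exp, <- exp_plus.
    rewrite Cmult_assoc, <- RtoC_mult.
    replace (/ 2 * exp (/ 2 * t) * (2 * exp (/ 2 * t))) with (exp (/ 2 * t + / 2 * t)).
    2: { rewrite exp_plus. field. }
    rewrite <- (Cexp_R (/ 2 * t + / 2 * t)), <- Cexp_plus. f_equal.
    replace (/ 2 * t + / 2 * t) with t by field. replace (alpha * (/ 2 * t)) with (alpha / 2 * t) by field. rewrite Cexp_R. ring.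
  - apply stretched_laplace_correct; auto.
Qed.

(** At [b = 0] the Mellin-Barnes representation has no meaning, but the integrand has the
    antiderivative [- exp (- A exp t) / A]. *)
Lemma stretched_laplace_0 A : 0 < Re A -> stretched_laplace A 0 = (/ A)%C.
Proof.
  intros HA. unfold stretched_laplace, CInt_R. apply (is_RInt_gen_unique (V := CR)).
  assert (NA : A <> 0%C) by (intros E; rewrite E in HA; simpl in HA; lra).
  replace (/ A)%C with (minus (G := CR) (- / A * RtoC 0)%C (- / A * RtoC 1)%C).
  2: { change (- / A * 0 - - / A * 1 = / A)%C. ring. }
  apply (is_RInt_gen_of_derive CR (fun t => - / A * Cexp (- (A * RtoC (exp t))))%C).
  - apply filter_forall. intros ab t _. split; [|ccont].
    destruct A as [a1 a2].
    assert (D1 := is_derive_Cexp_pair (fun t => - (a1 * exp t)) (fun t => - (a2 * exp t)) t (- (a1 * exp t)) (- (a2 * exp t))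
      ltac:(auto_derive; auto; ring) ltac:(auto_derive; auto; ring)).
    assert (EE : forall t, (- ((a1, a2) * RtoC (exp t)))%C = (- (a1 * exp t), - (a2 * exp t))).
    { intros u. unfold Copp, Cmult, RtoC; simpl. f_equal; ring. }
    assert (D2 : is_derive (V := CR) (fun t => Cexp (- ((a1, a2) * RtoC (exp t)))) t
      (- ((a1, a2) * RtoC (exp t)) * Cexp (- ((a1, a2) * RtoC (exp t))))%C).
    { rewrite EE. revert D1. apply is_derive_ext. intros u. rewrite EE. reflexivity. }
    set (A := ((a1, a2) : C)) in *. clearbody A.
    replace (Cexp (RtoC t - A * RtoC (exp t) - 0 * RtoC (exp (alpha / 2 * t))))%C with
      (- / A * (- (A * RtoC (exp t)) * Cexp (- (A * RtoC (exp t)))))%C.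
    2: { replace (RtoC t - A * RtoC (exp t) - 0 * RtoC (exp (alpha / 2 * t)))%C with (RtoC t + - (A * RtoC (exp t)))%C by ring.
         rewrite Cexp_plus, Cexp_R. field. auto. }
    assert (Lin : forall (f : R -> C) d c, is_derive (V := CR) f t d -> is_derive (V := CR) (fun t => c * f t)%C t (c * d)%C).
    { clear. intros f d c Hf.
      assert (H := filterdiff_comp (K := R_AbsRing) (U := R_NormedModule) (V := C_R_NormedModule) (W := C_R_NormedModule)
        (F := locally t) f (fun z => (c * z)%C) (fun y => scal y d) (fun z => (c * z)%C) Hf).
      unfold is_derive. eapply filterdiff_ext_lin; [apply H|].
      - apply filterdiff_linear. split.
        + intros x y. apply Cmult_plus_distr_l.
        + intros k x. rewrite !scal_R_Cmult. change (c * (RtoC k * x) = RtoC k * (c * x))%C. ring.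
        + exists (Cmod c + 1). split; [generalize (Cmod_ge_0 c); lra|].
          intros x. rewrite <- !Cmod_norm, Cmod_mult. generalize (Cmod_ge_0 c) (Cmod_ge_0 x). nra.
      - intros y. simpl. rewrite !scal_R_Cmult. change (c * (RtoC y * d) = RtoC y * (c * d))%C. ring. }
    apply Lin, D2.
  - apply filterlim_Cmult; [apply filterlim_const|].
    apply (filterlim_comp _ _ _ exp (fun u => Cexp (- (A * RtoC u))) _ (locally 0)).
    + apply is_lim_exp_m.
    + replace (RtoC 1) with (Cexp (- (A * RtoC 0))).
      2: { replace (- (A * RtoC 0))%C with (RtoC 0) by ring. rewrite Cexp_R, exp_0. reflexivity. }
      change (continuous (fun u => Cexp (- (A * RtoC u))) 0). ccont.
  - apply filterlim_Cmult; [apply filterlim_const|].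
    apply (filterlim_C0 _ (fun t => exp (- Re A * t))); [|apply lim_exp_lin_p; auto].
    exists 0. intros t Ht. rewrite Cmod_Cexp.
    replace (Re _) with (- Re A * exp t) by (destruct A; unfold Re; simpl; ring).
    left. apply exp_increasing. assert (t < exp t) by (assert (E := exp_ineq1 t); lra). nra.
Qed.

(** The majorant does not involve [b] as long as [Re b >= 0]; [Rabs a] ensures this on both sides of
    0, and the right-hand limit is then a case of continuity. *)
Lemma stretched_laplace_lim A w : 0 < Re A -> 0 < Re w ->
  filterlim (fun a => stretched_laplace A (RtoC a * w)%C) (at_right 0) (locally (/ A)%C).
Proof.
  intros HA Hw.
  assert (K : continuous (fun a => stretched_laplace A (RtoC (Rabs a) * w)%C) 0).
  { apply (RInt_gen_param_continuous (V := CR) (fun a t => Cexp (RtoC t - A * RtoC (exp t) - (RtoC (Rabs a) * w) * RtoC (exp (alpha / 2 * t))))%C _ _ 0)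
      with (2 := continuous_exp_abs (kernel_bound 1 (Re A)) 1) (3 := is_RInt_gen_exp_abs_scal (kernel_bound 1 (Re A)) 1 Rlt_0_1).
    - intros p. ccont.
    - apply filter_forall. intros a t. rewrite <- Cmod_norm. apply stretched_laplace_dominated; auto.
      destruct w; unfold Re in *; simpl in *. generalize (Rabs_pos a). nra. }
  rewrite <- stretched_laplace_0 by auto.
  apply (filterlim_ext_loc (fun a => stretched_laplace A (RtoC (Rabs a) * w)%C)).
  - exists (mkposreal _ Rlt_0_1). intros a _ H. rewrite Rabs_pos_eq by lra. reflexivity.
  - intros P HP. apply filter_le_within. apply (K P). rewrite Rabs_R0.
    replace (RtoC 0 * w)%C with (RtoC 0) by ring. exact HP.
Qed.
End LaplaceStretched.

(** * Binomial coefficients and finite sums *)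

Lemma binomial_0 n : Binomial.C n 0 = 1.
Proof. unfold Binomial.C. rewrite Nat.sub_0_r. simpl (Factorial.fact 0). simpl (INR 1). field. apply INR_fact_neq_0. Qed.

Lemma binomial_diag n : Binomial.C n n = 1.
Proof. unfold Binomial.C. rewrite Nat.sub_diag. simpl (Factorial.fact 0). simpl (INR 1). field. apply INR_fact_neq_0. Qed.

Lemma bernstein_formula n : forall j u, (j <= n)%nat -> bernstein n j u = Binomial.C n j * u ^ j * (1 - u) ^ (n - j).
Proof.
  induction n as [|n IH]; intros j u Hj.
  - replace j with 0%nat by lia. rewrite binomial_0. simpl. ring.
  - destruct j as [|j].
    + simpl bernstein. rewrite IH by lia. rewrite !Nat.sub_0_r, !binomial_0. simpl pow. ring.
    + simpl bernstein. rewrite IH by lia. destruct (Nat.eq_dec j n) as [->|Hn].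
      * rewrite bernstein_gt by lia. rewrite Nat.sub_diag, Nat.sub_diag, !binomial_diag. simpl; ring.
      * rewrite IH by lia. rewrite <- Binomial.pascal by lia.
        replace (S n - S j)%nat with (n - j)%nat by lia.
        replace (n - j)%nat with (S (n - S j)) by lia. simpl pow. ring.
Qed.

Lemma Csum_ext n f g : (forall l, f l = g l) -> Csum n f = Csum n g.
Proof. intros H; induction n; simpl; auto. rewrite IHn, H; auto. Qed.

Lemma Csum_Cmult n c f : (c * Csum n f = Csum n (fun l => c * f l))%C.
Proof. induction n; simpl; [ring|]. rewrite <- IHn. ring. Qed.

Lemma RtoC_sum_f_R0 f n : RtoC (sum_f_R0 f n) = Csum (S n) (fun l => RtoC (f l)).
Proof.
  induction n; [simpl; ring|].
  change (sum_f_R0 f (S n)) with (sum_f_R0 f n + f (S n)). rewrite RtoC_plus, IHn. reflexivity.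
Qed.

Lemma is_RInt_gen_Csum n (f : nat -> R -> C) (v : nat -> C) Fa Fb {PFa : ProperFilter Fa} {PFb : ProperFilter Fb} :
  (forall l, is_RInt_gen (V := CR) (f l) Fa Fb (v l)) ->
  is_RInt_gen (V := CR) (fun x => Csum n (fun l => f l x)) Fa Fb (Csum n v).
Proof.
  intros H. induction n; simpl.
  - assert (Z := is_RInt_gen_Cmult _ (RtoC 0) _ (H 0%nat)).
    replace (RtoC 0 * v 0%nat)%C with (RtoC 0) in Z by ring.
    revert Z. apply is_RInt_gen_ext. apply filter_forall. intros ab x _. apply Cmult_0_l.
  - apply (is_RInt_gen_plus (V := CR)); auto.
Qed.

Lemma filterlim_Csum {T : Type} {F : (T -> Prop) -> Prop} {FF : Filter F} n (f : nat -> T -> C) (v : nat -> C) :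
  (forall l, filterlim (f l) F (locally (v l))) ->
  filterlim (fun x => Csum n (fun l => f l x)) F (locally (Csum n v)).
Proof. intros H. induction n; simpl; [apply filterlim_const|]. apply filterlim_Cplus; auto. Qed.

(** * The transform of the ordered distance *)

(* Sectors around the positive axis are convex cones. *)
Lemma Clog_sector th0 k q l th : 0 < th0 < PI / 2 -> 0 < k -> 0 < q -> Rabs th < th0 ->
  0 < Re (RtoC k + RtoC q * Cexp (l, th))%C /\
  Rabs (Im (Clog (RtoC k + RtoC q * Cexp (l, th))%C)) < th0.
Proof.
  intros H0 Hk Hq Ht. assert (P := PI_RGT_0). assert (T := Rabs_def2 _ _ Ht).
  assert (El := exp_pos l).
  assert (ER : Re (RtoC k + RtoC q * Cexp (l, th))%C = k + q * (exp l * cos th)) by (unfold Re; simpl; ring).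
  assert (EI : Im (RtoC k + RtoC q * Cexp (l, th))%C = q * (exp l * sin th)) by (unfold Im; simpl; ring).
  set (z := (RtoC k + RtoC q * Cexp (l, th))%C) in *.
  assert (Hz : 0 < Re z).
  { rewrite ER. assert (0 < cos th) by (apply cos_gt_0; lra).
    assert (0 < q * (exp l * cos th)) by (repeat apply Rmult_lt_0_compat; auto). lra. }
  split; auto.
  destruct (polar_pos z Hz) as (lz & tz & Htz & Ez).
  assert (T2 := Rabs_def2 _ _ Htz). rewrite Ez, Clog_Cexp by lra. simpl.
  assert (Elz := exp_pos lz).
  rewrite Ez in ER, EI. unfold Cexp, Re, Im in ER, EI; simpl in ER, EI.
  assert (S0 : 0 < sin th0) by (apply sin_gt_0; lra).
  (* The sector is cut out by positivity of [sin (th0 - arg)] and [sin (th0 + arg)]. Multiplied by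
     the modulus these are linear in the number, and they are positive at [k] and at
     [q * Cexp (l, th)], hence at the sum. *)
  assert (S1 : 0 < exp lz * sin (th0 - tz)).
  { rewrite sin_minus.
    replace (exp lz * (sin th0 * cos tz - cos th0 * sin tz)) with
      (sin th0 * (exp lz * cos tz) - cos th0 * (exp lz * sin tz)) by ring.
    rewrite ER, EI.
    replace (sin th0 * (k + q * (exp l * cos th)) - cos th0 * (q * (exp l * sin th))) with
      (sin th0 * k + q * (exp l * (sin th0 * cos th - cos th0 * sin th))) by ring.
    rewrite <- sin_minus. assert (0 < sin (th0 - th)) by (apply sin_gt_0; lra).
    apply Rplus_lt_0_compat; repeat apply Rmult_lt_0_compat; auto. }
  assert (S2 : 0 < exp lz * sin (th0 + tz)).
  { rewrite sin_plus.
    replace (exp lz * (sin th0 * cos tz + cos th0 * sin tz)) with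
      (sin th0 * (exp lz * cos tz) + cos th0 * (exp lz * sin tz)) by ring.
    rewrite ER, EI.
    replace (sin th0 * (k + q * (exp l * cos th)) + cos th0 * (q * (exp l * sin th))) with
      (sin th0 * k + q * (exp l * (sin th0 * cos th + cos th0 * sin th))) by ring.
    rewrite <- sin_plus. assert (0 < sin (th0 + th)) by (apply sin_gt_0; lra).
    apply Rplus_lt_0_compat; repeat apply Rmult_lt_0_compat; auto. }
  assert (N : forall u, - PI < u -> 0 < exp lz * sin u -> 0 < u).
  { intros u Hu Hs. destruct (Rle_lt_dec u 0) as [h|h]; auto. exfalso.
    assert (sin u <= 0) by (destruct h as [h|h]; [left; apply sin_lt_0_var; lra|right; rewrite h; apply sin_0]).
    nra. }
  assert (N1 := N (th0 - tz) ltac:(lra) S1). assert (N2 := N (th0 + tz) ltac:(lra) S2).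
  apply Rabs_def1; lra.
Qed.

Lemma Clog_Rmult a z : 0 < a -> 0 < Re z -> Clog (RtoC a * z)%C = (Clog z + RtoC (ln a))%C.
Proof.
  intros H Hz. rewrite <- (exp_ln a) at 1 by auto. rewrite Cmult_comm. apply Clog_scale_exp; auto.
Qed.

Section Sector.
Variables (alpha : R) (w : C).
Hypotheses (Ha : 2 < alpha) (Hw : 0 < Re w).

Let w2 := Cpowc w (RtoC (2 / alpha)).

Let w2_polar : exists l th, Rabs th < PI / alpha /\ w2 = Cexp (l, th).
Proof.
  destruct (Cexp_Clog w Hw) as [_ T]. unfold w2, Cpowc. destruct (Clog w) as [l th]. simpl in T.
  exists (2 / alpha * l), (2 / alpha * th). split.
  - rewrite Rabs_mult, Rabs_pos_eq by (apply Rlt_le, Rdiv_lt_0_compat; lra).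
    replace (PI / alpha) with (2 / alpha * (PI / 2)) by (field; lra).
    apply Rmult_lt_compat_l; auto. apply Rdiv_lt_0_compat; lra.
  - f_equal. unfold Cmult, RtoC; simpl. f_equal; ring.
Qed.

(** This is where [alpha > 2] enters: the sector of half-angle [PI / alpha] lies inside the right
    half-plane. *)
Let th0 : 0 < PI / alpha < PI / 2.
Proof.
  assert (P := PI_RGT_0). split; [apply Rdiv_lt_0_compat; lra|].
  apply Rmult_lt_compat_l; auto. apply Rinv_lt_contravar; lra.
Qed.

Lemma Re_Cpowc_pos : 0 < Re (Cpowc w (RtoC (2 / alpha))).
Proof.
  fold w2. destruct w2_polar as (l & th & Ht & ->). simpl. apply Rmult_lt_0_compat; [apply exp_pos|].
  apply Rabs_def2 in Ht. apply cos_gt_0; lra.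
Qed.

Lemma denom_sector omega m : 0 < omega -> (0 < m)%nat ->
  let z := (RtoC (INR m * c_const) + RtoC omega * Cpowc w (RtoC (2 / alpha)))%C in
  0 < Re z /\ Rabs (Im (Clog z)) < PI / alpha.
Proof.
  intros Hom Hm z. unfold z. fold w2. destruct w2_polar as (l & th & Ht & ->). apply Clog_sector; auto.
  apply Rmult_lt_0_compat; [apply lt_0_INR; auto|unfold c_const; lra].
Qed.

End Sector.

(** * Rayleigh-type distances and the associated Laplace integrals *)

Section Main.
Variables (alpha lb omega : R) (w : C).
Hypotheses (Ha : 2 < alpha) (Hlb : 0 < lb) (Hom : 0 < omega) (Hw : 0 < Re w).

Let kap := c_const * lb * PI.
Let Hkap : 0 < kap.
Proof. unfold kap, c_const. apply Rmult_lt_0_compat; [|apply PI_RGT_0]. apply Rmult_lt_0_compat; lra. Qed.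

(** The distribution function on [x >= 0]. On negative reals the same formula keeps the derivative
    [f_d lb] and the range [[0, 1]], so continuity and bounds hold on the whole line without case
    distinction. *)
Let F x := 1 - exp (- (kap * x ^ 2)).

Let is_derive_F x : is_derive F x (f_d lb x).
Proof. unfold F, f_d, kap. auto_derive; auto. simpl (x ^ 2). ring. Qed.

Let continuous_f_d x : continuous (f_d lb) x.
Proof.
  apply (ex_derive_continuous (K := R_AbsRing) (V := R_NormedModule)). unfold f_d. auto_derive. auto.
Qed.

Let F0 : F 0 = 0.
Proof. unfold F. replace (- (kap * 0 ^ 2)) with 0 by ring. rewrite exp_0. ring. Qed.

Let F01 x : 0 <= F x <= 1.
Proof.
  unfold F. assert (E := exp_pos (- (kap * x ^ 2))).
  assert (exp (- (kap * x ^ 2)) <= 1).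
  { rewrite <- exp_0. assert (L : - (kap * x ^ 2) <= 0) by (generalize (pow2_ge_0 x); nra).
    destruct L as [L|L]; [left; apply exp_increasing; auto|right; rewrite L; auto]. }
  lra.
Qed.

Let F_lim : filterlim F pinfty (locally 1).
Proof.
  assert (H : filterlim F pinfty (locally (1 - 0))); [|rewrite Rminus_0_r in H; exact H].
  apply (filterlim_comp _ _ _ (fun x => exp (- (kap * x ^ 2))) (fun t => 1 - t) _ (locally 0)).
  - apply (filterlim_comp _ _ _ (fun x => - (kap * x ^ 2)) exp _ minfty); [|apply is_lim_exp_m].
    (* The [1] in the threshold gives [x <= x ^ 2]. *)
    intros P [M HM]. exists (Rmax 1 (- M / kap)). intros x Hx. apply HM.
    assert (1 <= Rmax 1 (- M / kap)) by apply Rmax_l. assert (- M / kap <= Rmax 1 (- M / kap)) by apply Rmax_r.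
    assert (- M < kap * x).
    { apply (Rmult_lt_reg_l (/ kap)); [apply Rinv_0_lt_compat; auto|].
      rewrite <- Rmult_assoc, Rinv_l, Rmult_1_l by lra. unfold Rdiv in *. rewrite Rmult_comm. lra. }
    assert (kap * x <= kap * x ^ 2) by (apply Rmult_le_compat_l; [lra|]; simpl; nra). lra.
  - change (continuous (fun t => 1 - t) 0). ccont.
Qed.

Let f_d_int : is_RInt_gen (fun x => Rabs (f_d lb x)) (at_point 0) pinfty (1 - 0).
Proof.
  apply (is_RInt_gen_ext (f_d lb)).
  - apply (Filter_prod _ _ _ (fun a => a = 0) (fun b => 0 < b)).
    + reflexivity.
    + exists 0; auto.
    + intros a b -> Hb x Hx. simpl in Hx. apply Rmin_Rmax_pos in Hx; auto.
      symmetry. apply Rabs_pos_eq. unfold f_d. apply Rmult_le_pos; [|apply Rlt_le, exp_pos].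
      assert (P := PI_RGT_0). unfold c_const. apply Rmult_le_pos; [|lra]. apply Rmult_le_pos; [|lra]. apply Rmult_le_pos; lra.
  - apply (is_RInt_gen_of_derive R_CompleteNormedModule F (f_d lb) 0 1).
    + apply filter_forall. intros ab x _. split; auto.
    + intros P HP. unfold filtermap, at_point. rewrite F0. apply (locally_singleton _ _ HP).
    + auto.
Qed.

Let w2 := Cpowc w (RtoC (2 / alpha)).

(** The coefficient of [u = x^2] when [m] factors [1 - F x] meet the interference term; up to
    [PI * lb] it is the denominator of the theorem. *)
Definition laplace_rate (m : nat) : C :=
  (RtoC (PI * lb) * (RtoC (INR m * c_const) + RtoC omega * Cpowc w (RtoC (2 / alpha))))%C.

Lemma laplace_rate_sector m : (0 < m)%nat -> 0 < Re (laplace_rate m) /\ Rabs (Im (Clog (laplace_rate m))) < PI / alpha.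
Proof.
  intros Hm. destruct (denom_sector alpha w Ha Hw omega m Hom Hm) as [H1 H2]. assert (P := PI_RGT_0).
  assert (Hpl : 0 < PI * lb) by (apply Rmult_lt_0_compat; auto). unfold laplace_rate. split.
  - set (z := (RtoC (INR m * c_const) + _)%C) in *. destruct z; unfold Re in *; simpl in *.
    rewrite Rmult_0_l, Rminus_0_r. apply Rmult_lt_0_compat; auto.
  - rewrite Clog_Rmult by auto. destruct (Clog _) as [u v]; simpl in *. rewrite Rplus_0_r. auto.
Qed.

Lemma stretched_laplace_FoxH11 m a gam : (0 < m)%nat -> 0 < a -> 0 < gam < 2 / alpha ->
  stretched_laplace alpha (laplace_rate m) (RtoC a * w)%C =
  (FoxH11 alpha gam (RtoC a * w * Cpowc (laplace_rate m) (RtoC (- (alpha / 2)))) / laplace_rate m)%C.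
Proof.
  intros Hm Ha0 Hg. destruct (laplace_rate_sector m Hm) as [H1 H2].
  assert (Hb : 0 < Re (RtoC a * w)%C).
  { destruct w; unfold Re in *; simpl in *. rewrite Rmult_0_l, Rminus_0_r. apply Rmult_lt_0_compat; auto. }
  unfold stretched_laplace, CInt_R. apply (is_RInt_gen_unique (V := CR)). apply stretched_laplace_mellin_barnes; auto; try lra.
  destruct (Cexp_Clog _ Hb) as [E T]. unfold Cpowc. rewrite <- E at 1. rewrite <- Cexp_plus.
  set (lbg := Clog (RtoC a * w)%C) in *. set (lA := Clog (laplace_rate m)) in *.
  replace (lbg + RtoC (- (alpha / 2)) * lA)%C with (lbg - RtoC (alpha / 2) * lA)%C by (rewrite RtoC_opp; ring).
  replace (lbg - RtoC (alpha / 2) * lA)%C with ((Re lbg - alpha / 2 * Re lA, Im lbg - alpha / 2 * Im lA) : C).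
  2: { destruct lbg, lA; unfold Re, Im, Cminus, Cplus, Copp, Cmult, RtoC; simpl. f_equal; ring. }
  apply Clog_Cexp.
  (* The sector bound [PI / alpha] is scaled by [alpha / 2]; with the angle of [a * w] also below
     [PI / 2], the difference stays strictly between [- PI] and [PI]. *)
  assert (B : Rabs (alpha / 2 * Im lA) < PI / 2).
  { rewrite Rabs_mult, Rabs_pos_eq by lra.
    replace (PI / 2) with (alpha / 2 * (PI / alpha)) by (field; lra). apply Rmult_lt_compat_l; lra. }
  apply Rabs_def2 in B. apply Rabs_def2 in T. lra.
Qed.

Section Rank.
Variables (K r : nat).
Hypotheses (HK : (1 <= K)%nat) (Hr : (1 <= r <= 2 * K)%nat).

Let Gc a d := Cexp (- (RtoC (a * cpow alpha d) * w) - RtoC (PI * lb * omega * d ^ 2) * w2)%C.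

Let continuous_Gc a d : continuous (Gc a) d.
Proof.
  assert (C2 : continuous (fun d => d ^ 2) d).
  { apply (ex_derive_continuous (K := R_AbsRing) (V := R_NormedModule)). auto_derive. auto. }
  unfold Gc. apply continuous_Cexp, continuous_Cminus.
  - apply continuous_Copp, continuous_Cmult; [|apply continuous_const]. apply continuous_RtoC, continuous_Rmult.
    apply continuous_const. apply continuous_cpow; lra.
  - apply continuous_Cmult; [|apply continuous_const]. apply continuous_RtoC, continuous_Rmult; auto.
    apply continuous_const.
Qed.

Let Gc_bound a d : 0 <= a -> Cmod (Gc a d) <= 1.
Proof.
  intros Ha0. unfold Gc. rewrite Cmod_Cexp.
  replace (Re _) with (- (a * cpow alpha d * Re w) - PI * lb * omega * d ^ 2 * Re w2).
  2: { destruct w, w2; unfold Re; simpl; ring. }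
  assert (H1 : 0 <= a * cpow alpha d * Re w) by (apply Rmult_le_pos; [apply Rmult_le_pos; auto using cpow_ge_0|lra]).
  assert (P := PI_RGT_0). assert (Re_w2 : 0 < Re w2) by (apply Re_Cpowc_pos; auto).
  assert (H2 : 0 <= PI * lb * omega * d ^ 2 * Re w2) by (apply Rmult_le_pos; [|lra]; apply Rmult_le_pos; [|apply pow2_ge_0]; apply Rmult_le_pos; [|lra]; apply Rmult_le_pos; lra).
  rewrite <- exp_0. assert (L : - (a * cpow alpha d * Re w) - PI * lb * omega * d ^ 2 * Re w2 <= 0) by lra.
  destruct L as [L|L]; [left; apply exp_increasing; auto|right; rewrite L; auto].
Qed.

Lemma phi_stretched_laplace a : 0 <= a ->
  phi K r alpha lb omega a w =
  (RtoC (c_const * INR r * Binomial.C (2 * K) r)%R *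
   Csum r (fun l => RtoC ((-1) ^ l * Binomial.C (r - 1) l)%R *
     (RtoC (PI * lb) * stretched_laplace alpha (laplace_rate (2 * K - r + l + 1)) (RtoC a * w))))%C.
Proof.
  intros Ha0. unfold phi, E_order_stat. apply is_iter_int_unique.
  destruct (2 * K)%nat as [|n] eqn:En; [lia|]. destruct r as [|j]; [lia|].
  assert (Hj : (j <= n)%nat) by lia.
  assert (I := order_stat_is_iter_int (f_d lb) F 1 is_derive_F continuous_f_d F0 F_lim F01
    ltac:(replace 1 with (1 - 0) by ring; exact f_d_int) n j (Gc a) 1 Hj (continuous_Gc a) (fun d => Gc_bound a d Ha0)).
  match goal with |- is_iter_int_int _ _ ?v => match type of I with is_iter_int_int _ _ ?v' => replace v with v' end end.
  (* All samples in the relation are positive, hence so is the selected one, where [cpow] and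
     [Rpower] agree. *)
  { revert I. apply is_iter_int_ext. intros l Hl Fl. f_equal. unfold Gc.
    assert (Hk : 0 < kth_smallest (S j) l).
    { unfold kth_smallest. simpl. rewrite Nat.sub_0_r.
      assert (Fs : List.Forall (fun y => 0 < y) (sortR l)).
      { clear - Fl. induction Fl as [|x l Hx Fl IH]; simpl; auto.
        induction IH as [|y l' Hy Fl' IH']; simpl; auto. destruct (Rle_dec x y); auto. }
      rewrite List.Forall_forall in Fs. apply Fs. apply nth_In. rewrite sortR_length. lia. }
    rewrite cpow_pos by auto. reflexivity. }
  apply is_RInt_gen_unique.
  replace (S j - 1)%nat with j by lia.
  assert (Hb : 0 <= Re (RtoC a * w)%C).
  { clear - Ha0 Hw. destruct w; unfold Re in *; simpl in *; nra. }
  assert (S1 := fun l => is_RInt_gen_Cmult (Fa := at_point 0) (Fb := pinfty) _ (RtoC ((-1) ^ l * Binomial.C j l)) _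
    (is_RInt_gen_Cmult (Fa := at_point 0) (Fb := pinfty) _ (RtoC (PI * lb)) _
     (stretched_laplace_half_line alpha ltac:(lra) (laplace_rate (S n - S j + l + 1)) (RtoC a * w)%C
        (proj1 (laplace_rate_sector (S n - S j + l + 1) ltac:(lia))) Hb))).
  assert (S2 := is_RInt_gen_Cmult (Fa := at_point 0) (Fb := pinfty) _ (RtoC (c_const * INR (S j) * Binomial.C (S n) (S j))) _
    (is_RInt_gen_Csum (S j) _ _ (at_point 0) pinfty S1)).
  revert S2. apply is_RInt_gen_ext. apply filter_forall. intros ab x _.
  rewrite bernstein_formula by auto.
  (* In terms of [v = 1 - F x] the factor [F x ^ j] is [(1 - v) ^ j]; its expansion is the
     alternating sum over [l]. *)
  set (v := exp (- (kap * x ^ 2))).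
  replace (1 - F x) with v by (unfold F, v; ring).
  replace (F x) with (- v + 1) by (unfold F, v; ring).
  rewrite (Binomial.binomial (- v) 1 j).
  (* With [2 * K = S n] and [r = S j], this turns the prefactor of the density into [r] times the
     binomial coefficient of [2 * K] over [r]. *)
  assert (EC : INR (S n) * Binomial.C n j = INR (S j) * Binomial.C (S n) (S j)).
  { unfold Binomial.C. replace (S n - S j)%nat with (n - j)%nat by lia.
    rewrite !fact_simpl, !mult_INR. field. repeat split; try apply INR_fact_neq_0; apply not_0_INR; lia. }
  transitivity (RtoC (c_const * INR (S j) * Binomial.C (S n) (S j)) *
    Csum (S j) (fun l => RtoC (Binomial.C j l * (- v) ^ l * 1 ^ (j - l)) * (Gc a x * RtoC (v ^ (n - j) * (2 * lb * PI * x * v)))))%C.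
  - apply f_equal. apply Csum_ext. intros l.
    (* The number [2 * K - r + l + 1] counts powers of [v]: [n - j] from the larger samples, [l]
       from the expansion and one from the density [f_d]. *)
    assert (EG : (Gc a x * RtoC (v ^ (n - j) * v ^ l * v) =
       Cexp (- (laplace_rate (S n - S j + l + 1) * RtoC (x * x)) - RtoC a * w * RtoC (cpow alpha x)))%C).
    { replace (v ^ (n - j) * v ^ l * v) with (exp (INR (S n - S j + l + 1) * - (kap * x ^ 2))).
      - rewrite <- Cexp_R. unfold Gc. rewrite <- Cexp_plus. f_equal. unfold laplace_rate, kap; fold w2.
        set (m := INR _). rewrite !RtoC_mult, !RtoC_opp, !RtoC_mult. simpl (x ^ 2). rewrite !RtoC_mult. ring.
      - replace (S n - S j + l + 1)%nat with (S ((n - j) + l)) by lia.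
        replace (v ^ (n - j) * v ^ l * v) with (v ^ (S ((n - j) + l))) by (simpl; rewrite pow_add; ring).
        unfold v. generalize (S (n - j + l)) (- (kap * x ^ 2)). intros m y.
        induction m; [simpl; rewrite Rmult_0_l, exp_0; reflexivity|].
        rewrite S_INR, Rmult_plus_distr_r, exp_plus, IHm, Rmult_1_l. simpl. ring. }
    rewrite <- EG. rewrite pow1. replace ((- v) ^ l) with ((-1) ^ l * v ^ l).
    2: { rewrite <- Rpow_mult_distr. f_equal. ring. }
    rewrite !RtoC_mult. ring.
  - rewrite (Csum_ext (S j) _ (fun l => (Gc a x * RtoC (v ^ (n - j) * (2 * lb * PI * x * v))) * RtoC (Binomial.C j l * (- v) ^ l * 1 ^ (j - l))))%C by (intros; ring).
    rewrite <- Csum_Cmult, <- RtoC_sum_f_R0.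
    set (sg := sum_f_R0 _ j). unfold f_d. fold kap. fold v.
    replace (INR (S n) * (Binomial.C n j * sg * v ^ (n - j)) * (2 * c_const * lb * PI * x * v)) with
      (INR (S n) * Binomial.C n j * (c_const * sg * v ^ (n - j) * (2 * lb * PI * x * v))) by ring.
    rewrite EC, !RtoC_mult. match goal with |- ?u = ?v => change (@eq C u v) end. ring.
Qed.
End Rank.
End Main.

Theorem theorem4 (alpha lb P sig2 omega : R) (K r : nat) (s t : C) :
  2 < alpha -> 0 < lb -> 0 < P -> 0 < sig2 -> 0 < omega ->
  (1 <= K)%nat -> (1 <= r <= 2 * K)%nat ->
  0 < Re s -> 0 < Re t ->
  (forall gam : R, 0 < gam < 2 / alpha ->
     phi K r alpha lb omega (sig2 / P) (s + t)%C =
     (RtoC (c_const * INR r * Binomial.C (2 * K) r)%R *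
      Csum r (fun l =>
        (RtoC ((-1) ^ l * Binomial.C (r - 1) l)%R *
         FoxH11 alpha gam
           (RtoC (sig2 / P)%R * (s + t) *
            Cpowc (RtoC (PI * lb)%R * denom K r l alpha omega (s + t)) (RtoC (- (alpha / 2))%R))
         / denom K r l alpha omega (s + t))%C))%C) /\
  filterlim (fun a : R => phi K r alpha lb omega a (s + t)%C) (at_right 0)
    (locally (RtoC (c_const * INR r * Binomial.C (2 * K) r)%R *
      Csum r (fun l =>
        (RtoC ((-1) ^ l * Binomial.C (r - 1) l)%R / denom K r l alpha omega (s + t))%C))%C).
Proof.
  intros Ha Hlb HP Hsig Hom HK Hr Hs Ht.
  assert (Hw : 0 < Re (s + t)%C) by (destruct s, t; unfold Re in *; simpl in *; lra).
  set (w := (s + t)%C) in *. clearbody w.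
  assert (Hpl : RtoC (PI * lb) <> 0%C).
  { intros E. apply RtoC_inj in E. assert (0 < PI * lb) by (apply Rmult_lt_0_compat; auto; apply PI_RGT_0). lra. }
  assert (Hd : forall l, denom K r l alpha omega w <> 0%C).
  { intros l E. destruct (denom_sector alpha w Ha Hw omega (2 * K - r + l + 1) Hom ltac:(lia)) as [H _].
    unfold denom in E. rewrite E in H. simpl in H. lra. }
  split.
  (* Every admissible abscissa [gam] gives the same value, since the intermediate form by
     [stretched_laplace] does not involve it. *)
  - intros gam Hgam.
    assert (Ha0 : 0 < sig2 / P) by (apply Rdiv_lt_0_compat; auto).
    rewrite (phi_stretched_laplace alpha lb omega w Ha Hlb Hom Hw K r HK Hr) by lra.
    apply f_equal. apply Csum_ext. intros l.
    rewrite (stretched_laplace_FoxH11 alpha lb omega w Ha Hlb Hom Hw (2 * K - r + l + 1) (sig2 / P) gam) by (auto; lia).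
    (* The factor [PI * lb] of the density cancels the one in the rate, leaving [denom] in the
       denominator. *)
    change (laplace_rate alpha lb omega w (2 * K - r + l + 1)) with (RtoC (PI * lb) * denom K r l alpha omega w)%C.
    field. split; auto.
  - apply (filterlim_ext_loc (fun a => (RtoC (c_const * INR r * Binomial.C (2 * K) r)%R *
     Csum r (fun l => RtoC ((-1) ^ l * Binomial.C (r - 1) l)%R *
     (RtoC (PI * lb) * stretched_laplace alpha (RtoC (PI * lb) * denom K r l alpha omega w) (RtoC a * w))))%C)).
    + exists (mkposreal _ Rlt_0_1). intros a _ Ha0. symmetry. apply phi_stretched_laplace; auto. lra.
    + apply filterlim_Cmult; [apply filterlim_const|].
      apply (filterlim_Csum r (fun l a => RtoC ((-1) ^ l * Binomial.C (r - 1) l)%R *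
        (RtoC (PI * lb) * stretched_laplace alpha (RtoC (PI * lb) * denom K r l alpha omega w) (RtoC a * w)))%C).
      intros l.
      replace (RtoC ((-1) ^ l * Binomial.C (r - 1) l) / denom K r l alpha omega w)%C with
        (RtoC ((-1) ^ l * Binomial.C (r - 1) l) * (RtoC (PI * lb) * / (RtoC (PI * lb) * denom K r l alpha omega w)))%C
        by (field; auto).
      apply filterlim_Cmult; [apply filterlim_const|]. apply filterlim_Cmult; [apply filterlim_const|].
      apply stretched_laplace_lim; auto. apply (laplace_rate_sector alpha lb omega w Ha Hlb Hom Hw). lia.
Qed.
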